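(* Let $(M,\omega)$ be a compact Hermitian surface (complex dimension $n=2$). Suppose that $\omega$ is Gauduchon and satisfies $$\Theta^{(3)}(\omega)+\Theta^{(4)}(\omega)=f\omega$$ for some non-positive $f\in C^\infty(M,\mathbb{R})$. Then exactly one of the following holds: (1) $S_C^{(2)}(\omega)\equiv0$; or (2) $\omega$ is Kähler--Einstein with negative scalar curvature.
   Context: All manifolds are connected. A Hermitian metric is identified with its fundamental form $\omega=\sqrt{-1}\,h_{i\bar j}\,dz^i\wedge d\bar z^j$; $(h^{i\bar j})$ is the inverse matrix of $(h_{i\bar j})$. $\omega$ is Gauduchon if $\partial\bar\partial\omega^{n-1}=0$ (so $\partial\bar\partial\omega=0$ when $n=2$). The Chern curvature of $\omega$ is $$\Theta_{i\bar jk\bar l}(\omega)=-\frac{\partial^2h_{k\bar l}}{\partial z^i\partial\bar z^j}+h^{p\bar q}\frac{\partial h_{p\bar l}}{\partial\bar z^j}\frac{\partial h_{k\bar q}}{\partial z^i}.$$ The third and fourth Chern--Ricci curvatures are $\Theta^{(3)}(\omega)=\sqrt{-1}\,\Theta^{(3)}_{i\bar j}dz^i\wedge d\bar z^j$ with $\Theta^{(3)}_{i\bar j}=h^{k\bar l}\Theta_{i\bar lk\bar j}$, and $\Theta^{(4)}(\omega)=\sqrt{-1}\,\Theta^{(4)}_{i\bar j}dz^i\wedge d\bar z^j$ with $\Theta^{(4)}_{i\bar j}=h^{k\bar l}\Theta_{k\bar ji\bar l}$. The second Chern scalar curvature is $S_C^{(2)}(\omega)=h^{i\bar l}h^{k\bar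 j}\Theta_{i\bar jk\bar l}(\omega)$. *)

(* Defs.v *)
From HB Require Import structures.
From mathcomp Require Import all_boot all_order all_algebra complex.
From mathcomp Require Import boolp classical_sets cardinality reals topology.
From mathcomp Require Import normedtype derive.

Set Implicit Arguments.
Unset Strict Implicit.
Unset Printing Implicit Defensive.

Import Order.TTheory GRing.Theory Num.Theory.
Import numFieldNormedType.Exports.

Local Open Scope classical_set_scope.
Local Open Scope ring_scope.

(* The space C^n is modelled by its underlying real space R^(n + n), the point
   z = x + i y being the row vector (x, y); thus z_k = x_k + i y_k. *)
Notation cspace R n := 'rV[R]_(n + n).

Section Calculus.
Variables (R : realType) (n : nat).
Local Notation V := (cspace R n).
Implicit Types (U : set V) (F : V -> R[i]) (g : V -> R) (p : V).

Definition zcoord (k : 'I_n) p : R[i] :=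
  (p ord0 (lshift n k) +i* p ord0 (rshift n k))%C.

Definition basis_vec (m : 'I_(n + n)) : V := delta_mx ord0 m.

Fixpoint Ck (k : nat) U g : Prop :=
  (forall p, U p -> {for p, continuous g}) /\
  if k is k'.+1 then
    forall m : 'I_(n + n),
      (forall p, U p -> derivable g p (basis_vec m)) /\
      Ck k' U (fun p => 'D_(basis_vec m) g p)
  else True.

Definition smooth U g := forall k, Ck k U g.

Definition csmooth U F :=
  smooth U (fun p => complex.Re (F p)) /\ smooth U (fun p => complex.Im (F p)).

(* directional derivative, in the real direction v, of a complex function *)
Definition cderive (v : V) F p : R[i] :=
  ('D_v (fun q => complex.Re (F q)) p +i* 'D_v (fun q => complex.Im (F q)) p)%C.

(* the Wirtinger derivatives d/dz^k and d/d\bar z^k *)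
Definition dz (k : 'I_n) F p : R[i] :=
  (cderive (basis_vec (lshift n k)) F p
   - 'i%C * cderive (basis_vec (rshift n k)) F p) / 2%:R.

Definition dzb (k : 'I_n) F p : R[i] :=
  (cderive (basis_vec (lshift n k)) F p
   + 'i%C * cderive (basis_vec (rshift n k)) F p) / 2%:R.

Definition holomorphic U F :=
  csmooth U F /\ forall p, U p -> forall k : 'I_n, dzb k F p = 0.

Definition hermitian_posdef (H : 'M[R[i]]_n) :=
  (forall i j, H j i = (H i j)^*%C) /\
  (forall v : 'rV[R[i]]_n, v != 0 ->
     0 < \sum_i \sum_j H i j * v ord0 i * (v ord0 j)^*%C).

End Calculus.

(* In the next section h is the matrix (h_{i \bar j}) of a Hermitian metric in
   a coordinate chart, seen as a function of the coordinates. *)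
Section LocalGeometry.
Variables (R : realType) (n : nat) (h : cspace R n -> 'M[R[i]]_n).
Local Notation V := (cspace R n).

Definition coef (i j : 'I_n) : V -> R[i] := fun p => h p i j.

(* h^{i \bar j}, normalised by \sum_q h^{i \bar q} h_{j \bar q} = delta_ij:
   hence the exchange of the indices of the inverse matrix. *)
Definition hup (p : V) (i j : 'I_n) : R[i] := invmx (h p) j i.

Definition chern_curvature (p : V) (i j k l : 'I_n) : R[i] :=
  - dz i (dzb j (coef k l)) p
  + \sum_a \sum_b hup p a b * dzb j (coef a l) p * dz i (coef k b) p.

Definition chern_ricci1 (p : V) (i j : 'I_n) : R[i] :=
  \sum_k \sum_l hup p k l * chern_curvature p i j k l.

Definition chern_ricci3 (p : V) (i j : 'I_n) : R[i] :=
  \sum_k \sum_l hup p k l * chern_curvature p i l k j.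

Definition chern_ricci4 (p : V) (i j : 'I_n) : R[i] :=
  \sum_k \sum_l hup p k l * chern_curvature p k j i l.

Definition chern_scalar1 (p : V) : R[i] :=
  \sum_i \sum_j hup p i j * chern_ricci1 p i j.

Definition chern_scalar2 (p : V) : R[i] :=
  \sum_i \sum_j \sum_k \sum_l
    hup p i l * hup p k j * chern_curvature p i j k l.

(* Coefficient, up to a constant factor, of
   dz^i /\ dz^k /\ d\bar z^j /\ d\bar z^l in
   \partial \bar\partial (\sqrt{-1} h_{k \bar l} dz^k /\ d\bar z^l). *)
Definition ddbar_coef (p : V) (i k j l : 'I_n) : R[i] :=
  dz i (dzb j (coef k l)) p - dz k (dzb j (coef i l)) p
  - dz i (dzb l (coef k j)) p + dz k (dzb l (coef i j)) p.

(* The form is d-closed: both its \partial and its \bar\partial vanish. *)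
Definition dclosed_at (p : V) :=
  (forall i k l : 'I_n, dz i (coef k l) p = dz k (coef i l) p) /\
  (forall k j l : 'I_n, dzb j (coef k l) p = dzb l (coef k j) p).

End LocalGeometry.

Record chart (R : realType) (n : nat) (T : topologicalType) := Chart {
  chart_dom : set T;
  chart_img : set (cspace R n);
  chart_map : T -> cspace R n;
  chart_inv : cspace R n -> T;
  chart_dom_open : open chart_dom;
  chart_img_open : open chart_img;
  chart_map_img : forall x, chart_dom x -> chart_img (chart_map x);
  chart_inv_dom : forall p, chart_img p -> chart_dom (chart_inv p);
  chart_mapK : forall x, chart_dom x -> chart_inv (chart_map x) = x;
  chart_invK : forall p, chart_img p -> chart_map (chart_inv p) = p;
  chart_map_continuous :
    forall x, chart_dom x -> {for x, continuous chart_map};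
  chart_inv_continuous :
    forall p, chart_img p -> {for p, continuous chart_inv}
}.

Definition transition (R : realType) (n : nat) (T : topologicalType)
    (c c' : chart R n T) : cspace R n -> cspace R n :=
  fun p => chart_map c' (chart_inv c p).

Definition overlap (R : realType) (n : nat) (T : topologicalType)
    (c c' : chart R n T) : set (cspace R n) :=
  [set p | chart_img c p /\ chart_dom c' (chart_inv c p)].

(* Manifolds are connected, in particular nonempty: in the library the empty
   set is connected. *)
Record complex_manifold (R : realType) (n : nat) := ComplexManifold {
  carrier :> topologicalType;
  carrier_hausdorff : hausdorff_space carrier;
  carrier_second_countable : @second_countable carrier;
  carrier_nonempty : [set: carrier] !=set0;
  carrier_connected : connected [set: carrier];
  atlas : set (chart R n carrier);
  atlas_cover : forall x : carrier, exists2 c, atlas c & chart_dom c x;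
  atlas_holomorphic : forall c c', atlas c -> atlas c' ->
    forall k : 'I_n,
      holomorphic (overlap c c') (fun p => zcoord k (transition c c' p))
}.

(* A Hermitian metric is given by its coefficient matrices in the charts of the
   atlas; the values of [metric] outside the atlas, or outside the image of
   the chart, are irrelevant. *)
Record hermitian_metric (R : realType) (n : nat) (M : complex_manifold R n) :=
  HermitianMetric {
  metric : chart R n M -> cspace R n -> 'M[R[i]]_n;
  metric_smooth : forall c, atlas c -> forall i j : 'I_n,
    csmooth (chart_img c) (coef (metric c) i j);
  metric_posdef : forall c, atlas c -> forall p, chart_img c p ->
    hermitian_posdef (metric c p);
  metric_compat : forall c c', atlas c -> atlas c' ->
    forall p, overlap c c' p -> forall i j : 'I_n,
      metric c p i j =
      \sum_k \sum_l
        dz i (fun q => zcoord k (transition c c' q)) p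
        * (dz j (fun q => zcoord l (transition c c' q)) p)^*%C
        * metric c' (transition c c' p) k l
}.

Section GlobalGeometry.
Variables (R : realType) (n : nat) (M : complex_manifold R n).
Variable w : hermitian_metric M.

Definition smooth_function (f : M -> R) :=
  forall c, atlas c -> smooth (chart_img c) (fun p => f (chart_inv c p)).

Definition in_charts (P : chart R n M -> cspace R n -> Prop) :=
  forall c, atlas c -> forall p, chart_img c p -> P c p.

(* Theta^(3)(w) + Theta^(4)(w) = f w *)
Definition chern_ricci34_eq (f : M -> R) :=
  in_charts (fun c p => forall i j : 'I_n,
    chern_ricci3 (metric w c) p i j + chern_ricci4 (metric w c) p i j =
    (f (chart_inv c p))%:C%C * metric w c p i j).

Definition chern_scalar2_vanishes :=
  in_charts (fun c p => chern_scalar2 (metric w c) p = 0).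

Definition kahler := in_charts (fun c p => dclosed_at (metric w c) p).

(* For a Kahler metric the Chern and Levi-Civita connections coincide, so that
   chern_ricci1 is the Ricci curvature and chern_scalar1 is the scalar
   curvature, up to the normalising factor 2 of the Riemannian convention. *)
Definition kahler_einstein :=
  kahler /\
  exists lambda : R, in_charts (fun c p => forall i j : 'I_n,
    chern_ricci1 (metric w c) p i j = lambda%:C%C * metric w c p i j).

Definition negative_scalar_curvature :=
  in_charts (fun c p => chern_scalar1 (metric w c) p < 0).

End GlobalGeometry.

(* On a surface w^(n-1) = w, so that Gauduchon means
   \partial \bar\partial w = 0. *)
Definition gauduchon (R : realType) (M : complex_manifold R 2)
    (w : hermitian_metric M) :=
  in_charts (fun c p => forall i k j l : 'I_2,
    ddbar_coef (metric w c) p i k j l = 0).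

Definition exactly_one (P Q : Prop) := (P /\ ~ Q) \/ (~ P /\ Q).

(* Main.v *)
Require Import Defs.
From mathcomp Require Import all_boot all_order all_algebra complex.
From mathcomp Require Import boolp classical_sets reals topology.
From mathcomp Require Import normedtype derive.
From HB Require Import structures.
From mathcomp Require Import functions landau realfun ring lra.

Set Implicit Arguments.
Unset Strict Implicit.
Unset Printing Implicit Defensive.

Import Order.TTheory GRing.Theory Num.Theory.
Import numFieldNormedType.Exports.

Local Open Scope classical_set_scope.
Local Open Scope ring_scope.

(** Write tau for the torsion of h, eta for its trace and rho for the first
    Chern-Ricci form. Then Theta^(3) + Theta^(4) = f h reads
    f h_(i,j) = dbar_j (eta_i - 2 d_i log det h) + d_i conj(eta_j).
    Applying ddbar and the Gauduchon condition yields a second order elliptic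
    equation for f without zero order term, so f is constant by the strong
    maximum principle, and its trace is S_C^(2) = f. If f = c < 0, set
    e = d_1 eta_2 - d_2 eta_1; the equation gives dbar_j e = c tau_j. Since e is
    a section of the canonical bundle, |e|^2 / det h is a function on M, and at
    a positive maximum its Laplacian would be positive, because
    S_C^(1) = c + |eta|^2. Hence e = 0, so c tau = 0, the metric is Kahler and
    rho = (c / 2) h. *)

(** The tensor identities are polynomial identities in h, its derivatives and the inverse of det h,
    so they are proved in a commutative ring with derivations and a conjugation; each chart supplies
    such a ring, its smooth functions. Only positivity and maxima are argued at points. Exchanging
    the two holomorphic indices of the curvature costs dbar of the torsion: this is why Theta^(4)
    differs from rho by dbar eta, and Theta^(3) by the conjugate term. The obstacle in the last step
    is that e is not holomorphic: dbar e = c tau puts first derivatives of tau into the Laplacian of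
    |e|^2. Their trace closes up again because -e is the divergence of tau. Up to det h, it
    contributes -2 c |e|^2 against the c |e|^2 coming from the Ricci term; what remains is -c |e|^2
    plus nonnegative terms in |eta|^2 and |tau|^2, which is where c < 0 enters. The two alternatives
    exclude each other because a Kähler solution has S_C^(1) = c. *)

Section DirectionalDerivatives.
Variables (R : realType) (V : normedModType R).
Implicit Types (g : V -> R) (p v : V).

Lemma is_derive_line g p v (t : R) :
  derivable g (p + t *: v) v ->
  is_derive t 1 (fun s : R => g (p + s *: v)) ('D_v g (p + t *: v)).
Proof.
move=> dg; have E : (fun h : R => h^-1 *: (g (h *: v + (p + t *: v)) - g (p + t *: v)))
   = (fun h : R => h^-1 *: (g (p + (h *: 1 + t) *: v) - g (p + t *: v))).
  apply/funext => h; congr (_ *: (g _ - _)).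
  by rewrite [h *: 1]mulr1 scalerDl addrCA.
by split; [rewrite /derivable -E | rewrite /derive -E].
Qed.

Lemma mean_value_line g p v :
  (forall t : R, 0 <= t <= 1 -> derivable g (p + t *: v) v) ->
  exists2 t : R, 0 < t < 1 & g (p + v) - g p = 'D_v g (p + t *: v).
Proof.
move=> dg.
have H (t : R) : t \in `]0, 1[ ->
    is_derive t 1 (fun s : R => g (p + s *: v)) ('D_v g (p + t *: v)).
  rewrite in_itv/= => /andP[t0 t1]; apply: is_derive_line.
  by apply: dg; rewrite !ltW.
have C : {within `[0, 1], continuous (fun s : R => g (p + s *: v))}.
  apply: derivable_within_continuous => t; rewrite in_itv/= => /dg dgt.
  by have [] := is_derive_line dgt.
have [t] := MVT ltr01 H C.
rewrite in_itv/= => t01; rewrite scale1r scale0r addr0 subr0 mulr1 => E.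
by exists t.
Qed.

Lemma is_deriveZv g p v (c : R) :
  derivable g p v -> is_derive p (c *: v) g (c * 'D_v g p).
Proof.
move=> dg.
have dl : is_derive (0 * c : R) 1 (fun s : R => g (p + s *: v)) ('D_v g p).
  have := @is_derive_line g p v 0; rewrite mul0r scale0r addr0.
  exact.
have dm : is_derive (0 : R) 1 (fun s : R => s * c) c.
  apply: is_derive_eq; rewrite scaler0 add0r [c *: 1]mulr1 //.
have := @is_derive1_comp R (fun s : R => g (p + s *: v)) (fun s : R => s * c) 0 _ c dl dm.
rewrite mulrC => -[H1 H2].
have E : (fun h : R => h^-1 *: (g (h *: (c *: v) + p) - g p)) =
 (fun h : R => h^-1 *: (((fun s : R => g (p + s *: v)) \o (fun s : R => s * c)) (h *: 1 + 0) - ((fun s : R => g (p + s *: v)) \o (fun s : R => s * c)) 0)).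
  apply/funext => h /=; rewrite mul0r scale0r !addr0 [h *: 1]mulr1 scalerA.
  by rewrite [p + _]addrC.
by split; [rewrite /derivable E | rewrite /derive E].
Qed.

Lemma mean_value_scaled g p v (s : R) :
  (forall t : R, 0 <= t <= 1 -> derivable g (p + t *: (s *: v)) v) ->
  exists2 t : R, 0 < t < 1 &
    g (p + s *: v) - g p = s * 'D_v g (p + t *: (s *: v)).
Proof.
move=> dg; have [t t01' E] : exists2 t : R, 0 < t < 1 &
    g (p + s *: v) - g p = 'D_(s *: v) g (p + t *: (s *: v)).
  by apply: mean_value_line => t /dg dt; have [] := is_deriveZv s dt.
have t01 : 0 <= t <= 1 by case/andP: t01' => /ltW -> /ltW ->.
by exists t => //; rewrite E; have [_ ->] := is_deriveZv s (dg _ t01).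
Qed.

End DirectionalDerivatives.

(** * Differentiability of C^1 functions and the chain rule *)

Section Frechet.
Variables (R : realType) (n : nat).
Local Notation V := (cspace R n).
Local Notation e_ := (@basis_vec R n).
Implicit Types (U : set V) (g : V -> R) (p v h : V).

Lemma coord_le_norm h i : `|h ord0 i| <= `|h|.
Proof.
rewrite [leRHS]/Num.Def.normr/= mx_normrE.
exact: (le_bigmax _ (fun i : 'I_1 * 'I_(n + n) => `|h i.1 i.2|) (ord0, i)).
Qed.

Lemma norm_le_coord h (r : R) :
  0 <= r -> (forall i, `|h ord0 i| <= r) -> `|h| <= r.
Proof.
move=> r0 H; rewrite [leLHS]/Num.Def.normr/= mx_normrE.
by apply: bigmax_le => // -[i j] _ /=; rewrite ord1.
Qed.

Lemma row_sum_basis h : h = \sum_i h ord0 i *: e_ i.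
Proof. by rewrite {1}[h]row_sum_delta. Qed.

(** The points [p + truncv k h] form the staircase from [p] to [p + h] whose steps are parallel to
    the axes. *)
Definition truncv (k : nat) h : V := \row_i (if (i < k)%N then h ord0 i else 0).

Lemma continuous_sum (T : topologicalType) (I : Type) (r : seq I)
    (F : I -> T -> R) (x : T) :
  (forall i, {for x, continuous (F i)}) ->
  {for x, continuous (fun y => \sum_(i <- r) F i y)}.
Proof.
move=> cF; elim: r => [|i r IH].
  rewrite (_ : (fun _ => _) = cst 0); first exact: cvg_cst.
  by apply/funext => y; rewrite big_nil.
rewrite (_ : (fun _ => _) = (fun y => F i y + \sum_(i <- r) F i y)).
  by apply: cvgD; [exact: cF | exact: IH].
by apply/funext => y; rewrite big_cons.
Qed.

Lemma truncv0 h : truncv 0 h = 0.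
Proof. by apply/rowP => i; rewrite !mxE. Qed.

Lemma truncv_full h : truncv (n + n) h = h.
Proof. by apply/rowP => i; rewrite !mxE ltn_ord. Qed.

Lemma truncvS h (i : 'I_(n + n)) :
  truncv i.+1 h = truncv i h + h ord0 i *: e_ i.
Proof.
apply/rowP => j; rewrite !mxE eqxx /= ltnS leq_eqVlt -val_eqE /=.
have [E|_] := eqVneq (j : nat) i => /=; last by rewrite mulr0 addr0.
by rewrite E ltnn add0r mulr1; congr (h _ _); apply/val_inj.
Qed.

Lemma Ck_sub k U U' g : U' `<=` U -> Ck k U g -> Ck k U' g.
Proof.
move=> s; elim: k g => [|k IH] g /= [c d]; split => //.
- by move=> p /s; exact: c.
- by move=> p /s; exact: c.
- by move=> m; have [d1 d2] := d m; split; [move=> p /s; exact: d1 | exact: IH].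
Qed.

(** On each step of the staircase the mean value theorem replaces the increment by a partial
    derivative at a nearby point, and continuity of the partials at [p] bounds the error by [e1]
    times the norm of [h]. *)
Lemma C1_increment U g p (eps : R) : open U -> Ck 1 U g -> U p -> 0 < eps ->
  exists2 d, 0 < d & forall h, `|h| < d ->
    `|g (p + h) - g p - \sum_i h ord0 i * 'D_(e_ i) g p| <= eps * `|h|.
Proof.
move=> oU [cg dg] Up eps0.
have N0 : 0 < (n + n).+1%:R :> R by rewrite ltr0n.
(* There are [n + n] steps, each costing [e1]; the successor keeps the divisor nonzero for
   [n = 0]. *)
pose e1 := eps / (n + n).+1%:R.
have e10 : 0 < e1 by rewrite divr_gt0.
have nU : \forall q \near p, U q by exact: open_nbhs_nbhs.
have nD : \forall q \near p, forall i, `|'D_(e_ i) g p - 'D_(e_ i) g q| < e1.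
  apply: (@filter_forall _ 'I_(n + n) (fun i q => `|'D_(e_ i) g p - 'D_(e_ i) g q| < e1) (nbhs p)) => i.
  have cD : {for p, continuous (fun p => 'D_(e_ i) g p)} by apply (dg i).2.
  by move/cvgrPdist_lt : cD; exact.
have := @filterI _ _ (nbhs_filter p) _ _ nU nD.
move=> /nbhs_ballP[d /= d0 Hd]; exists d => // h hd.
have Hb (k : nat) (i : 'I_(n + n)) (t : R) : 0 <= t <= 1 ->
    ball p d (p + truncv i h + t *: (h ord0 i *: e_ i)).
  move=> /andP[t0 t1]; rewrite -ball_normE /= -addrA opprD addNKr normrN.
  apply: le_lt_trans hd; apply: norm_le_coord => // j.
  rewrite !mxE eqxx /=; have [E|ne] := eqVneq j i.
    by rewrite E ltnn add0r mulr1 normrM ger0_norm // (le_trans _ (coord_le_norm h i)) // ler_piMl.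
  rewrite !mulr0 addr0; case: ifP => _; first exact: coord_le_norm.
  by rewrite normr0.
have step (i : 'I_(n + n)) :
    `|g (p + truncv i.+1 h) - g (p + truncv i h) - h ord0 i * 'D_(e_ i) g p| <= e1 * `|h|.
  have [t t01'] : exists2 t : R, 0 < t < 1 &
      g (p + truncv i h + h ord0 i *: e_ i) - g (p + truncv i h) =
      'D_(h ord0 i *: e_ i) g (p + truncv i h + t *: (h ord0 i *: e_ i)).
    apply: mean_value_line => t t01; have [Uq _] := Hd _ (Hb 0%N i t t01).
    by have [] := is_deriveZv (h ord0 i) ((dg i).1 _ Uq).
  have t01 : 0 <= t <= 1 by case/andP: t01' => /ltW -> /ltW ->.
  have [Uq He] := Hd _ (Hb 0%N i t t01).
  have [_ ->] := is_deriveZv (h ord0 i) ((dg i).1 _ Uq).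
  rewrite truncvS addrA => ->; rewrite -mulrBr normrM mulrC.
  by rewrite ler_pM // ?coord_le_norm // distrC ltW.
have -> : g (p + h) - g p - \sum_i h ord0 i * 'D_(e_ i) g p =
  \sum_(i < n + n) (g (p + truncv i.+1 h) - g (p + truncv i h) - h ord0 i * 'D_(e_ i) g p).
  rewrite sumrB; congr (_ - _).
  rewrite -(big_mkord xpredT (fun i => g (p + truncv i.+1 h) - g (p + truncv i h))).
  by rewrite telescope_sumr // truncv0 truncv_full addr0.
apply: le_trans (ler_norm_sum _ _ _) _.
apply: (le_trans (ler_sum _ (fun i _ => step i))).
rewrite sumr_const card_ord -mulr_natl mulrA ler_wpM2r //.
by rewrite /e1 mulrCA ler_piMr ?(ltW eps0) // ler_pdivrMr // mul1r ler_nat.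
Qed.

Lemma C1_differentiable U g p : open U -> Ck 1 U g -> U p -> differentiable g p.
Proof.
move=> oU Cg Up; pose J : 'M[R]_(n + n, 1) := \col_i 'D_(e_ i) g p.
pose L : V -> R := fun h => \sum_i h ord0 i * 'D_(e_ i) g p.
have linL : linear L.
  move=> a x y; rewrite /L scaler_sumr -big_split /=; apply: eq_bigr => i _.
  by rewrite !mxE mulrDl -mulrA.
pose lL : {linear V -> R} := HB.pack L (GRing.isLinear.Build R V R *:%R L linL).
have cL : continuous lL.
  by move=> h; apply: continuous_sum => i; apply: continuousM; [exact: coord_continuous | exact: cst_continuous].
have oL : g \o shift p = cst (g p) + lL +o_ (0 : V) id.
  apply/eqaddoP => eps eps0.
  have [d d0 Hd] := C1_increment oU Cg Up eps0.
  have N : \forall h \near (0 : V), `|h| < d by exact: nbhs0_lt.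
  apply: filterS N => h hd.
  have -> : (g \o shift p - (cst (g p) + lL)) h = g (p + h) - g p - L h.
    by rewrite -addrA -opprD [p + h]addrC.
  exact: Hd.
have E := diff_unique cL oL.
by apply/diff_locallyP; rewrite E.
Qed.

Lemma C1_derive_sum U g p v : open U -> Ck 1 U g -> U p ->
  'D_v g p = \sum_i v ord0 i * 'D_(e_ i) g p.
Proof.
move=> oU Cg Up; have dg := C1_differentiable oU Cg Up.
rewrite deriveE // {1}[v]row_sum_basis linear_sum; apply: eq_bigr => i _.
by rewrite linearZ /= -deriveE.
Qed.

(** Only the directional derivative of [phi] is available, so the chain rule is applied to the curve
    [c t = phi (t *: w + q)], for which derivable and differentiable coincide. *)
Lemma derivable_comp_chain (W : normedModType R) (phi : W -> V) g (q w : W) :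
  differentiable g (phi q) ->
  (forall i, derivable (fun x => phi x ord0 i) q w) ->
  is_derive q w (g \o phi)
    (\sum_i 'D_w (fun x => phi x ord0 i) q * 'D_(e_ i) g (phi q)).
Proof.
move=> dg dphi.
have dp : derivable phi q w by apply/derivable_mxP => i j; rewrite ord1.
pose c := fun t : R => phi (t *: w + q).
have c0 : c 0 = phi q by rewrite /c scale0r add0r.
have dc : derivable c 0 1 by move/derivable1P: dp.
have dcd : differentiable c 0 by apply/derivable1_diffP.
have dgc : differentiable g (c 0) by rewrite c0.
have dgd : differentiable (g \o c) 0 by apply: differentiable_comp.
have dgl : derivable (g \o phi) q w by apply/derivable1P; apply/derivable1_diffP.
split => //.
have E1 : 'D_w (g \o phi) q = 'D_1 (g \o c) 0.
  rewrite /derive; set g1 := fun h : R => h^-1 *: _; set g2 := fun h : R => h^-1 *: _.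
  suff -> : g1 = g2 by []; apply/funext => h; rewrite /g1 /g2 /=.
  by rewrite /c addr0 scale0r add0r [h *: 1]mulr1.
have E2 : 'D_w phi q = 'D_1 c 0.
  rewrite /derive; set g1 := fun h : R => h^-1 *: _; set g2 := fun h : R => h^-1 *: _.
  suff -> : g1 = g2 by []; apply/funext => h; rewrite /g1 /g2 /=.
  by rewrite /c addr0 scale0r add0r [h *: 1]mulr1.
have Ec : 'd c 0 1 = 'D_w phi q by rewrite E2 deriveE.
rewrite E1 deriveE // diff_comp //= Ec c0 (derive_mx dp).
rewrite [X in 'd g _ X]row_sum_basis linear_sum; apply: eq_bigr => i _.
by rewrite linearZ /= -deriveE // mxE.
Qed.

End Frechet.

(** * The algebra of C^k functions *)

Section SmoothAlgebra.
Variables (R : realType) (n : nat).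
Local Notation V := (cspace R n).
Local Notation e_ := (@basis_vec R n).
Implicit Types (U : set V) (f g : V -> R) (p v : V) (k : nat).

Lemma Ck_cont k U g p : Ck k U g -> U p -> {for p, continuous g}.
Proof. by case: k => [|k] [c _]; exact: c. Qed.

Lemma Ck_derivable k U g p m : Ck k.+1 U g -> U p -> derivable g p (e_ m).
Proof. by move=> [_ /(_ m)[d _]]; exact: d. Qed.

Lemma Ck_deriv k U g m : Ck k.+1 U g -> Ck k U (fun p => 'D_(e_ m) g p).
Proof. by move=> [_ /(_ m)[_ d]]. Qed.

Lemma CkW k U g : Ck k.+1 U g -> Ck k U g.
Proof.
elim: k g => [|k IH] g [c d]; split => // m.
by have [d1 d2] := d m; split => //; exact: IH.
Qed.

Lemma Ck_le k l U g : (k <= l)%N -> Ck l U g -> Ck k U g.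
Proof.
elim: l => [|l IH]; first by rewrite leqn0 => /eqP ->.
by rewrite leq_eqVlt => /predU1P[->//|/IH H /CkW].
Qed.

Lemma near_open U (T : Type) (f g : V -> T) p : open U -> U p ->
  (forall q, U q -> f q = g q) -> \forall q \near p, f q = g q.
Proof. by move=> oU Up E; apply: filterS (open_nbhs_nbhs (conj oU Up)). Qed.

Lemma near_eq_cont (f g : V -> R) p :
  (\forall q \near p, f q = g q) ->
  {for p, continuous f} -> {for p, continuous g}.
Proof.
move=> E c; have c' : f @ p --> f p := c.
suff : g @ p --> g p by []; rewrite -(nbhs_singleton E).
have E' : \forall q \near p, g q = f q by apply: filterS E => q ->.
apply: cvg_trans c'; first [exact: (near_eq_cvg E')|exact: (near_eq_cvg E)].
Qed.

Lemma Ck_ext k U f g : open U -> (forall p, U p -> f p = g p) ->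
  Ck k U f -> Ck k U g.
Proof.
move=> oU; elim: k f g => [|k IH] f g E [c d]; split => //.
- by move=> p Up; apply: near_eq_cont (c p Up); exact: near_open E.
- by move=> p Up; apply: near_eq_cont (c p Up); exact: near_open E.
- move=> m; have [d1 d2] := d m; split.
    by move=> p Up; apply: near_eq_derivable (d1 p Up); exact: near_open E.
  apply: IH d2 => p Up; apply: near_eq_derive; exact: near_open E.
Qed.

Lemma Ck_eq k U f g : f =1 g -> Ck k U f -> Ck k U g.
Proof. by move=> /funext ->. Qed.

Lemma Ck_cst k U (a : R) : Ck k U (fun=> a).
Proof.
elim: k a => [|k IH] a; split => //; try by move=> p _; exact: cst_continuous.
move=> m; split; first by move=> p _; exact: derivable_cst.
by apply: (Ck_eq _ (IH 0)) => p; rewrite derive_cst.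
Qed.

Lemma CkD k U f g : open U -> Ck k U f -> Ck k U g ->
  Ck k U (fun p => f p + g p).
Proof.
move=> oU; elim: k f g => [|k IH] f g Cf Cg; split => //;
  try by move=> p Up; apply: continuousD; [exact: Ck_cont Cf Up|exact: Ck_cont Cg Up].
move=> m; split.
  by move=> p Up; apply: derivableD; [exact: Ck_derivable Cf Up|exact: Ck_derivable Cg Up].
apply: (Ck_ext oU _ (IH _ _ (Ck_deriv m Cf) (Ck_deriv m Cg))) => p Up.
by rewrite deriveD //; [exact: Ck_derivable Cf Up|exact: Ck_derivable Cg Up].
Qed.

Lemma CkM k U f g : open U -> Ck k U f -> Ck k U g ->
  Ck k U (fun p => f p * g p).
Proof.
move=> oU; elim: k f g => [|k IH] f g Cf Cg; split => //;
  try by move=> p Up; apply: continuousM; [exact: Ck_cont Cf Up|exact: Ck_cont Cg Up].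
move=> m; split.
  by move=> p Up; apply: derivableM; [exact: Ck_derivable Cf Up|exact: Ck_derivable Cg Up].
apply: (Ck_ext oU _ (CkD oU (IH _ _ (CkW Cf) (Ck_deriv m Cg))
                            (IH _ _ (CkW Cg) (Ck_deriv m Cf)))) => p Up.
by rewrite deriveM //; [exact: Ck_derivable Cf Up|exact: Ck_derivable Cg Up].
Qed.

Lemma CkN k U f : open U -> Ck k U f -> Ck k U (fun p => - f p).
Proof.
move=> oU Cf; apply: (Ck_ext oU _ (CkM oU (Ck_cst k U (-1)) Cf)) => p _.
by rewrite mulN1r.
Qed.

Lemma CkV k U f : open U -> (forall p, U p -> f p != 0) -> Ck k U f ->
  Ck k U (fun p => (f p)^-1).
Proof.
move=> oU f0; elim: k => [|k IH] Cf; split => //;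
  try by move=> p Up; apply: continuousV; [exact: f0|exact: Ck_cont Cf Up].
move=> m; split.
  by move=> p Up; apply: derivableV; [exact: f0|exact: Ck_derivable Cf Up].
have CV := IH (CkW Cf).
apply: (Ck_ext oU _ (CkN oU (CkM oU (CkM oU CV CV) (Ck_deriv m Cf)))) => p Up.
rewrite deriveV; [|exact: f0|exact: Ck_derivable Cf Up].
by rewrite -mulNr expr2 invfM.
Qed.

Lemma Ck_sum k U (I : Type) (r : seq I) (F : I -> V -> R) : open U ->
  (forall i, Ck k U (F i)) -> Ck k U (fun p => \sum_(i <- r) F i p).
Proof.
move=> oU CF; elim: r => [|i r IH].
  by apply: (Ck_ext oU _ (Ck_cst k U 0)) => p _; rewrite big_nil.
by apply: (Ck_ext oU _ (CkD oU (CF i) IH)) => p _; rewrite big_cons.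
Qed.

Lemma is_derive_coord (i : 'I_(n + n)) p v :
  is_derive p v (fun q : V => q ord0 i) (v ord0 i).
Proof.
have dI := @derivable_id R V p v.
split; first by have /derivable_mxP := dI; exact.
by have := derive_mx dI; rewrite derive_id => /rowP/(_ i); rewrite mxE => <-.
Qed.

Lemma Ck_coord k U (i : 'I_(n + n)) : Ck k U (fun q : V => q ord0 i).
Proof.
case: k => [|k]; split => //; try by move=> p _; exact: coord_continuous.
move=> m; split; first by move=> p _; have [] := is_derive_coord i p (e_ m).
apply: (Ck_eq _ (Ck_cst k U (e_ m ord0 i))) => p.
by have [_ ->] := is_derive_coord i p (e_ m).
Qed.

(** The chain rule writes a partial of the composite as a sum of products of partials of [phi] with
    composites of partials of [g], to which the induction hypothesis applies. *)
Lemma Ck_comp k U U' (phi : V -> V) g : open U -> open U' ->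
  (forall p, U p -> U' (phi p)) ->
  (forall p, U p -> {for p, continuous phi}) ->
  (forall i, Ck k U (fun p => phi p ord0 i)) ->
  Ck k U' g -> Ck k U (fun p => g (phi p)).
Proof.
move=> oU oU' sU cphi; elim: k g => [|k IH] g Cphi Cg; split => //;
  try by move=> p Up; apply: continuous_comp; [exact: cphi|exact: Ck_cont Cg (sU p Up)].
move=> m.
have H p (Up : U p) := derivable_comp_chain
  (C1_differentiable oU' (Ck_le (isT : 0 < k.+1)%N Cg) (sU p Up))
  (fun i => Ck_derivable (m:=m) (Cphi i) Up).
split; first by move=> p Up; have [] := H p Up.
have := @Ck_sum k U _ (index_enum 'I_(n + n)) (fun i p => 'D_(e_ m) (fun x => phi x ord0 i) p * 'D_(e_ i) g (phi p)) oU.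
move=> HH; apply: (Ck_ext oU _ (HH _)).
  by move=> p Up; have [_ <-] := H p Up.
move=> i; apply: CkM => //; first exact: Ck_deriv.
exact: (IH (fun q => 'D_(e_ i) g q) (fun j => CkW (Cphi j)) (Ck_deriv i Cg)).
Qed.

Lemma open_ball U p : open U -> U p ->
  exists2 d : R, 0 < d & forall v, `|v| < d -> U (p + v).
Proof.
move=> oU Up; have /nbhs_ballP[d /= d0 Hd] := open_nbhs_nbhs (conj oU Up).
by exists d => // v vd; apply: Hd; rewrite -ball_normE /= opprD addNKr normrN.
Qed.

Lemma derivable_shift g w p v :
  derivable g (p + w) v -> is_derive p v (fun q => g (q + w)) ('D_v g (p + w)).
Proof.
move=> dg; have E : (fun h : R => h^-1 *: (g (h *: v + (p + w)) - g (p + w)))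
   = (fun h : R => h^-1 *: (g (h *: v + p + w) - g (p + w))).
  by apply/funext => h; rewrite addrA.
by split; [rewrite /derivable -E | rewrite /derive -E].
Qed.

(** Two mean value arguments: along [e_ i] for [u q = g (q + s e_j) - g q], then along [e_ j]. The
    left side is symmetric in [i] and [j], which is the source of [schwarz]. *)
Lemma second_difference U g p (s d : R) (i j : 'I_(n + n)) :
  Ck 2 U g -> (forall v, `|v| < d -> U (p + v)) -> 0 < s -> s + s < d ->
  exists2 v, `|v| < d &
    g (p + s *: e_ i + s *: e_ j) - g (p + s *: e_ i) - g (p + s *: e_ j) + g p
    = s * s * 'D_(e_ j) (fun q => 'D_(e_ i) g q) (p + v).
Proof.
move=> Cg Ub s0 sd.
have ne (l : 'I_(n + n)) : `|e_ l| <= 1.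
  by apply: norm_le_coord => // m; rewrite mxE eqxx /=; case: (m == l); rewrite ?normr1 ?normr0.
have nb (a b : R) : 0 <= a <= 1 -> 0 <= b <= 1 ->
    `|(a * s) *: e_ i + (b * s) *: e_ j| < d.
  move=> /andP[a0 a1] /andP[b0 b1]; apply: le_lt_trans sd.
  apply: (le_trans (ler_normD _ _)); rewrite !normrZ.
  rewrite !ger0_norm ?mulr_ge0 ?(ltW s0) //.
  apply: lerD; rewrite -[leRHS]mul1r -mulrA; apply: ler_pM => //;
    by rewrite ?mulr_ge0 ?(ltW s0) // ler_piMr ?(ltW s0).
have o01 : 0 <= (1 : R) <= 1 by rewrite ler01 lexx.
have z01 : 0 <= (0 : R) <= 1 by rewrite ler01 lexx.
have dg m q : U q -> derivable g q (e_ m) by move=> Uq; exact: Ck_derivable Cg Uq.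
pose u q := g (q + s *: e_ j) - g q.
have du (t : R) : 0 <= t <= 1 ->
    is_derive (p + t *: (s *: e_ i)) (e_ i) u
      ('D_(e_ i) g (p + t *: (s *: e_ i) + s *: e_ j) - 'D_(e_ i) g (p + t *: (s *: e_ i))).
  move=> t01; apply: is_deriveB.
    apply: derivable_shift; apply: dg; rewrite -addrA; apply: Ub.
    by have := nb t 1 t01 o01; rewrite mul1r scalerA.
  apply: derivableP; apply: dg; apply: Ub; rewrite scalerA.
  by have := nb t 0 t01 z01; rewrite mul0r scale0r addr0.
have [t t01' ] := mean_value_scaled (fun t t01 => let: DeriveDef d _ := du t t01 in d).
have t01 : 0 <= t <= 1 by case/andP: t01' => /ltW -> /ltW ->.
have [_ ->] := du t t01.
set q := p + t *: (s *: e_ i).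
have dd (b : R) : 0 <= b <= 1 ->
    derivable (fun x => 'D_(e_ i) g x) (q + b *: (s *: e_ j)) (e_ j).
  move=> b01; apply: (Ck_derivable (m:=j) (Ck_deriv i Cg)).
  by rewrite /q -addrA !scalerA; apply: Ub; exact: nb.
have [b b01' ->] := mean_value_scaled dd.
have b01 : 0 <= b <= 1 by case/andP: b01' => /ltW -> /ltW ->.
move=> E; exists ((t * s) *: e_ i + (b * s) *: e_ j); first exact: nb.
rewrite addrA -!scalerA -/q -mulrA -E /u.
by rewrite opprB addrA [RHS]addrAC.
Qed.

End SmoothAlgebra.

(** * Symmetry of second derivatives, and the real Hessian at a maximum *)

Section TwiceDifferentiable.
Variables (R : realType) (n : nat).
Local Notation V := (cspace R n).
Local Notation e_ := (@basis_vec R n).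
Implicit Types (U : set V) (f g : V -> R) (p v : V) (k : nat).

(** The increments [v] and [w] may differ, as do the intermediate points that [second_difference]
    yields for the two orders of differentiation. *)
Lemma eq_at_of_near (F G : V -> R) p :
  {for p, continuous F} -> {for p, continuous G} ->
  (forall d : R, 0 < d -> exists v w,
     [/\ `|v| < d, `|w| < d & F (p + v) = G (p + w)]) ->
  F p = G p.
Proof.
move=> cF cG FG; apply/eqP; apply: contraT => ne.
have eps0 : 0 < `|F p - G p| / 2 by rewrite divr_gt0 // normr_gt0 subr_eq0.
have near_val (H : V -> R) : {for p, continuous H} ->
    exists2 d : R, 0 < d & forall v, `|v| < d ->
    `|H p - H (p + v)| < `|F p - G p| / 2.
  move=> c; have /cvgrPdist_lt/(_ _ eps0)/nbhs_ballP[d /= d0 Hd] : H @ p --> H p by [].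
  exists d => // v vd; apply: Hd.
  by rewrite -ball_normE /= opprD addNKr normrN.
have [d1 d1p H1] := near_val _ cF; have [d2 d2p H2] := near_val _ cG.
have dp : 0 < Num.min d1 d2 by rewrite lt_min d1p.
have [v [w [+ + E]]] := FG _ dp.
rewrite !lt_min => /andP[v1 _] /andP[_ w2].
have := H1 _ v1; have := H2 _ w2; rewrite -E; set X := F (p + v) => HB HA.
have T := ler_normD (F p - X) (X - G p); rewrite addrA subrK in T.
rewrite distrC in HB.
have := le_lt_trans T (ltrD HA HB).
by rewrite -splitr ltxx.
Qed.

Lemma schwarz U g p i j : open U -> Ck 2 U g -> U p ->
  'D_(e_ j) (fun q => 'D_(e_ i) g q) p = 'D_(e_ i) (fun q => 'D_(e_ j) g q) p.
Proof.
move=> oU Cg Up; apply: (@eq_at_of_near (fun p => 'D_(e_ j) (fun q => 'D_(e_ i) g q) p)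
  (fun p => 'D_(e_ i) (fun q => 'D_(e_ j) g q) p)).
- exact: (Ck_cont (Ck_deriv j (Ck_deriv i Cg)) Up).
- exact: (Ck_cont (Ck_deriv i (Ck_deriv j Cg)) Up).
move=> d' d'0; have [d0 d0p H0] := open_ball oU Up.
pose d := Num.min d0 d'.
have dp : 0 < d by rewrite lt_min d0p.
have s0 : 0 < d / 3 by rewrite divr_gt0.
have sd : d / 3 + d / 3 < d by lra.
have Ub v : `|v| < d -> U (p + v) by rewrite lt_min => /andP[/H0].
have [v vd E1] := second_difference i j Cg Ub s0 sd.
have [w wd E2] := second_difference j i Cg Ub s0 sd.
have s20 : d / 3 * (d / 3) != 0 by rewrite mulf_neq0 // gt_eqF.
have E : g (p + d / 3 *: e_ i + d / 3 *: e_ j) - g (p + d / 3 *: e_ i)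
    - g (p + d / 3 *: e_ j) + g p =
  g (p + d / 3 *: e_ j + d / 3 *: e_ i) - g (p + d / 3 *: e_ j)
    - g (p + d / 3 *: e_ i) + g p.
  by rewrite [p + _ + _]addrAC [X in X + _]addrAC.
exists v, w; split.
- by move: vd; rewrite lt_min => /andP[].
- by move: wd; rewrite lt_min => /andP[].
exact: (mulfI s20 (etrans (esym E1) (etrans E E2))).
Qed.

Lemma derive_at_max U g p v : open U -> Ck 1 U g -> U p ->
  (forall q, U q -> g q <= g p) -> 'D_v g p = 0.
Proof.
move=> oU Cg Up gmax; have [d d0 Hd] := open_ball oU Up.
have v1 : 0 < `|v| + 1 by rewrite ltr_wpDl.
pose r := d / (`|v| + 1); have r0 : 0 < r by rewrite divr_gt0.
have Ut t : t \in `]- r, r[ -> U (p + t *: v).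
  rewrite in_itv /= => /andP[t1 t2]; apply: Hd; rewrite normrZ.
  have tr : `|t| < r by rewrite ltr_norml t1.
  have [->|vn0] := eqVneq `|v| 0; first by rewrite mulr0.
  have vp : 0 < `|v| by rewrite lt_neqAle eq_sym vn0 /=.
  apply: (@lt_le_trans _ _ (r * `|v|)); first by rewrite ltr_pM2r.
  by rewrite /r mulrAC ler_pdivrMr // ler_pM2l // lerDl.
have H (t : R) : t \in `]- r, r[ ->
    is_derive t 1 (fun s : R => g (p + s *: v)) ('D_v g (p + t *: v)).
  move=> /Ut Ut'; apply: is_derive_line.
  by apply: diff_derivable; exact: (C1_differentiable oU Cg).
have z : (0 : R) \in `]- r, r[ by rewrite in_itv /= oppr_lt0 r0.
have [_ E0] := H _ z.
have nr : - r <= r by rewrite ge0_cp // ltW.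
have [_ E1] : is_derive (0 : R) 1 (fun s : R => g (p + s *: v)) 0.
  apply: (@derive1_at_max _ _ (- r) r) => //.
  - by move=> t /H[].
  - by move=> t /Ut /gmax; rewrite scale0r addr0.
by rewrite -E1 E0 scale0r addr0.
Qed.

(** The sum is the derivative along [v] of [u], the derivative of [g] along [v], and [u] vanishes at
    [p]. Were it positive, [u] would be positive just after [p] on the ray along [v], and the mean
    value theorem would make [g] exceed its maximum. *)
Lemma second_derive_at_max U g p v : open U -> Ck 2 U g -> U p ->
  (forall q, U q -> g q <= g p) ->
  \sum_i \sum_j v ord0 i * v ord0 j * 'D_(e_ i) (fun q => 'D_(e_ j) g q) p <= 0.
Proof.
move=> oU Cg Up gmax; set H := (X in X <= 0).
have Cg1 := CkW Cg.
pose u q := \sum_j v ord0 j * 'D_(e_ j) g q.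
have Cu : Ck 1 U u.
  by apply: (Ck_sum _ oU) => j; exact: (CkM oU (Ck_cst _ _ _) (Ck_deriv j Cg)).
have uE q : U q -> u q = 'D_v g q by move=> Uq; rewrite (C1_derive_sum _ oU Cg1).
have u0 : u p = 0 by rewrite uE // (derive_at_max _ oU Cg1).
have du : 'D_v u p = H.
  rewrite (C1_derive_sum _ oU Cu Up); apply: eq_bigr => i _.
  rewrite (_ : u = \sum_j (fun q => v ord0 j * 'D_(e_ j) g q)); last first.
    by apply/funext => q; rewrite fct_sumE.
  rewrite derive_sum; last first.
    move=> j.
    exact: (Ck_derivable (CkM oU (Ck_cst 1 U (v ord0 j)) (Ck_deriv j Cg)) Up).
  rewrite mulr_sumr; apply: eq_bigr => j _.
  have dj : derivable (fun q => 'D_(e_ j) g q) p (e_ i).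
    exact: (Ck_derivable (Ck_deriv j Cg) Up).
  have [_ ->] := is_deriveZ (v ord0 j) (derivableP dj).
  by rewrite mulrA.
rewrite leNgt; apply/negP => H0.
have dv : derivable u p v by apply: diff_derivable; exact: (C1_differentiable oU Cu).
have c : h^-1 *: (u (h *: v + p) - u p) @[h --> 0^'] --> H by rewrite -du.
have [d d0 Hd] := open_ball oU Up.
have c1 : \forall h \near (0 : R)^', 0 < h^-1 *: (u (h *: v + p) - u p).
  by move/cvgrPdist_lt : c => /(_ _ H0); apply: filterS => h; rewrite ltr_norml; lra.
move: c1 => /nbhs_ballP[r /= r0 Hr].
have v1 : 0 < `|v| + 1 by rewrite ltr_wpDl.
(* The first bound keeps parameters where the difference quotient of [u] is positive, the second
   keeps the segment inside [U]. *)
pose t := Num.min (r / 2) (d / (`|v| + 1)).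
have t0 : 0 < t by rewrite lt_min !divr_gt0.
have Us s : 0 <= s <= 1 -> U (p + s *: (t *: v)).
  move=> /andP[s0 s1]; apply: Hd; rewrite !normrZ !ger0_norm ?(ltW t0) //.
  apply: (@le_lt_trans _ _ (t * `|v|)); first by rewrite ler_piMl // mulr_ge0 // ltW.
  have td : t * (`|v| + 1) <= d.
    by rewrite -ler_pdivlMr // ge_min lexx orbT.
  by apply: lt_le_trans td; rewrite ltr_pM2l // ltrDl.
have dgl q : U q -> derivable g q v.
  by move=> Uq; apply: diff_derivable; exact: (C1_differentiable oU Cg1).
have [s s01 E] := mean_value_scaled (fun s s01 => dgl _ (Us s s01)).
have s01' : 0 <= s <= 1 by case/andP: s01 => /ltW -> /ltW ->.
have [s0 s1] := andP s01.
have st0 : 0 < s * t by rewrite mulr_gt0.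
have : 0 < g (p + t *: v) - g p.
  rewrite E mulr_gt0 // -uE; last exact: Us.
  have := Hr (s * t); rewrite u0 subr0 -ball_normE /= sub0r normrN gtr0_norm //.
  rewrite [X in u (X + _)](_ : _ = s *: (t *: v)) ?scalerA // addrC.
  rewrite -scalerA => HH.
  have : 0 < (s * t)^-1 *: u (p + s *: (t *: v)).
    apply: HH; last by rewrite gt_eqF.
    apply: (@lt_le_trans _ _ (1 * t)); first by rewrite ltr_pM2r.
    rewrite mul1r; apply: (@le_trans _ _ (r / 2)); first by rewrite ge_min lexx.
    by lra.
  by rewrite pmulr_rgt0 // invr_gt0.
rewrite subr_gt0 ltNge gmax //; have := Us 1; rewrite scale1r; apply.
by rewrite ler01 lexx.
Qed.

End TwiceDifferentiable.

(** * Wirtinger derivatives *)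

Section ComplexSmooth.
Variables (R : realType) (n : nat).
Local Notation V := (cspace R n).
Local Notation e_ := (@basis_vec R n).
Local Notation C := R[i].
Implicit Types (U : set V) (f g : V -> R) (F G : V -> C) (p v : V).

Lemma ReM (x y : C) :
  complex.Re (x * y) = complex.Re x * complex.Re y - complex.Im x * complex.Im y.
Proof. by case: x y => a b [c d]. Qed.

Lemma ImM (x y : C) :
  complex.Im (x * y) = complex.Re x * complex.Im y + complex.Im x * complex.Re y.
Proof. by case: x y => a b [c d]. Qed.

Lemma ReD (x y : C) : complex.Re (x + y) = complex.Re x + complex.Re y.
Proof. by case: x y => a b [c d]. Qed.

Lemma ImD (x y : C) : complex.Im (x + y) = complex.Im x + complex.Im y.
Proof. by case: x y => a b [c d]. Qed.

Lemma ReV (x : C) : complex.Re x^-1 =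
  complex.Re x * (complex.Re x * complex.Re x + complex.Im x * complex.Im x)^-1.
Proof. by case: x => a b; rewrite /= !expr2. Qed.

Lemma ImV (x : C) : complex.Im x^-1 =
  - complex.Im x * (complex.Re x * complex.Re x + complex.Im x * complex.Im x)^-1.
Proof. by case: x => a b; rewrite /= !expr2 mulNr. Qed.

Lemma ReJ (x : C) : complex.Re (x^*)%C = complex.Re x.
Proof. by case: x. Qed.

Lemma ImJ (x : C) : complex.Im (x^*)%C = - complex.Im x.
Proof. by case: x. Qed.

Lemma sqr_norm_eq0 (x : C) :
  complex.Re x * complex.Re x + complex.Im x * complex.Im x = 0 -> x = 0.
Proof.
case: x => a b /= /eqP; rewrite -!expr2 paddr_eq0 ?sqr_ge0 // !sqrf_eq0.
by move=> /andP[/eqP -> /eqP ->].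
Qed.

Lemma smoothM U f g : open U -> smooth U f -> smooth U g ->
  smooth U (fun p => f p * g p).
Proof. by move=> oU sf sg k; exact: CkM. Qed.

Lemma smoothD U f g : open U -> smooth U f -> smooth U g ->
  smooth U (fun p => f p + g p).
Proof. by move=> oU sf sg k; exact: CkD. Qed.

Lemma smoothN U f : open U -> smooth U f -> smooth U (fun p => - f p).
Proof. by move=> oU sf k; exact: CkN. Qed.

Lemma smoothV U f : open U -> (forall p, U p -> f p != 0) -> smooth U f ->
  smooth U (fun p => (f p)^-1).
Proof. by move=> oU f0 sf k; exact: CkV. Qed.

Lemma smooth_ext U f g : open U -> (forall p, U p -> f p = g p) ->
  smooth U f -> smooth U g.
Proof. by move=> oU E sf k; exact: Ck_ext E (sf k). Qed.

Lemma smooth_deriv U f m : smooth U f -> smooth U (fun p => 'D_(e_ m) f p).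
Proof. by move=> sf k; exact: Ck_deriv. Qed.

Lemma smooth_derivable U f p m : smooth U f -> U p -> derivable f p (e_ m).
Proof. by move=> sf Up; exact: (Ck_derivable (sf 1%N) Up). Qed.

Lemma smooth_eq U f g : f =1 g -> smooth U f -> smooth U g.
Proof. by move=> /funext ->. Qed.

Lemma csmooth_ext U F G : open U -> (forall p, U p -> F p = G p) ->
  csmooth U F -> csmooth U G.
Proof.
move=> oU E [s1 s2]; split.
  by apply: (smooth_ext oU _ s1) => p /E ->.
by apply: (smooth_ext oU _ s2) => p /E ->.
Qed.

Lemma csmooth_cst U (c : C) : csmooth U (fun=> c).
Proof. by split => k; exact: Ck_cst. Qed.

Lemma csmoothD U F G : open U -> csmooth U F -> csmooth U G ->
  csmooth U (fun p => F p + G p).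
Proof.
move=> oU [F1 F2] [G1 G2]; split.
  by apply: (smooth_eq _ (smoothD oU F1 G1)) => p; rewrite ReD.
by apply: (smooth_eq _ (smoothD oU F2 G2)) => p; rewrite ImD.
Qed.

Lemma csmoothM U F G : open U -> csmooth U F -> csmooth U G ->
  csmooth U (fun p => F p * G p).
Proof.
move=> oU [F1 F2] [G1 G2]; split.
  apply: (smooth_eq _ (smoothD oU (smoothM oU F1 G1) (smoothN oU (smoothM oU F2 G2)))) => p.
  by rewrite ReM.
apply: (smooth_eq _ (smoothD oU (smoothM oU F1 G2) (smoothM oU F2 G1))) => p.
by rewrite ImM.
Qed.

Lemma csmoothN U F : open U -> csmooth U F -> csmooth U (fun p => - F p).
Proof.
move=> oU sF; apply: (csmooth_ext oU _ (csmoothM oU (csmooth_cst U (-1)) sF)) => p _.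
by rewrite mulN1r.
Qed.

Lemma csmoothJ U F : open U -> csmooth U F -> csmooth U (fun p => (F p)^*%C).
Proof.
move=> oU [F1 F2]; split.
  by apply: (smooth_eq _ F1) => p; rewrite ReJ.
by apply: (smooth_eq _ (smoothN oU F2)) => p; rewrite ImJ.
Qed.

Lemma csmoothV U F : open U -> (forall p, U p -> F p != 0) -> csmooth U F ->
  csmooth U (fun p => (F p)^-1).
Proof.
move=> oU F0 [F1 F2].
have N0 p : U p -> complex.Re (F p) * complex.Re (F p) + complex.Im (F p) * complex.Im (F p) != 0.
  by move=> /F0; apply: contraNneq => /sqr_norm_eq0 ->.
have NV := smoothV oU N0 (smoothD oU (smoothM oU F1 F1) (smoothM oU F2 F2)).
split.
  by apply: (smooth_eq _ (smoothM oU F1 NV)) => p; rewrite ReV.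
by apply: (smooth_eq _ (smoothM oU (smoothN oU F2) NV)) => p; rewrite ImV.
Qed.

Lemma csmooth_cderive U F m : csmooth U F -> csmooth U (cderive (e_ m) F).
Proof. by move=> [F1 F2]; split; exact: smooth_deriv. Qed.

Lemma near_eq_cderive F G p v :
  (\forall q \near p, F q = G q) -> cderive v F p = cderive v G p.
Proof.
move=> E; apply: (f_equal2 (@Complex R)); apply: near_eq_derive;
  by apply: filterS E => q ->.
Qed.

Lemma cderive_cst (c : C) p v : cderive v (fun=> c) p = 0.
Proof. by rewrite /cderive !derive_cst. Qed.

Lemma cderiveJ U F p m : csmooth U F -> U p ->
  cderive (e_ m) (fun q => (F q)^*%C) p = (cderive (e_ m) F p)^*%C.
Proof.
move=> [F1 F2] Up.
have E1 : (fun q => complex.Re (F q)^*%C) = (fun q => complex.Re (F q)).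
  by apply/funext => q; rewrite ReJ.
have E2 : (fun q => complex.Im (F q)^*%C) = - (fun q => complex.Im (F q)).
  by apply/funext => q; rewrite ImJ.
have H2 := deriveN (smooth_derivable (m:=m) F2 Up); rewrite -E2 in H2.
have H1 := f_equal (fun f => 'D_(e_ m) f p) E1.
exact: (f_equal2 (@Complex R) H1 H2).
Qed.

Lemma cderiveD U F G p m : csmooth U F -> csmooth U G -> U p ->
  cderive (e_ m) (fun q => F q + G q) p = cderive (e_ m) F p + cderive (e_ m) G p.
Proof.
move=> [F1 F2] [G1 G2] Up.
have dF1 := smooth_derivable (m:=m) F1 Up; have dF2 := smooth_derivable (m:=m) F2 Up.
have dG1 := smooth_derivable (m:=m) G1 Up; have dG2 := smooth_derivable (m:=m) G2 Up.
have E1 : (fun q => complex.Re (F q + G q)) =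
    (fun q => complex.Re (F q)) + (fun q => complex.Re (G q)).
  by apply/funext => q; exact: ReD.
have E2 : (fun q => complex.Im (F q + G q)) =
    (fun q => complex.Im (F q)) + (fun q => complex.Im (G q)).
  by apply/funext => q; exact: ImD.
have := deriveD dF1 dG1; have := deriveD dF2 dG2; rewrite -E1 -E2.
by move=> H2 H1; exact: (f_equal2 (@Complex R) H1 H2).
Qed.

Lemma cleibniz (a b c d a' b' c' d' : R) :
  ((a * c' + c * a' - (b * d' + d * b')) +i* (a * d' + d * a' + (b * c' + c * b')))%C
  = (a' +i* b')%C * (c +i* d)%C + (a +i* b)%C * (c' +i* d')%C.
Proof. by apply/eqP; rewrite eq_complex /=; apply/andP; split; apply/eqP; ring. Qed.

Lemma cderiveM U F G p m : csmooth U F -> csmooth U G -> U p ->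
  cderive (e_ m) (fun q => F q * G q) p =
  cderive (e_ m) F p * G p + F p * cderive (e_ m) G p.
Proof.
move=> [F1 F2] [G1 G2] Up.
have dF1 := derivableP (smooth_derivable (m:=m) F1 Up).
have dF2 := derivableP (smooth_derivable (m:=m) F2 Up).
have dG1 := derivableP (smooth_derivable (m:=m) G1 Up).
have dG2 := derivableP (smooth_derivable (m:=m) G2 Up).
have [_ E1] := is_deriveB (is_deriveM dF1 dG1) (is_deriveM dF2 dG2).
have [_ E2] := is_deriveD (is_deriveM dF1 dG2) (is_deriveM dF2 dG1).
have H1 : (fun q => complex.Re (F q)) * (fun q => complex.Re (G q)) -
    (fun q => complex.Im (F q)) * (fun q => complex.Im (G q)) =
    (fun q => complex.Re (F q * G q)) by apply/funext => q; rewrite ReM.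
have H2 : (fun q => complex.Re (F q)) * (fun q => complex.Im (G q)) +
    (fun q => complex.Im (F q)) * (fun q => complex.Re (G q)) =
    (fun q => complex.Im (F q * G q)) by apply/funext => q; rewrite ImM.
rewrite H1 in E1; rewrite H2 in E2.
apply: (etrans (f_equal2 (@Complex R) E1 E2)).
apply: (etrans (cleibniz _ _ _ _ _ _ _ _)).
by rewrite /cderive; case: (F p) => ? ?; case: (G p).
Qed.

Lemma cderive_comm U F p i j : open U -> csmooth U F -> U p ->
  cderive (e_ i) (cderive (e_ j) F) p = cderive (e_ j) (cderive (e_ i) F) p.
Proof.
move=> oU [F1 F2] Up.
exact: (f_equal2 (@Complex R) (@schwarz _ _ _ _ _ j i oU (F1 2%N) Up)
                              (@schwarz _ _ _ _ _ j i oU (F2 2%N) Up)).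
Qed.

End ComplexSmooth.

(** Here [wd] is d/dz^i and [wj] is conjugation; d/d\bar z^i is the conjugate [wj (wd i (wj x))], so
    [wdbC] is the commutation of d/dz^i with d/d\bar z^j. The zero ring must be allowed: it is the
    ring of functions on the empty open set. *)
Record wirtinger (A : comPzRingType) (n : nat) := Wirtinger {
  wd : 'I_n -> A -> A;
  wj : A -> A;
  wdD : forall i x y, wd i (x + y) = wd i x + wd i y;
  wdM : forall i x y, wd i (x * y) = wd i x * y + x * wd i y;
  wjD : forall x y, wj (x + y) = wj x + wj y;
  wjM : forall x y, wj (x * y) = wj x * wj y;
  wj1 : wj 1 = 1;
  wjK : forall x, wj (wj x) = x;
  wdC : forall i j x, wd i (wd j x) = wd j (wd i x);
  wdbC : forall i j x, wd i (wj (wd j (wj x))) = wj (wd j (wj (wd i x)))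
}.

Section WirtingerOfPartials.
Variables (A : comPzRingType) (n : nat) (pd : 'I_(n + n) -> A -> A) (cj : A -> A).
Variables (I H : A).
Hypothesis pdD : forall m x y, pd m (x + y) = pd m x + pd m y.
Hypothesis pdM : forall m x y, pd m (x * y) = pd m x * y + x * pd m y.
Hypothesis pdC : forall i j x, pd i (pd j x) = pd j (pd i x).
Hypothesis pdI : forall m, pd m I = 0.
Hypothesis pdH : forall m, pd m H = 0.
Hypothesis cjD : forall x y, cj (x + y) = cj x + cj y.
Hypothesis cjM : forall x y, cj (x * y) = cj x * cj y.
Hypothesis cjK : forall x, cj (cj x) = x.
Hypothesis cjpd : forall m x, pd m (cj x) = cj (pd m x).
Hypothesis cjI : cj I = - I.
Hypothesis cjH : cj H = H.

(** [I] and [H] stand for the constants i and 1/2, [pd] for the real partial derivatives. *)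
Definition wdz (k : 'I_n) x := (pd (lshift n k) x - I * pd (rshift n k) x) * H.
Definition wdzb (k : 'I_n) x := (pd (lshift n k) x + I * pd (rshift n k) x) * H.

Lemma pdN m x : pd m (- x) = - pd m x.
Proof.
have pd0 : pd m 0 = 0 by apply: (addrI (pd m 0)); rewrite -pdD !addr0.
by apply/eqP; rewrite -addr_eq0 -pdD addNr pd0.
Qed.

Lemma cjN x : cj (- x) = - cj x.
Proof.
have cj0 : cj 0 = 0 by apply: (addrI (cj 0)); rewrite -cjD !addr0.
by apply/eqP; rewrite -addr_eq0 -cjD addNr cj0.
Qed.

Lemma wdzb_conj k x : cj (wdz k (cj x)) = wdzb k x.
Proof.
by rewrite /wdz /wdzb !cjpd cjM cjD cjN cjM !cjK cjI cjH mulNr opprK.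
Qed.

Lemma wdzD k x y : wdz k (x + y) = wdz k x + wdz k y.
Proof. by rewrite /wdz !pdD; ring. Qed.

Lemma wdzM k x y : wdz k (x * y) = wdz k x * y + x * wdz k y.
Proof. by rewrite /wdz !pdM; ring. Qed.

Lemma wdzC i j x : wdz i (wdz j x) = wdz j (wdz i x).
Proof.
rewrite /wdz !(pdM, pdD, pdN, pdI, pdH) !(mulr0, mul0r, addr0, add0r).
rewrite (pdC (lshift n i) (lshift n j)) (pdC (lshift n i) (rshift n j)).
rewrite (pdC (rshift n i) (lshift n j)) (pdC (rshift n i) (rshift n j)).
ring.
Qed.

Lemma wdz_wdzbE i j x : wdz i (wdzb j x) = H * H *
  (pd (lshift n i) (pd (lshift n j) x) - I * I * pd (rshift n i) (pd (rshift n j) x)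
   + I * (pd (lshift n i) (pd (rshift n j) x) - pd (rshift n i) (pd (lshift n j) x))).
Proof.
rewrite /wdz /wdzb !(pdM, pdD, pdN, pdI, pdH) !(mulr0, mul0r, addr0, add0r); ring.
Qed.

Lemma wdzbC i j x : wdz i (cj (wdz j (cj x))) = cj (wdz j (cj (wdz i x))).
Proof.
rewrite !wdzb_conj /wdz /wdzb !(pdM, pdD, pdN, pdI, pdH) !(mulr0, mul0r, addr0, add0r).
rewrite (pdC (lshift n i) (lshift n j)) (pdC (lshift n i) (rshift n j)).
rewrite (pdC (rshift n i) (lshift n j)) (pdC (rshift n i) (rshift n j)).
ring.
Qed.

Lemma cj1 : cj 1 = 1.
Proof. by have := cjM 1 (cj 1); rewrite mul1r cjK mulr1. Qed.

Definition wirtinger_of_partials :=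
  Wirtinger wdzD wdzM cjD cjM cj1 cjK wdzC wdzbC.

End WirtingerOfPartials.

(* Smooth functions on U are represented by their extensions by zero, so that
   Leibniz equality is pointwise equality on U and the usual ring structure is
   available. *)
Record cinf (R : realType) (n : nat) (U : set (cspace R n)) := Cinf {
  cfun :> cspace R n -> R[i];
  cfun_smooth : csmooth U cfun;
  cfun_out : forall p, ~ U p -> cfun p = 0
}.

Section CinfRing.
Variables (R : realType) (n : nat) (U : set (cspace R n)).
Hypothesis oU : open U.
Local Notation V := (cspace R n).
Local Notation C := R[i].
Local Notation A := (cinf U).

Lemma cinf_ext (x y : A) : (forall p, U p -> cfun x p = cfun y p) -> x = y.
Proof.
case: x y => x sx zx [y sy zy] /= E.
have {}E : x = y.
  by apply/funext => p; have [/E//|nUp] := pselect (U p); rewrite zx ?zy.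
case: y / E sy zy => sy zy.
by rewrite (Prop_irrelevance sx sy) (Prop_irrelevance zx zy).
Qed.

Definition cut (F : V -> C) : V -> C := fun p => if `[<U p>] then F p else 0.

Lemma cutE F p : U p -> cut F p = F p.
Proof. by move=> Up; rewrite /cut asboolT. Qed.

Lemma cut_out F p : ~ U p -> cut F p = 0.
Proof. by move=> Up; rewrite /cut asboolF. Qed.

Lemma cut_smooth F : csmooth U F -> csmooth U (cut F).
Proof. by apply: csmooth_ext => // p Up; rewrite cutE. Qed.

(* Existence proofs are opaque: conversion must never unfold the smooth
   functions built below. *)
Lemma mkc_subproof F : csmooth U F -> {x : A | forall p, U p -> x p = F p}.
Proof. by move=> sF; exists (Cinf (cut_smooth sF) (@cut_out F)) => p; exact: cutE. Qed.

Definition mkc F (sF : csmooth U F) : A := sval (mkc_subproof sF).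

Lemma mkcE F (sF : csmooth U F) p : U p -> mkc sF p = F p.
Proof. exact: svalP (mkc_subproof sF) p. Qed.

Definition cinf_cst (c : C) : A := mkc (csmooth_cst U c).
Definition cinf_add (x y : A) : A :=
  mkc (csmoothD oU (cfun_smooth x) (cfun_smooth y)).
Definition cinf_mul (x y : A) : A :=
  mkc (csmoothM oU (cfun_smooth x) (cfun_smooth y)).
Definition cinf_opp (x : A) : A := mkc (csmoothN oU (cfun_smooth x)).

Lemma cinf_addA : associative cinf_add.
Proof. by move=> x y z; apply: cinf_ext => p Up; rewrite !mkcE // addrA. Qed.
Lemma cinf_addC : commutative cinf_add.
Proof. by move=> x y; apply: cinf_ext => p Up; rewrite !mkcE // addrC. Qed.
Lemma cinf_add0 : left_id (cinf_cst 0) cinf_add.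
Proof. by move=> x; apply: cinf_ext => p Up; rewrite !mkcE // add0r. Qed.
Lemma cinf_addN : left_inverse (cinf_cst 0) cinf_opp cinf_add.
Proof. by move=> x; apply: cinf_ext => p Up; rewrite !mkcE // addNr. Qed.
Lemma cinf_mulA : associative cinf_mul.
Proof. by move=> x y z; apply: cinf_ext => p Up; rewrite !mkcE // mulrA. Qed.
Lemma cinf_mulC : commutative cinf_mul.
Proof. by move=> x y; apply: cinf_ext => p Up; rewrite !mkcE // mulrC. Qed.
Lemma cinf_mul1 : left_id (cinf_cst 1) cinf_mul.
Proof. by move=> x; apply: cinf_ext => p Up; rewrite !mkcE // mul1r. Qed.
Lemma cinf_mulD : left_distributive cinf_mul cinf_add.
Proof. by move=> x y z; apply: cinf_ext => p Up; rewrite !mkcE // mulrDl. Qed.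

End CinfRing.

(** Sums and products of smooth functions need the openness of the domain; bundling its proof with
    the set lets unification find the ring structure of [cinfty]. *)
Record opens (R : realType) (n : nat) :=
  Opens { opset : set (cspace R n); opset_open : open opset }.

Arguments opset_open {R n} o.

Definition cinfty (R : realType) (n : nat) (W : opens R n) := cinf (opset W).

HB.instance Definition _ (R : realType) (n : nat) (W : opens R n) :=
  gen_eqMixin (cinfty W).
HB.instance Definition _ (R : realType) (n : nat) (W : opens R n) :=
  gen_choiceMixin (cinfty W).
HB.instance Definition _ (R : realType) (n : nat) (W : opens R n) :=
  @GRing.isZmodule.Build (cinfty W)
  (cinf_cst (opset_open W) 0) (cinf_opp (opset_open W)) (cinf_add (opset_open W))
  (cinf_addA (opset_open W)) (cinf_addC (opset_open W)) (cinf_add0 (opset_open W))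
  (cinf_addN (opset_open W)).
HB.instance Definition _ (R : realType) (n : nat) (W : opens R n) :=
  @GRing.Zmodule_isComPzRing.Build (cinfty W)
  (cinf_cst (opset_open W) 1) (cinf_mul (opset_open W))
  (cinf_mulA (opset_open W)) (cinf_mulC (opset_open W)) (cinf_mul1 (opset_open W))
  (cinf_mulD (opset_open W)).

Section CinfDerivations.
Variables (R : realType) (n : nat) (W : opens R n).
Local Notation V := (cspace R n).
Local Notation e_ := (@basis_vec R n).
Local Notation C := R[i].
Local Notation U := (opset W).
Local Notation oU := (opset_open W).
Local Notation A := (cinfty W).
Implicit Types (x y : A) (p : V).

Definition mkf F (sF : csmooth U F) : A := mkc oU sF.

Lemma mkfE F (sF : csmooth U F) p : U p -> mkf sF p = F p.
Proof. exact: mkcE. Qed.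

Lemma cfD x y p : U p -> (x + y) p = x p + y p.
Proof. exact: mkcE. Qed.
Lemma cfM x y p : U p -> (x * y) p = x p * y p.
Proof. exact: mkcE. Qed.
Lemma cfN x p : U p -> (- x) p = - x p.
Proof. exact: mkcE. Qed.
Lemma cf0 p : U p -> (0 : A) p = 0.
Proof. exact: mkcE. Qed.
Lemma cf1 p : U p -> (1 : A) p = 1.
Proof. exact: mkcE. Qed.

Definition cstf (c : C) : A := cinf_cst oU c.
Lemma cstfE c p : U p -> cstf c p = c.
Proof. exact: mkcE. Qed.

Lemma conjf_subproof x : {y : A | forall p, U p -> y p = (x p)^*%C}.
Proof. by exists (mkf (csmoothJ oU (cfun_smooth x))) => p; exact: mkfE. Qed.

Lemma pdf_subproof (m : 'I_(n + n)) x :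
  {y : A | forall p, U p -> y p = cderive (e_ m) x p}.
Proof. by exists (mkf (csmooth_cderive m (cfun_smooth x))) => p; exact: mkfE. Qed.

Definition conjf x : A := sval (conjf_subproof x).
Definition pdf (m : 'I_(n + n)) x : A := sval (pdf_subproof m x).

Definition invf x (x0 : forall p, U p -> x p != 0) : A :=
  mkf (csmoothV oU x0 (cfun_smooth x)).

Lemma conjfE x p : U p -> conjf x p = (x p)^*%C.
Proof. exact: svalP (conjf_subproof x) p. Qed.

Lemma pdfE m x p : U p -> pdf m x p = cderive (e_ m) x p.
Proof. exact: svalP (pdf_subproof m x) p. Qed.

Lemma invfP x (x0 : forall p, U p -> x p != 0) : x * invf x0 = 1.
Proof.
by apply: cinf_ext => p Up; rewrite cfM // mkfE // cf1 // divff // x0.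
Qed.

Lemma pdfD m x y : pdf m (x + y) = pdf m x + pdf m y.
Proof.
apply: cinf_ext => p Up; rewrite cfD // !pdfE //.
rewrite -(cderiveD m (cfun_smooth x) (cfun_smooth y) Up); apply: near_eq_cderive.
by apply: (near_open oU Up) => q Uq; rewrite cfD.
Qed.

Lemma pdfM m x y : pdf m (x * y) = pdf m x * y + x * pdf m y.
Proof.
apply: cinf_ext => p Up; rewrite cfD // !cfM // !pdfE //.
rewrite -(cderiveM m (cfun_smooth x) (cfun_smooth y) Up); apply: near_eq_cderive.
by apply: (near_open oU Up) => q Uq; rewrite cfM.
Qed.

Lemma pdf_cst m c : pdf m (cstf c) = 0.
Proof.
apply: cinf_ext => p Up; rewrite cf0 // pdfE // -(cderive_cst c p (e_ m)).
by apply: near_eq_cderive; apply: (near_open oU Up) => q Uq; rewrite cstfE.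
Qed.

Lemma pdf_conj m x : pdf m (conjf x) = conjf (pdf m x).
Proof.
apply: cinf_ext => p Up; rewrite conjfE // !pdfE //.
rewrite -(cderiveJ m (cfun_smooth x) Up); apply: near_eq_cderive.
by apply: (near_open oU Up) => q Uq; rewrite conjfE.
Qed.

Lemma pdf_pdfE i j x p : U p ->
  pdf i (pdf j x) p = cderive (e_ i) (cderive (e_ j) x) p.
Proof.
move=> Up; apply: (etrans (pdfE i (pdf j x) Up)); apply: near_eq_cderive.
by apply: (near_open oU Up) => q Uq; exact: pdfE.
Qed.

Lemma pdf_comm i j x : pdf i (pdf j x) = pdf j (pdf i x).
Proof.
apply: cinf_ext => p Up; apply: (etrans (pdf_pdfE i j x Up)).
apply: etrans (esym (pdf_pdfE j i x Up)).
exact: (cderive_comm i j oU (cfun_smooth x) Up).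
Qed.

Lemma conjfK x : conjf (conjf x) = x.
Proof. by apply: cinf_ext => p Up; rewrite !conjfE // conjcK. Qed.

Lemma conjfD x y : conjf (x + y) = conjf x + conjf y.
Proof. by apply: cinf_ext => p Up; rewrite cfD // !conjfE // cfD // rmorphD. Qed.

Lemma conjfM x y : conjf (x * y) = conjf x * conjf y.
Proof. by apply: cinf_ext => p Up; rewrite cfM // !conjfE // cfM // rmorphM. Qed.

Lemma conjf_cst c : conjf (cstf c) = cstf c^*%C.
Proof. by apply: cinf_ext => p Up; rewrite conjfE // !cstfE. Qed.

Lemma conjf_I : conjf (cstf 'i%C) = - cstf 'i%C.
Proof.
rewrite conjf_cst; apply: cinf_ext => p Up.
apply: (etrans (cstfE _ Up)); apply: etrans (esym (cfN _ Up)).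
apply: etrans (congr1 (@GRing.opp _) (esym (cstfE _ Up))).
by apply/eqP; rewrite eq_complex /= oppr0 !eqxx.
Qed.

Lemma conjf_half : conjf (cstf 2%:R^-1) = cstf 2%:R^-1.
Proof. by rewrite conjf_cst conjc_inv conjc_nat. Qed.

Lemma cinf_wirtinger_subproof : {w : wirtinger A n |
  (forall k x, wd w k x = wdz pdf (cstf 'i%C) (cstf 2%:R^-1) k x) /\
  (forall x, wj w x = conjf x)}.
Proof.
by exists (wirtinger_of_partials pdfD pdfM pdf_comm (fun m => pdf_cst m 'i%C)
    (fun m => pdf_cst m 2%:R^-1) conjfD conjfM conjfK pdf_conj conjf_I conjf_half).
Qed.

Definition cinf_wirtinger : wirtinger A n := sval cinf_wirtinger_subproof.

Lemma cinf_wd k x :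
  wd cinf_wirtinger k x = wdz pdf (cstf 'i%C) (cstf 2%:R^-1) k x.
Proof. exact: (svalP cinf_wirtinger_subproof).1. Qed.

Lemma cinf_wj x : wj cinf_wirtinger x = conjf x.
Proof. exact: (svalP cinf_wirtinger_subproof).2. Qed.

Lemma dz_near F G k p : (\forall q \near p, F q = G q) -> dz k F p = dz k G p.
Proof. by move=> E; rewrite /dz !(near_eq_cderive _ E). Qed.

Lemma dzb_near F G k p : (\forall q \near p, F q = G q) -> dzb k F p = dzb k G p.
Proof. by move=> E; rewrite /dzb !(near_eq_cderive _ E). Qed.

Lemma wdzE k x p : U p -> wdz pdf (cstf 'i%C) (cstf 2%:R^-1) k x p = dz k x p.
Proof.
move=> Up; apply: (etrans (cfM _ _ Up)).
apply: (f_equal2 *%R); last exact: cstfE.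
apply: (etrans (cfD _ _ Up)); apply: (f_equal2 +%R); first exact: pdfE.
apply: (etrans (cfN _ Up)); apply: (f_equal -%R).
apply: (etrans (cfM _ _ Up)); apply: (f_equal2 *%R); first exact: cstfE.
exact: pdfE.
Qed.

Lemma wdzbE k x p : U p -> wdzb pdf (cstf 'i%C) (cstf 2%:R^-1) k x p = dzb k x p.
Proof.
move=> Up; apply: (etrans (cfM _ _ Up)).
apply: (f_equal2 *%R); last exact: cstfE.
apply: (etrans (cfD _ _ Up)); apply: (f_equal2 +%R); first exact: pdfE.
apply: (etrans (cfM _ _ Up)); apply: (f_equal2 *%R); first exact: cstfE.
exact: pdfE.
Qed.

End CinfDerivations.

(** * Curvature identities on a surface *)

Notation i1 := (@ord0 1).
Notation i2 := (@ord_max 1).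

Lemma sum2 (A : nmodType) (F : 'I_2 -> A) : \sum_(i < 2) F i = F i1 + F i2.
Proof.
by rewrite big_ord_recr big_ord1 /=; congr (F _ + F _); exact/val_inj.
Qed.

Lemma ord2P (P : 'I_2 -> Prop) : P i1 -> P i2 -> forall i, P i.
Proof.
move=> P1 P2 [[|[|//]] Hi].
  by rewrite (_ : Ordinal Hi = i1) //; exact: val_inj.
by rewrite (_ : Ordinal Hi = i2) //; exact: val_inj.
Qed.

Section SurfaceAlgebra.
Variables (A : comPzRingType) (W : wirtinger A 2).
Local Notation d := (wd W).
Local Notation J := (wj W).

(* The abstract model of a chart: d_i stands for d/dz^i, J for conjugation and
   hence b_i for d/d\bar z^i; Di is the inverse of det h. Definitions are
   locked so that rewriting never unfolds them up to conversion. *)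
Definition wb (i : 'I_2) (x : A) : A := locked (J (d i (J x))).
Local Notation b := wb.

Lemma wbE i x : b i x = J (d i (J x)).
Proof. by rewrite /wb -lock. Qed.

Lemma wd0 i : d i 0 = 0.
Proof. by apply: (addrI (d i 0)); rewrite -wdD !addr0. Qed.
Lemma wdN i x : d i (- x) = - d i x.
Proof. by apply/eqP; rewrite -addr_eq0 -wdD addNr wd0. Qed.
Lemma wj0 : J 0 = 0.
Proof. by apply: (addrI (J 0)); rewrite -wjD !addr0. Qed.
Lemma wjN x : J (- x) = - J x.
Proof. by apply/eqP; rewrite -addr_eq0 -wjD addNr wj0. Qed.
Lemma wd1 i : d i 1 = 0.
Proof.
have := wdM W i 1 1; rewrite !mulr1 mul1r => /eqP.
by rewrite -subr_eq0 opprD addNKr oppr_eq0 => /eqP.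
Qed.
Lemma wbD i x y : b i (x + y) = b i x + b i y.
Proof. by rewrite !wbE wjD wdD wjD. Qed.
Lemma wbN i x : b i (- x) = - b i x.
Proof. by rewrite !wbE wjN wdN wjN. Qed.
Lemma wbM i x y : b i (x * y) = b i x * y + x * b i y.
Proof. by rewrite !wbE wjM wdM wjD !wjM !wjK. Qed.
Lemma wb1 i : b i 1 = 0.
Proof. by rewrite !wbE wj1 wd1 wj0. Qed.
Lemma wb0 i : b i 0 = 0.
Proof. by rewrite !wbE wj0 wd0 wj0. Qed.
Lemma wdJ i x : d i (J x) = J (b i x).
Proof. by rewrite !wbE wjK. Qed.
Lemma wbJ i x : b i (J x) = J (d i x).
Proof. by rewrite !wbE wjK. Qed.
Lemma wdb i j x : d i (b j x) = b j (d i x).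
Proof. by rewrite !wbE wdbC. Qed.
Lemma wbb i j x : b i (b j x) = b j (b i x).
Proof. by rewrite !wbE !wjK wdC. Qed.

Variables (h : 'I_2 -> 'I_2 -> A) (Di : A).
Local Notation h11 := (h i1 i1).
Local Notation h12 := (h i1 i2).
Local Notation h21 := (h i2 i1).
Local Notation h22 := (h i2 i2).

Definition sD : A := locked (h11 * h22 - h12 * h21).
(** The transposed adjugate over det h, since h^{i \bar j} is the entry (j, i) of the inverse
    matrix. *)
Definition shu (i j : 'I_2) : A :=
  locked ((if i == i1 then if j == i1 then h22 else - h21
   else if j == i1 then - h12 else h11) * Di).
Definition sTheta i j k l : A :=
  locked (- d i (b j (h k l)) + \sum_p \sum_q shu p q * b j (h p l) * d i (h k q)).
Definition sric1 i j : A := locked (\sum_k \sum_l shu k l * sTheta i j k l).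
Definition sric3 i j : A := locked (\sum_k \sum_l shu k l * sTheta i l k j).
Definition sric4 i j : A := locked (\sum_k \sum_l shu k l * sTheta k j i l).

(* The torsion (2,1)-form is tau_l dz^1 /\ dz^2 /\ d\bar z^l, and eta is its
   contraction with the metric. *)
Definition stau l : A := locked (d i1 (h i2 l) - d i2 (h i1 l)).
Definition seta i : A := locked ((stau i2 * h i i1 - stau i1 * h i i2) * Di).
(** The derivative d_i log det h, also the trace of the Chern connection. *)
Definition sG i : A := locked (d i sD * Di).
(* [sN x y] is [det h] times the inverse metric. *)
Definition sN (x y : 'I_2 -> A) : A :=
  locked (h22 * x i1 * y i1 - h21 * x i1 * y i2 - h12 * x i2 * y i1
          + h11 * x i2 * y i2).
(** This is det h times the complex Laplacian h^{i \bar j} d_i b_j, so that no inverse of det h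
    occurs in it. *)
Definition sL (x : A) : A :=
  locked (h22 * d i1 (b i1 x) - h21 * d i1 (b i2 x) - h12 * d i2 (b i1 x)
          + h11 * d i2 (b i2 x)).
(* d eta = se dz^1 /\ dz^2 + ..., a section of the canonical bundle. *)
Definition se : A := locked (d i1 (seta i2) - d i2 (seta i1)).

Lemma sDE : sD = h11 * h22 - h12 * h21.
Proof. by rewrite /sD -lock. Qed.
Lemma shuE i j : shu i j = (if i == i1 then if j == i1 then h22 else - h21
   else if j == i1 then - h12 else h11) * Di.
Proof. by rewrite /shu -lock. Qed.
Lemma sThetaE i j k l : sTheta i j k l =
  - d i (b j (h k l)) + \sum_p \sum_q shu p q * b j (h p l) * d i (h k q).
Proof. by rewrite /sTheta -lock. Qed.
Lemma ric1_def i j : sric1 i j = \sum_k \sum_l shu k l * sTheta i j k l.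
Proof. by rewrite /sric1 -lock. Qed.
Lemma ric3_def i j : sric3 i j = \sum_k \sum_l shu k l * sTheta i l k j.
Proof. by rewrite /sric3 -lock. Qed.
Lemma ric4_def i j : sric4 i j = \sum_k \sum_l shu k l * sTheta k j i l.
Proof. by rewrite /sric4 -lock. Qed.
Lemma stauE l : stau l = d i1 (h i2 l) - d i2 (h i1 l).
Proof. by rewrite /stau -lock. Qed.
Lemma setaE i : seta i = (stau i2 * h i i1 - stau i1 * h i i2) * Di.
Proof. by rewrite /seta -lock. Qed.
Lemma sGE i : sG i = d i sD * Di.
Proof. by rewrite /sG -lock. Qed.
Lemma sNE x y : sN x y = h22 * x i1 * y i1 - h21 * x i1 * y i2 - h12 * x i2 * y i1
          + h11 * x i2 * y i2.
Proof. by rewrite /sN -lock. Qed.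
Lemma sLE x : sL x = h22 * d i1 (b i1 x) - h21 * d i1 (b i2 x)
  - h12 * d i2 (b i1 x) + h11 * d i2 (b i2 x).
Proof. by rewrite /sL -lock. Qed.
Lemma se_def : se = d i1 (seta i2) - d i2 (seta i1).
Proof. by rewrite /se -lock. Qed.

Hypothesis hJ : forall i j, J (h i j) = h j i.
Hypothesis DDi : sD * Di = 1.

(** The relation [sD * Di = 1] with [sD] expanded, solved for one monomial so that [ring] can reduce
    modulo it. *)
Lemma hhDi : h11 * h22 * Di = 1 + h12 * h21 * Di.
Proof. by rewrite -DDi sDE; ring. Qed.

Lemma dDE i : d i sD = d i h11 * h22 + h11 * d i h22 - (d i h12 * h21 + h12 * d i h21).
Proof. by rewrite {1}sDE wdD wdN !wdM. Qed.

Lemma bDE i : b i sD = b i h11 * h22 + h11 * b i h22 - (b i h12 * h21 + h12 * b i h21).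
Proof. by rewrite {1}sDE wbD wbN !wbM. Qed.

Lemma JD : J sD = sD.
Proof. by rewrite sDE wjD wjN !wjM !hJ mulrC [h21 * _]mulrC [h22 * _]mulrC. Qed.

Lemma JDi : J Di = Di.
Proof.
rewrite -[LHS]mulr1 -DDi -{1}JD mulrA -wjM [Di * _]mulrC DDi wj1 mul1r //.
Qed.

Lemma dDi i : d i Di = - (Di * Di * d i sD).
Proof.
have E : d i sD * Di + sD * d i Di = 0 by rewrite -wdM DDi wd1.
have -> : d i Di = Di * (d i sD * Di + sD * d i Di) - Di * Di * d i sD by ring: DDi.
by rewrite E mulr0 sub0r.
Qed.

Lemma bDi i : b i Di = - (Di * Di * b i sD).
Proof.
have E : b i sD * Di + sD * b i Di = 0 by rewrite -wbM DDi wb1.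
have -> : b i Di = Di * (b i sD * Di + sD * b i Di) - Di * Di * b i sD by ring: DDi.
by rewrite E mulr0 sub0r.
Qed.

Lemma sric1E i j : sric1 i j = - b j (sG i).
Proof.
rewrite ric1_def !sum2 !sThetaE !sGE wbM bDi dDE !(wbD, wbN, wbM) bDE !sum2 !shuE /= -!wdb.
ring: hhDi.
Qed.

(** The curvature is -b_j of the connection coefficients with an index lowered, so exchanging its
    indices [i] and [k] adds b_j of the torsion; contracting turns the torsion into its trace
    eta. *)
Lemma sric4E i j : sric4 i j = - b j (sG i) + b j (seta i).
Proof.
rewrite -sric1E ric1_def !ric4_def !sum2 !sThetaE !setaE !stauE !(wbM, wbD, wbN) bDi bDE !sum2 !shuE /= -!wdb.
move: i; apply: ord2P; ring: hhDi.
Qed.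

Lemma sric3J i j : sric3 i j = J (sric4 j i).
Proof.
have huJ k l : J (shu k l) = shu l k.
  by rewrite !shuE wjM JDi; case: (k == i1); case: (l == i1); rewrite ?wjN hJ.
have ThJ k l p q : J (sTheta k l p q) = sTheta l k q p.
  rewrite !sThetaE !sum2 !(wjD, wjN, wjM) -!wbJ -!wdJ !hJ wdb !huJ.
  ring.
rewrite !ric3_def !ric4_def !sum2 !(wjD, wjM) !huJ !ThJ.
ring.
Qed.

Lemma bG_sym i j : b j (sG i) = d i (J (sG j)).
Proof.
by rewrite !sGE wjM JDi -wbJ JD wbM wdM dDi bDi wdb; ring.
Qed.

Lemma sric3E i j : sric3 i j = - b j (sG i) + d i (J (seta j)).
Proof.
by rewrite sric3J sric4E wjD wjN -!wdJ -bG_sym.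
Qed.

(** In dimension two the antisymmetric pair of indices takes one value only, so the torsion is a
    covector's worth of data and is recovered from its trace. *)
Lemma seta_tau l : stau l = seta i1 * h i2 l - seta i2 * h i1 l.
Proof.
rewrite !setaE; move: l; apply: ord2P; set t1 := stau i1; set t2 := stau i2;
  ring: hhDi.
Qed.

Lemma Jtau l : J (stau l) = b i1 (h l i2) - b i2 (h l i1).
Proof. by rewrite !stauE wjD wjN -!wbJ !hJ. Qed.

(** Up to sign, e is the divergence of the torsion. Through [trace_dtau] this closes up the
    Laplacian of |e|^2. *)
Lemma seE : - se = \sum_k \sum_j shu k j * (d k (stau j) - stau j * sG k).
Proof.
rewrite se_def !sum2 !shuE /= !setaE !sGE !stauE !(wdM, wdD, wdN) !dDi !dDE.
rewrite !(wdC W i2 i1); ring: hhDi.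
Qed.

Lemma traceL (x : 'I_2 -> 'I_2 -> A) :
  sD * (\sum_i \sum_j shu i j * x i j) =
  h22 * x i1 i1 - h21 * x i1 i2 - h12 * x i2 i1 + h11 * x i2 i2.
Proof. by rewrite !sum2 !shuE /=; ring: DDi. Qed.

Lemma trace_h f : \sum_i \sum_j shu i j * (f * h i j) = f + f.
Proof. by rewrite !sum2 !shuE /=; ring: hhDi. Qed.

Lemma trace_ric3 : \sum_i \sum_j shu i j * sric3 i j =
  \sum_i \sum_j \sum_k \sum_l shu i l * shu k j * sTheta i j k l.
Proof. by rewrite !sum2 !ric3_def !sum2; ring. Qed.

Lemma trace_ric4 : \sum_i \sum_j shu i j * sric4 i j =
  \sum_i \sum_j \sum_k \sum_l shu i l * shu k j * sTheta i j k l.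
Proof. by rewrite !sum2 !ric4_def !sum2; ring. Qed.

Hypothesis gaud :
  d i1 (b i1 h22) - d i2 (b i1 h12) - d i1 (b i2 h21) + d i2 (b i2 h11) = 0.

(** The Gauduchon condition says b_1 tau_2 = b_2 tau_1. Writing tau through eta by [seta_tau] and
    applying the product rule, the derivatives of h assemble into the conjugate torsion, which is
    linear in the conjugate of eta; hence a quadratic right side. *)
Lemma trace_eta :
  h22 * b i1 (seta i1) - h21 * b i2 (seta i1) - h12 * b i1 (seta i2)
  + h11 * b i2 (seta i2) = - sN seta (fun j => J (seta j)).
Proof.
have E : b i1 (stau i2) - b i2 (stau i1) = 0.
  by rewrite -gaud !stauE !(wbD, wbN) -!wdb; ring.
have J1 : b i1 h12 - b i2 h11 = J (stau i1) by rewrite Jtau.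
have J2 : b i1 h22 - b i2 h21 = J (stau i2) by rewrite Jtau.
have T1 : J (stau i1) = J (seta i1) * h12 - J (seta i2) * h11.
  by rewrite (seta_tau i1) wjD wjN !wjM !hJ.
have T2 : J (stau i2) = J (seta i1) * h22 - J (seta i2) * h21.
  by rewrite (seta_tau i2) wjD wjN !wjM !hJ.
move: E; rewrite !seta_tau !(wbD, wbN, wbM) => E.
apply/eqP; rewrite -subr_eq0; apply/eqP.
rewrite -[RHS]E !sNE.
have -> : b i1 h22 = J (stau i2) + b i2 h21 by rewrite -J2 subrK.
have -> : b i1 h12 = J (stau i1) + b i2 h11 by rewrite -J1 subrK.
rewrite T1 T2; ring.
Qed.

(** The divergence form of [seE]: only the quotients tau_j / det h are differentiated, which suits a
    change of coordinates. *)
Lemma seE2 : - se = h22 * d i1 (stau i1 * Di) - h21 * d i1 (stau i2 * Di)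
  - h12 * d i2 (stau i1 * Di) + h11 * d i2 (stau i2 * Di).
Proof.
rewrite seE !sum2 !shuE !sGE /= !wdM !dDi; ring.
Qed.

Variable f : A.
Hypothesis ein : forall i j, sric3 i j + sric4 i j = f * h i j.

Lemma ein_split i j :
  f * h i j = b j (seta i - (sG i + sG i)) + d i (J (seta j)).
Proof. by rewrite -ein sric3E sric4E !(wbD, wbN); ring. Qed.

(** Both summands of [ein_split] vanish under the antisymmetrised second derivative, one because b_1
    and b_2 commute, the other because d_1 and d_2 do. On the other side the only term without a
    derivative of [f] is [f] times the Gauduchon expression. *)
Lemma conformal_pde :
  sL f + d i1 f * (b i1 h22 - b i2 h21) + d i2 f * (b i2 h11 - b i1 h12)
  + b i1 f * (d i1 h22 - d i2 h12) + b i2 f * (d i2 h11 - d i1 h21) = 0.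
Proof.
have E : d i1 (b i1 (f * h22)) - d i2 (b i1 (f * h12))
    - d i1 (b i2 (f * h21)) + d i2 (b i2 (f * h11)) = 0.
  rewrite !ein_split; set s1 := seta i1 - _; set s2 := seta i2 - _.
  rewrite !(wbD, wdD) !wdb !(wbb i2 i1, wdC W i2 i1); ring.
rewrite -[RHS]E !(wbM, wdD, wdM) !sLE.
have -> : d i1 (b i1 h22) = d i2 (b i1 h12) + d i1 (b i2 h21) - d i2 (b i2 h11).
  by apply/eqP; rewrite -subr_eq0 -gaud; apply/eqP; ring.
ring.
Qed.

(** Antisymmetrise a d-derivative of [ein_split] in the holomorphic indices: with [f] constant the
    left side becomes f tau_j, the conjugate eta term cancels, and [sG] drops out because it is
    d-closed, being d log det h. *)
Lemma dbar_se j : d i1 f = 0 -> d i2 f = 0 -> b j se = f * stau j.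
Proof.
move=> f1 f2.
have E : d i1 (f * h i2 j) - d i2 (f * h i1 j) = f * stau j.
  by rewrite !wdM f1 f2 !stauE; ring.
rewrite -E !ein_split !(wdD, wdN) (wdC W i2 i1).
have G : d i1 (sG i2) = d i2 (sG i1).
  by rewrite !sGE !wdM !dDi (wdC W i2 i1); ring.
by rewrite !wdb se_def !(wdD, wdN) G !(wbD, wbN); ring.
Qed.

(** The trace of the equation, with both traces of derivatives of eta replaced by [trace_eta] and
    its conjugate. It is stated for doubles because 2 need not be cancellable in [A]. *)
Lemma Df_ric1 : J f = f ->
  h22 * sric1 i1 i1 - h21 * sric1 i1 i2 - h12 * sric1 i2 i1 + h11 * sric1 i2 i2
  + (h22 * sric1 i1 i1 - h21 * sric1 i1 i2 - h12 * sric1 i2 i1 + h11 * sric1 i2 i2)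
  = (sD * f + sN seta (fun j => J (seta j))) + (sD * f + sN seta (fun j => J (seta j))).
Proof.
move=> Jf.
have E : sD * (f + f) = sD * (\sum_i \sum_j shu i j * (sric3 i j + sric4 i j)).
  by rewrite -trace_h; congr (_ * _); rewrite !sum2 !ein.
rewrite traceL !sric3E !sric4E in E.
have T := trace_eta.
have T' : h22 * d i1 (J (seta i1)) - h21 * d i1 (J (seta i2)) - h12 * d i2 (J (seta i1))
  + h11 * d i2 (J (seta i2)) = - sN seta (fun j => J (seta j)).
  have TJ := congr1 J T; rewrite sNE !(wjD, wjN, wjM) !hJ !wjK in TJ.
  rewrite !wdJ [LHS](_ : _ = h22 * J (b i1 (seta i1)) - h12 * J (b i2 (seta i1))
    - h21 * J (b i1 (seta i2)) + h11 * J (b i2 (seta i2))); last by ring.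
  by rewrite TJ sNE; ring.
rewrite !sric1E.
set N := sN _ _ in T T' *.
rewrite [RHS](_ : _ = sD * (f + f) - (- N) - (- N)); last by ring.
rewrite E -{1}T -T'; ring.
Qed.

(** From d_i b_j D = D (d_i log D b_j log D + d_i b_j log D), the last term being minus the first
    Chern-Ricci form. *)
Lemma L_D : sL sD = sD * (sN sG (fun j => J (sG j)) -
  (h22 * sric1 i1 i1 - h21 * sric1 i1 i2 - h12 * sric1 i2 i1 + h11 * sric1 i2 i2)).
Proof.
have dbD i j : d i (b j sD) = sD * (sG i * J (sG j)) + sD * b j (sG i).
  have B : J (sG j) = b j sD * Di by rewrite sGE wjM -wbJ JD JDi.
  by rewrite B sGE !wbM bDi wdb; ring: DDi.
by rewrite sLE !dbD !sric1E sNE; ring.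
Qed.

(** With [v0] the maximum of |e|^2 / det h, the function [se * J se - v0 * sD] is nonpositive and
    vanishes at the maximum point; it replaces the quotient in the second derivative test. *)
Lemma grad_phi v0 i : (forall j, b j se = f * stau j) -> J f = f ->
  (forall j, d j v0 = 0) ->
  d i (se * J se - v0 * sD) = d i se * J se + se * f * J (stau i) - v0 * sD * sG i.
Proof.
move=> be Jf dv; rewrite wdD wdN !wdM dv wdJ be wjM Jf.
have -> : d i sD = sD * sG i by rewrite sGE mulrCA DDi mulr1.
ring.
Qed.

(** Since b_j e = f tau_j, second derivatives of e reduce to first derivatives of the torsion, whose
    trace is [T]. *)
Lemma L_phi v0 : (forall j, b j se = f * stau j) -> J f = f ->
  (forall j, d j f = 0) -> (forall j, d j v0 = 0) -> J v0 = v0 ->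
  let T := h22 * d i1 (stau i1) - h21 * d i1 (stau i2) - h12 * d i2 (stau i1)
    + h11 * d i2 (stau i2) in
  sL (se * J se - v0 * sD) =
    f * J se * T + f * f * sN (fun i => J (stau i)) stau
    + sN (fun i => d i se) (fun i => J (d i se)) + f * se * J T
    - v0 * sL sD.
Proof.
move=> be Jf df dv Jv T.
have bf j : b j f = 0 by rewrite wbE Jf df wj0.
have bv j : b j v0 = 0 by rewrite wbE Jv dv wj0.
have E i j : d i (b j (se * J se - v0 * sD)) =
   f * d i (stau j) * J se + f * f * stau j * J (stau i) + d i se * J (d j se)
   + f * se * J (d j (stau i)) - v0 * d i (b j sD).
  rewrite wbD wbN !wbM be bv mul0r add0r wbJ !(wdD, wdN, wdM) dv df !wdJ be.
  by rewrite -(wdb j i se) be !wdM !df !mul0r !add0r !wjM Jf; ring.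
rewrite sLE !E !sNE [sL sD]sLE /T !(wjD, wjN, wjM) !hJ; ring.
Qed.

Lemma trace_dtau : h22 * d i1 (stau i1) - h21 * d i1 (stau i2) - h12 * d i2 (stau i1)
    + h11 * d i2 (stau i2) = - (sD * se) + sN sG stau.
Proof.
have -> : sD * se = - (sD * - se) by rewrite mulrN opprK.
by rewrite seE !sum2 !shuE sNE /=; ring: DDi.
Qed.

End SurfaceAlgebra.

(* Evaluates q * sL phi at a critical point of phi = e * J e - v0 * D where
   phi = 0: a primed letter is the conjugate, u is the gradient of e, N is sN
   and k is the trace of the first Chern-Ricci form times D. *)
Lemma max_identity (K : comPzRingType) (g11 g12 g21 g22 : K) (e e' q f D k : K)
    (t t' G G' u u' : 'I_2 -> K) (tr tr' : K) :
  let N (a c : 'I_2 -> K) := g22 * a i1 * c i1 - g21 * a i1 * c i2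
    - g12 * a i2 * c i1 + g11 * a i2 * c i2 in
  e * e' = q ->
  (forall i, u i * e' = q * G i - e * f * t' i) ->
  (forall i, u' i * e = q * G' i - e' * f * t i) ->
  tr = - (D * e) + N G t -> tr' = - (D * e') + N t' G' ->
  q * (f * e' * tr + f * f * N t' t + N u u' + f * e * tr' - q * (N G G' - k)) =
  q * (q * k - (f * D * q + f * D * q) + (f * f * N t' t + f * f * N t' t)).
Proof.
move=> N Eq Hu Hu' -> ->.
(* The critical equations know [u] only through [u i * e']; the factor [q = e * e'] lets them be
   used without dividing by e. *)
have Nu : q * N u u' = N (fun i => q * G i - e * f * t' i) (fun i => q * G' i - e' * f * t i).
  by rewrite /N -!Hu -!Hu' -Eq; ring.
rewrite [LHS](_ : _ = q * (f * e' * (- (D * e) + N G t) + f * f * N t' t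
  + f * e * (- (D * e') + N t' G') - q * (N G G' - k)) + q * N u u'); last by ring.
rewrite Nu /N -Eq; ring.
Qed.

(** * Behaviour of torsion and e under a change of coordinates *)

Section Pullback.
Variables (A B : comPzRingType) (W : wirtinger A 2) (W' : wirtinger B 2).
Variables (P : B -> A) (jac : 'I_2 -> 'I_2 -> A).
Local Notation d := (wd W).
Local Notation J := (wj W).
Local Notation b := (wb W).
Hypothesis PD : forall x y, P (x + y) = P x + P y.
Hypothesis PM : forall x y, P (x * y) = P x * P y.
Hypothesis P1 : P 1 = 1.
Hypothesis PJ : forall x, P (wj W' x) = J (P x).
Hypothesis Pd : forall k x, d k (P x) = \sum_c jac c k * P (wd W' c x).
Hypothesis jac_hol : forall k a i, b k (jac a i) = 0.
Hypothesis jac_sym : forall a, d i1 (jac a i2) = d i2 (jac a i1).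

Variables (h : 'I_2 -> 'I_2 -> A) (Di : A) (h' : 'I_2 -> 'I_2 -> B) (Di' : B).
Hypothesis hJ : forall i j, J (h i j) = h j i.
Hypothesis DDi : sD h * Di = 1.
Hypothesis DDi' : sD h' * Di' = 1.
Hypothesis hE : forall i j, h i j = \sum_a \sum_c jac a i * J (jac c j) * P (h' a c).

Local Notation dj := (jac i1 i1 * jac i2 i2 - jac i1 i2 * jac i2 i1).

Lemma PN x : P (- x) = - P x.
Proof.
have P0 : P 0 = 0 by apply: (addrI (P 0)); rewrite -PD !addr0.
by apply/eqP; rewrite -addr_eq0 -PD addNr P0.
Qed.

Lemma sD_pullback : sD h = dj * J dj * P (sD h').
Proof.
rewrite !sDE PD PN !PM !hE !sum2 wjD wjN !wjM; ring.
Qed.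

(** Invertibility of the Jacobian determinant is read off the transformation law of det h, whose
    left side is invertible. The inverse is holomorphic like the determinant itself. *)
Lemma djV : {x : A | dj * x = 1 & forall k, b k x = 0}.
Proof.
have E : dj * (J dj * P (sD h') * Di) = 1 by rewrite -DDi sD_pullback; ring.
exists (J dj * P (sD h') * Di) => // k; set x := J dj * _ * _ in E *.
have bdj : b k dj = 0 by rewrite wbD wbN !wbM !jac_hol; ring.
have := congr1 (b k) E; rewrite wb1 wbM bdj mul0r add0r => E0.
by rewrite -[b k x]mul1r -E mulrAC E0 mul0r.
Qed.

Lemma Di_pullback x : dj * x = 1 -> Di = x * J x * P Di'.
Proof.
move=> E; have E' : J dj * J x = 1 by rewrite -wjM E wj1.
have EP : P (sD h') * P Di' = 1 by rewrite -PM DDi' P1.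
rewrite -[LHS](_ : (dj * x) * (J dj * J x) * (P (sD h') * P Di') * Di = _);
  last by rewrite E E' EP; ring.
rewrite -[RHS]mulr1 -DDi sD_pullback; ring.
Qed.

(** Conjugate Jacobian entries are killed by d_k, and second derivatives of the coordinate change
    cancel by [jac_sym]: the torsion is a (2,1)-form. *)
Lemma stau_pullback l :
  stau W h l = dj * \sum_m J (jac m l) * P (stau W' h' m).
Proof.
have Jh k c j : d k (J (jac c j)) = 0 by rewrite wdJ jac_hol wj0.
rewrite !stauE !sum2 !stauE !PD !PN !hE !sum2 !(wdD, wdM) !Jh !Pd !sum2 !jac_sym.
ring.
Qed.

(** In the divergence form [seE2] one differentiates tau / det h, which transforms with
    antiholomorphic factors only; d_i passes through them, and no derivative of the Jacobian
    survives. *)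
Lemma se_pullback : se W h Di = dj * P (se W' h' Di').
Proof.
have [x Ex bx] := djV.
have Ex' : J dj * J x = 1 by rewrite -wjM Ex wj1.
have dJx k : d k (J x) = 0 by rewrite wdJ bx wj0.
have Jh k c j : d k (J (jac c j)) = 0 by rewrite wdJ jac_hol wj0.
have S j : stau W h j * Di = J x * \sum_m J (jac m j) * P (stau W' h' m * Di').
  rewrite stau_pullback (Di_pullback Ex) !sum2 !PM.
  rewrite -[RHS]mul1r -{1}Ex; ring.
have E : - (dj * P (se W' h' Di')) = dj * P (- se W' h' Di') by rewrite PN mulrN.
apply: oppr_inj; rewrite E (seE2 W DDi) (seE2 W' DDi') !S !sum2.
move: (stau W' h' i1 * Di') (stau W' h' i2 * Di') => u1 u2.
rewrite !wdM !dJx !(wdD, wdM) !Jh !Pd !sum2 !(PD, PN) !PM !hE !sum2.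
rewrite -[RHS]mul1r -{1}Ex' wjD wjN !wjM; ring.
Qed.

Lemma norm_se_pullback : se W h Di * J (se W h Di) * Di =
  P (se W' h' Di' * wj W' (se W' h' Di') * Di').
Proof.
have [x Ex _] := djV.
have Ex' : J dj * J x = 1 by rewrite -wjM Ex wj1.
rewrite se_pullback wjM !PM PJ (Di_pullback Ex).
set y := P (se _ _ _); set z := P Di'; set t := J y.
transitivity ((dj * x) * (J dj * J x) * (y * t * z)); first by ring.
by rewrite Ex Ex' !mul1r.
Qed.

End Pullback.

(** * The chain rule for d/dz^k under a holomorphic map *)

Section PartialsPullback.
Variables (A B : comPzRingType) (n : nat).
Variables (pd : 'I_(n + n) -> A -> A) (pd' : 'I_(n + n) -> B -> B).
Variables (cj : A -> A) (I H : A) (I' H' : B).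
Variables (P : B -> A) (r : 'I_(n + n) -> A).
Hypothesis pdD : forall m x y, pd m (x + y) = pd m x + pd m y.
Hypothesis pdM : forall m x y, pd m (x * y) = pd m x * y + x * pd m y.
Hypothesis pdI : forall m, pd m I = 0.
Hypothesis pdcj : forall m x, pd m (cj x) = cj (pd m x).
Hypothesis cjD : forall x y, cj (x + y) = cj x + cj y.
Hypothesis cjM : forall x y, cj (x * y) = cj x * cj y.
Hypothesis cjI : cj I = - I.
Hypothesis cjH : cj H = H.
Hypothesis cjr : forall i, cj (r i) = r i.
Hypothesis PB : forall x y, P (x - y) = P x - P y.
Hypothesis PM : forall x y, P (x * y) = P x * P y.
Hypothesis PI : P I' = I.
Hypothesis PH : P H' = H.
Hypothesis II : I * I = - 1.
Hypothesis HH : H + H = 1.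
Hypothesis Ppd : forall m x, pd m (P x) = \sum_i pd m (r i) * P (pd' i x).
Hypothesis hol : forall k c, wdzb pd I H k (r (lshift n c) + I * r (rshift n c)) = 0.

(** Real and imaginary parts do not exist in [A]: the two equations come from the sum and the
    difference of the holomorphy equation and its conjugate, the [r i] being self-conjugate. *)
Lemma cauchy_riemann k c :
  pd (lshift n k) (r (lshift n c)) = pd (rshift n k) (r (rshift n c)) /\
  pd (rshift n k) (r (lshift n c)) = - pd (lshift n k) (r (rshift n c)).
Proof.
have := hol k c; rewrite /wdzb !pdD !pdM !pdI !mul0r !add0r.
set a1 := pd _ (r (lshift n c)); set a2 := pd _ (r (rshift n c)).
set b1 := pd _ (r (lshift n c)); set b2 := pd _ (r (rshift n c)) => Z.
have cj0 : cj 0 = 0 by apply: (addrI (cj 0)); rewrite -cjD !addr0.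
have := congr1 cj Z; rewrite !(cjM, cjD) cjI cjH cj0 -!pdcj !cjr -/a1 -/a2 -/b1 -/b2 => Zc.
split; apply/eqP.
  rewrite -subr_eq0 -[X in X == _]mulr1 -HH.
  rewrite [X in X == _](_ : _ = (a1 + I * a2 + I * (b1 + I * b2)) * H +
     (a1 + - I * a2 + - I * (b1 + - I * b2)) * H); last by ring: II.
  by rewrite Z Zc addr0.
rewrite -addr_eq0 -[X in X == _]mulr1 -HH.
rewrite [X in X == _](_ : _ = - I * ((a1 + I * a2 + I * (b1 + I * b2)) * H -
   (a1 + - I * a2 + - I * (b1 + - I * b2)) * H)); last by ring: II.
by rewrite Z Zc subrr mulr0.
Qed.

(** The real chain rule regrouped over pairs of real coordinates; by Cauchy-Riemann the contribution
    of the d/d\bar z^c derivatives vanishes. *)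
Lemma wdz_pullback k x :
  wdz pd I H k (P x) =
  \sum_c wdz pd I H k (r (lshift n c) + I * r (rshift n c)) * P (wdz pd' I' H' c x).
Proof.
have E c y y' : wdz pd I H k (r (lshift n c)) * y + wdz pd I H k (r (rshift n c)) * y' =
    wdz pd I H k (r (lshift n c) + I * r (rshift n c)) * ((y - I * y') * H).
  have [C1 C2] := cauchy_riemann k c.
  rewrite /wdz !pdD !pdM !pdI !mul0r !add0r C2 C1.
  set a1 := pd _ _; set a2 := pd _ _.
  rewrite -[LHS]mulr1 -HH; ring: II.
transitivity (\sum_i wdz pd I H k (r i) * P (pd' i x)).
  rewrite /wdz !Ppd mulr_sumr -sumrB mulr_suml; apply: eq_bigr => i _; ring.
rewrite big_split_ord /= -big_split /=; apply: eq_bigr => c _.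
by rewrite E /wdz PM PB PM PI PH.
Qed.

End PartialsPullback.

Section Sums.
Variable A : nmodType.
Lemma sum4 (F : 'I_(2 + 2) -> A) : \sum_m F m =
  F (lshift 2 i1) + F (lshift 2 i2) + (F (rshift 2 i1) + F (rshift 2 i2)).
Proof. by rewrite big_split_ord /= !sum2. Qed.
End Sums.

(** * Levi forms and positive definite matrices of size two *)

Section LeviForm.
Variable R : realType.
Local Notation C := R[i].

(** For a = p + i q the Levi form is the sum of the real quadratic form at a and at i a, that is at
    (p, q) and (-q, p). *)
Lemma levi_form (H : 'I_(2 + 2) -> 'I_(2 + 2) -> R) (a : 'I_2 -> C) :
  (forall i j, H i j = H j i) ->
  (forall u : 'rV[R]_(2 + 2), \sum_i \sum_j u ord0 i * u ord0 j * H i j <= 0) ->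
  \sum_i \sum_j a i * (a j)^*%C *
    ((H (lshift 2 i) (lshift 2 j) + H (rshift 2 i) (rshift 2 j)) +i*
     (H (lshift 2 i) (rshift 2 j) - H (rshift 2 i) (lshift 2 j)))%C <= 0.
Proof.
move=> Hs Hn; rewrite !sum2.
case: (a i1) => p1 q1; case: (a i2) => p2 q2.
pose u (x1 x2 y1 y2 : R) : 'rV[R]_(2 + 2) := row_mx (\row_i (if i == i1 then x1 else x2))
   (\row_i (if i == i1 then y1 else y2)).
have uE x1 x2 y1 y2 : [/\ u x1 x2 y1 y2 ord0 (lshift 2 i1) = x1,
    u x1 x2 y1 y2 ord0 (lshift 2 i2) = x2, u x1 x2 y1 y2 ord0 (rshift 2 i1) = y1 &
    u x1 x2 y1 y2 ord0 (rshift 2 i2) = y2].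
  by rewrite /u !row_mxEl !row_mxEr !mxE.
have := Hn (u p1 p2 q1 q2); have := Hn (u (- q1) (- q2) p1 p2).
have [U1 U2 U3 U4] := uE p1 p2 q1 q2; have [V1 V2 V3 V4] := uE (- q1) (- q2) p1 p2.
rewrite !sum4 U1 U2 U3 U4 V1 V2 V3 V4 {uE U1 U2 U3 U4 V1 V2 V3 V4}.
rewrite (Hs (lshift 2 i2) (lshift 2 i1)) (Hs (rshift 2 i2) (rshift 2 i1)).
rewrite (Hs (rshift 2 i1) (lshift 2 i1)) (Hs (rshift 2 i1) (lshift 2 i2)).
rewrite (Hs (rshift 2 i2) (lshift 2 i1)) (Hs (rshift 2 i2) (lshift 2 i2)).
move: (H (lshift 2 i1) (lshift 2 i1)) (H (lshift 2 i1) (lshift 2 i2))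
  (H (lshift 2 i2) (lshift 2 i2)) (H (rshift 2 i1) (rshift 2 i1))
  (H (rshift 2 i1) (rshift 2 i2)) (H (rshift 2 i2) (rshift 2 i2))
  (H (lshift 2 i1) (rshift 2 i1)) (H (lshift 2 i1) (rshift 2 i2))
  (H (lshift 2 i2) (rshift 2 i1)) (H (lshift 2 i2) (rshift 2 i2)).
move=> h1 h2 h3 h4 h5 h6 h7 h8 h9 h10 L1 L2.
rewrite lecE /=; apply/andP; split; first by apply/eqP; ring.
have := lerD L1 L2; rewrite addr0; apply: le_trans.
rewrite le_eqVlt; apply/orP; left; apply/eqP; ring.
Qed.

Section Posdef.
Variable H : 'M[C]_2.
Hypothesis Hpos : hermitian_posdef H.
Local Notation H11 := (H i1 i1).
Local Notation H12 := (H i1 i2).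
Local Notation H21 := (H i2 i1).
Local Notation H22 := (H i2 i2).

Lemma posdef_form (x y : C) : (x != 0) || (y != 0) ->
  0 < H11 * x * x^*%C + H12 * x * y^*%C + (H21 * y * x^*%C + H22 * y * y^*%C).
Proof.
move=> xy; have [_ /(_ (\row_i if i == i1 then x else y))] := Hpos.
rewrite !sum2 !mxE /=; apply.
apply/eqP => /rowP E; have := E i1; have := E i2; rewrite !mxE /= => y0 x0.
by rewrite x0 y0 !eqxx in xy.
Qed.

Lemma posdef_22 : 0 < H22.
Proof.
have := @posdef_form 0 1; rewrite oner_neq0 orbT => /(_ isT).
by rewrite !conjc1 !conjc0 !(mulr0, mulr1, add0r).
Qed.

Lemma posdef_det : 0 < H11 * H22 - H12 * H21.
Proof.
have p22 := posdef_22; have [hJ _] := Hpos.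
have := @posdef_form H22 (- H12); rewrite gt_eqF //= => /(_ isT).
rewrite rmorphN /= -!hJ.
rewrite [X in 0 < X](_ : _ = H22 * (H11 * H22 - H12 * H21)); last by ring.
by rewrite pmulr_rgt0.
Qed.

(** Completing the square: [H22] times the form is |H22 x - H12 y|^2 + det |y|^2. *)
Lemma posdef_adj_ge0 (x y : C) :
  0 <= H22 * x * x^*%C - H21 * x * y^*%C - H12 * y * x^*%C + H11 * y * y^*%C.
Proof.
have p22 := posdef_22; have pD := posdef_det; have [hJ _] := Hpos.
rewrite -(pmulr_rge0 _ p22).
rewrite [X in 0 <= X](_ : _ = (H22 * x - H12 * y) * (H22 * x - H12 * y)^*%C
  + (H11 * H22 - H12 * H21) * (y * y^*%C)).
  by rewrite addr_ge0 ?mulcJ_ge0 // mulr_ge0 ?mulcJ_ge0 // ltW.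
rewrite rmorphB !rmorphM /= -!hJ; ring.
Qed.

Lemma posdef_adj_gt0 (x y : C) : (x != 0) || (y != 0) ->
  0 < H22 * x * x^*%C - H21 * x * y^*%C - H12 * y * x^*%C + H11 * y * y^*%C.
Proof.
move=> xy; rewrite lt_neqAle posdef_adj_ge0 andbT; apply/eqP => E.
have p22 := posdef_22; have pD := posdef_det; have [hJ _] := Hpos.
have S : (H22 * x - H12 * y) * (H22 * x - H12 * y)^*%C
    + (H11 * H22 - H12 * H21) * (y * y^*%C) = 0.
  by rewrite -[RHS](mulr0 H22) E rmorphB !rmorphM /= -!hJ; ring.
have y0 : y = 0.
  have S' : (H11 * H22 - H12 * H21) * (y * y^*%C) <= 0.
    by rewrite -S lerDr mulcJ_ge0.
  move: S'; rewrite pmulr_rle0 // => S'.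
  have : y * y^*%C = 0 by apply/eqP; rewrite eq_le S' mulcJ_ge0.
  by move/eqP; rewrite mulf_eq0 conjc_eq0 orbb => /eqP.
have x0 : x = 0.
  move/eqP: S; rewrite y0 mul0r !mulr0 subr0 addr0 mulf_eq0 conjc_eq0 orbb mulf_eq0.
  by rewrite gt_eqF //= => /eqP.
by rewrite x0 y0 !eqxx in xy.
Qed.

(** [H22] times the adjugate is the rank one form of (H22, -H12) plus det times that of (0, 1), so
    the trace is a positive combination of values of the form of [X]. *)
Lemma levi_trace_le0 (X : 'I_2 -> 'I_2 -> C) :
  (forall a : 'I_2 -> C, \sum_i \sum_j a i * (a j)^*%C * X i j <= 0) ->
  H22 * X i1 i1 - H21 * X i1 i2 - H12 * X i2 i1 + H11 * X i2 i2 <= 0.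
Proof.
move=> Xn; have p22 := posdef_22; have pD := posdef_det; have [hJ _] := Hpos.
rewrite -(pmulr_rle0 _ p22).
have := Xn (fun i => if i == i1 then H22 else - H12).
have := Xn (fun i => if i == i1 then 0 else 1).
rewrite !sum2 !eqxx (_ : (i2 == i1) = false) // conjc0 conjc1 rmorphN /= -!hJ => L1 L2.
rewrite [X in X <= 0](_ : _ =
   (H22 * H22 * X i1 i1 + H22 * - H21 * X i1 i2 +
     (- H12 * H22 * X i2 i1 + - H12 * - H21 * X i2 i2)) +
   (H11 * H22 - H12 * H21) * (X i2 i2)); last by ring.
have L1' : X i2 i2 <= 0 by move: L1; rewrite !(mul0r, mulr0, mul1r, add0r).
rewrite -[leRHS]addr0 lerD //; rewrite pmulr_rle0 //.
Qed.

End Posdef.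
End LeviForm.

(** * Pullback of smooth functions by a holomorphic map *)

Section CinfPullback.
Variables (R : realType) (n : nat) (W W' : opens R n).
Local Notation V := (cspace R n).
Local Notation e_ := (@basis_vec R n).
Local Notation C := R[i].
Local Notation U := (opset W).
Local Notation oU := (opset_open W).
Local Notation U' := (opset W').
Local Notation A := (cinfty W).
Variable phi : V -> V.
Hypothesis phiW : forall p, U p -> U' (phi p).
Hypothesis phiC : forall p, U p -> {for p, continuous phi}.
Hypothesis phiS : forall k, holomorphic U (fun p => zcoord k (phi p)).

Lemma phi_smooth i : smooth U (fun p => phi p ord0 i).
Proof. by case: (split_ordP i) => k ->; have [[s1 s2] _] := phiS k. Qed.

Lemma smooth_comp (f : V -> R) : smooth U' f -> smooth U (fun p => f (phi p)).
Proof.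
move=> sf k.
exact: (Ck_comp oU (opset_open W') phiW phiC (fun i => phi_smooth i k) (sf k)).
Qed.

Lemma csmooth_comp (F : V -> C) : csmooth U' F -> csmooth U (fun p => F (phi p)).
Proof. by move=> [s1 s2]; split; [exact: (smooth_comp s1)|exact: (smooth_comp s2)]. Qed.

Lemma complex_sum_scale (T : Type) (r : seq T) (a b c : T -> R) :
  Complex (\sum_(i <- r) a i * b i) (\sum_(i <- r) a i * c i) =
  \sum_(i <- r) (a i)%:C%C * Complex (b i) (c i).
Proof.
elim: r => [|i r IH]; first by rewrite !big_nil.
rewrite !big_cons -IH; apply/eqP; rewrite eq_complex /= !mul0r subr0 addr0.
by rewrite !eqxx.
Qed.

Lemma cderive_comp (F : V -> C) m p : csmooth U' F -> U p ->
  cderive (e_ m) (fun q => F (phi q)) p =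
  \sum_i ('D_(e_ m) (fun q => phi q ord0 i) p)%:C%C * cderive (e_ i) F (phi p).
Proof.
move=> [s1 s2] Up.
have dp i : derivable (fun x => phi x ord0 i) p (e_ m).
  exact: (smooth_derivable (phi_smooth i) Up).
have [_ E1] := derivable_comp_chain
  (C1_differentiable (opset_open W') (s1 1%N) (phiW Up)) dp.
have [_ E2] := derivable_comp_chain
  (C1_differentiable (opset_open W') (s2 1%N) (phiW Up)) dp.
apply: (etrans (f_equal2 (@Complex R) E1 E2)).
exact: complex_sum_scale.
Qed.

Lemma pb_subproof (x : cinfty W') : {y : A | forall p, U p -> y p = x (phi p)}.
Proof.
by exists (mkf (csmooth_comp (cfun_smooth x))) => p; exact: mkfE.
Qed.

Definition pb x : A := sval (pb_subproof x).

Lemma pbE x p : U p -> pb x p = x (phi p).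
Proof. exact: svalP (pb_subproof x) p. Qed.

Lemma coord_subproof i : {y : A | forall p, U p -> y p = (phi p ord0 i)%:C%C}.
Proof.
have s : csmooth U (fun p => (phi p ord0 i)%:C%C).
  by split; [exact: (phi_smooth i)|move=> k; exact: Ck_cst].
by exists (mkf s) => p; exact: mkfE.
Qed.

Definition rphi i : A := sval (coord_subproof i).

Lemma rphiE i p : U p -> rphi i p = (phi p ord0 i)%:C%C.
Proof. exact: svalP (coord_subproof i) p. Qed.

Definition zphi c : A := rphi (lshift n c) + cstf W 'i%C * rphi (rshift n c).

Lemma zphiE c p : U p -> zphi c p = zcoord c (phi p).
Proof.
move=> Up; apply: (etrans (cfD _ _ Up)).
apply: (etrans (f_equal2 +%R (rphiE _ Up) (etrans (cfM _ _ Up)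
   (f_equal2 *%R (cstfE _ Up) (rphiE _ Up))))).
apply/eqP; rewrite eq_complex /= !(mul0r, mul1r, subr0, addr0, add0r) !eqxx //.
Qed.

Lemma pbD x y : pb (x + y) = pb x + pb y.
Proof.
apply: cinf_ext => p Up; have Up' := phiW Up.
apply: (etrans (pbE _ Up)); apply: (etrans (cfD _ _ Up')).
by apply: etrans (esym (cfD _ _ Up)); rewrite !pbE.
Qed.

Lemma pbM x y : pb (x * y) = pb x * pb y.
Proof.
apply: cinf_ext => p Up; have Up' := phiW Up.
apply: (etrans (pbE _ Up)); apply: (etrans (cfM _ _ Up')).
by apply: etrans (esym (cfM _ _ Up)); rewrite !pbE.
Qed.

Lemma pbB x y : pb (x - y) = pb x - pb y.
Proof.
have pb0 : pb 0 = 0 by apply: (addrI (pb 0)); rewrite -pbD !addr0.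
have pbN z : pb (- z) = - pb z by apply/eqP; rewrite -addr_eq0 -pbD addNr pb0.
by rewrite pbD pbN.
Qed.

Lemma pb_cst c : pb (cstf W' c) = cstf W c.
Proof.
apply: cinf_ext => p Up; have Up' := phiW Up.
by apply: (etrans (pbE _ Up)); apply: (etrans (cstfE _ Up')); rewrite cstfE.
Qed.

Lemma pb1 : pb 1 = 1.
Proof. exact: pb_cst. Qed.

Lemma pbJ x : pb (conjf x) = conjf (pb x).
Proof.
apply: cinf_ext => p Up; have Up' := phiW Up.
apply: (etrans (pbE _ Up)); apply: (etrans (conjfE _ Up')).
by apply: etrans (esym (conjfE _ Up)); rewrite pbE.
Qed.

Lemma cf_sum (T : Type) (r : seq T) (F : T -> A) p : U p ->
  (\sum_(i <- r) F i) p = \sum_(i <- r) F i p.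
Proof.
move=> Up; elim: r => [|i r IH]; first by rewrite !big_nil; exact: cf0.
by rewrite !big_cons; apply: (etrans (cfD _ _ Up)); rewrite IH.
Qed.

Lemma pdf_rphi m i p : U p ->
  pdf m (rphi i) p = ('D_(e_ m) (fun q => phi q ord0 i) p)%:C%C.
Proof.
move=> Up; apply: (etrans (pdfE _ _ Up)).
transitivity (cderive (e_ m) (fun q => (phi q ord0 i)%:C%C) p).
  apply: near_eq_cderive.
  by apply: (near_open oU Up) => q Uq; exact: rphiE.
by apply: (f_equal2 (@Complex R)) => //; exact: derive_cst.
Qed.

Lemma pdf_pb m x : pdf m (pb x) = \sum_i pdf m (rphi i) * pb (pdf i x).
Proof.
apply: cinf_ext => p Up; have Up' := phiW Up.
apply: (etrans (pdfE _ _ Up)).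
transitivity (cderive (e_ m) (fun q => x (phi q)) p).
  apply: near_eq_cderive.
  by apply: (near_open oU Up) => q Uq; exact: pbE.
apply: (etrans (cderive_comp m (cfun_smooth x) Up)).
apply: etrans (esym (cf_sum _ _ Up)); apply: eq_bigr => i _.
apply: etrans (esym (cfM _ _ Up)).
apply: (f_equal2 *%R); first exact: (esym (pdf_rphi _ _ Up)).
exact: (esym (etrans (pbE _ Up) (pdfE _ _ Up'))).
Qed.

Lemma conjf_rphi i : conjf (rphi i) = rphi i.
Proof.
apply: cinf_ext => p Up; apply: (etrans (conjfE _ Up)).
by rewrite rphiE // conjc_real.
Qed.

Lemma cst_ii : cstf W 'i%C * cstf W 'i%C = -1.
Proof.
apply: cinf_ext => p Up; apply: (etrans (cfM _ _ Up)); rewrite !cstfE //.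
apply: etrans (esym (cfN _ Up)); rewrite cf1 //.
by rewrite -expr2 sqr_i.
Qed.

Lemma cst_half : cstf W 2%:R^-1 + cstf W 2%:R^-1 = 1.
Proof.
apply: cinf_ext => p Up; apply: (etrans (cfD _ _ Up)); apply: etrans (esym (cf1 Up)).
by rewrite !(cstfE _ Up) [RHS]splitr mul1r.
Qed.

Lemma zphi_hol k c :
  wdzb (@pdf _ _ W) (cstf W 'i%C) (cstf W 2%:R^-1) k (zphi c) = 0.
Proof.
apply: cinf_ext => p Up; apply: (etrans (wdzbE _ _ Up)).
apply: etrans (esym (cf0 Up)); apply: etrans ((phiS c).2 _ Up k).
by apply: dzb_near; apply: (near_open oU Up) => q Uq; exact: zphiE.
Qed.

Definition jacf c k : A := wd (cinf_wirtinger W) k (zphi c).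

Lemma jacfE c k p : U p -> jacf c k p = dz k (fun q => zcoord c (phi q)) p.
Proof.
move=> Up; rewrite /jacf cinf_wd; apply: (etrans (wdzE _ _ Up)).
by apply: dz_near; apply: (near_open oU Up) => q Uq; exact: zphiE.
Qed.

Lemma pb_chain k x : wd (cinf_wirtinger W) k (pb x) =
  \sum_c jacf c k * pb (wd (cinf_wirtinger W') c x).
Proof.
rewrite cinf_wd.
rewrite (wdz_pullback (@pdfD _ _ W) (@pdfM _ _ W) (fun m => pdf_cst W m 'i%C)
  (@pdf_conj _ _ W) (@conjfD _ _ W) (@conjfM _ _ W) (conjf_I W) (conjf_half W)
  conjf_rphi pbB pbM (pb_cst 'i%C) (pb_cst 2%:R^-1) cst_ii cst_half pdf_pb zphi_hol).
by apply: eq_bigr => c _; rewrite /jacf !cinf_wd.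
Qed.

Lemma jacf_hol k c i :
  wj (cinf_wirtinger W) (wd (cinf_wirtinger W) k (wj (cinf_wirtinger W) (jacf c i))) = 0.
Proof.
rewrite /jacf -wdbC.
have -> : wj (cinf_wirtinger W) (wd (cinf_wirtinger W) k
   (wj (cinf_wirtinger W) (zphi c))) = 0.
  rewrite !cinf_wj cinf_wd; apply: etrans (zphi_hol k c).
  exact: (wdzb_conj (@conjfD _ _ W) (@conjfM _ _ W) (@conjfK _ _ W) (@pdf_conj _ _ W) (conjf_I W) (conjf_half W)).
by apply: (addrI (wd (cinf_wirtinger W) i 0)); rewrite -wdD !addr0.
Qed.

End CinfPullback.

(** * The second derivative test *)

Section SurfaceMaximum.
Variables (R : realType) (W : opens R 2).
Local Notation V := (cspace R 2).
Local Notation e_ := (@basis_vec R 2).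
Local Notation C := R[i].
Local Notation U := (opset W).
Local Notation oU := (opset_open W).
Local Notation A := (cinfty W).
Local Notation WW := (cinf_wirtinger W).
Implicit Types (x y : A).

Lemma wd_cinfE k x p : U p -> wd WW k x p = dz k x p.
Proof. by move=> Up; rewrite cinf_wd; exact: wdzE. Qed.

Lemma wb_cinf k x : wb WW k x = wdzb (@pdf _ _ W) (cstf W 'i%C) (cstf W 2%:R^-1) k x.
Proof.
rewrite wbE !cinf_wj cinf_wd; exact: (wdzb_conj (@conjfD _ _ W) (@conjfM _ _ W) (@conjfK _ _ W)
  (@pdf_conj _ _ W) (conjf_I W) (conjf_half W)).
Qed.

Lemma wb_cinfE k x p : U p -> wb WW k x p = dzb k x p.
Proof. by move=> Up; rewrite wb_cinf; exact: wdzbE. Qed.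

Lemma wj_cinfE x p : U p -> wj WW x p = (x p)^*%C.
Proof. by move=> Up; rewrite cinf_wj; exact: conjfE. Qed.

Variables (x : A) (p : V).
Hypothesis xJ : wj WW x = x.
Variable O : set V.
Hypothesis oO : open O.
Hypothesis Op : O p.
Hypothesis sO : O `<=` U.
Hypothesis xmax : forall q, O q -> complex.Re (x q) <= complex.Re (x p).
Let Up : U p := sO Op.

Local Notation g := (fun q => complex.Re (x q)).

Lemma real_Im q : U q -> complex.Im (x q) = 0.
Proof.
move=> Uq; have := conjfE x Uq; rewrite -cinf_wj xJ => /(congr1 (@complex.Im R)).
by rewrite ImJ => E; apply/eqP; rewrite -eqNr -E.
Qed.

Lemma pdf_max m : pdf m x p = 0.
Proof.
apply: (etrans (pdfE _ _ Up)); have [s1 s2] := cfun_smooth x.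
apply: (f_equal2 (@Complex R)); first exact: (derive_at_max _ oO (Ck_sub sO (s1 1%N)) Op xmax).
apply: (etrans (near_eq_derive _ _)); last exact: (derive_cst (0 : R)).
by apply: (near_open oU Up) => q; exact: real_Im.
Qed.

Lemma hess_subproof : {H : 'I_(2 + 2) -> 'I_(2 + 2) -> R |
  forall i j, H i j = 'D_(e_ i) (fun q => 'D_(e_ j) g q) p}.
Proof. by exists (fun i j => 'D_(e_ i) (fun q => 'D_(e_ j) g q) p). Qed.

Definition hess i j : R := sval hess_subproof i j.

Lemma hessE i j : hess i j = 'D_(e_ i) (fun q => 'D_(e_ j) g q) p.
Proof. exact: svalP hess_subproof i j. Qed.

Lemma pdf_pdf_hess i j : pdf i (pdf j x) p = (hess i j)%:C%C.
Proof.
apply: (etrans (pdf_pdfE _ _ _ Up)).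
apply: (f_equal2 (@Complex R)); first exact: (esym (hessE i j)).
apply: (etrans (near_eq_derive _ _)); last exact: (derive_cst (0 : R)).
apply: (near_open oU Up) => q Uq.
apply: (etrans (near_eq_derive _ _)); last exact: (derive_cst (0 : R)).
by apply: (near_open oU Uq) => q' ; exact: real_Im.
Qed.

Lemma wd_max k : wd WW k x p = 0.
Proof.
rewrite cinf_wd; apply: (etrans (cfM _ _ Up)); apply: etrans (mul0r _); apply: (f_equal2 *%R) => //.
apply: (etrans (cfD _ _ Up)); rewrite pdf_max add0r.
apply: (etrans (cfN _ Up)); apply: etrans (oppr0 _); apply: (f_equal -%R).
by apply: (etrans (cfM _ _ Up)); rewrite pdf_max mulr0.
Qed.

Lemma hess_sym i j : hess i j = hess j i.
Proof.
have [s1 s2] := cfun_smooth x.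
apply: (etrans (hessE i j)); apply: etrans (esym (hessE j i)).
exact: (@schwarz _ _ _ _ _ j i oU (s1 2%N) Up).
Qed.

Lemma hess_neg (u : 'rV[R]_(2 + 2)) :
  \sum_i \sum_j u ord0 i * u ord0 j * hess i j <= 0.
Proof.
have [s1 s2] := cfun_smooth x.
have := second_derive_at_max u oO (Ck_sub sO (s1 2%N)) Op xmax; congr (_ <= 0).
by do 2 (apply: eq_bigr => ? _); apply: (f_equal2 *%R) => //; exact/esym/hessE.
Qed.

Lemma wd_wb_hess i j : 4%:R * wd WW i (wb WW j x) p =
    ((hess (lshift 2 i) (lshift 2 j) + hess (rshift 2 i) (rshift 2 j)) +i*
     (hess (lshift 2 i) (rshift 2 j) - hess (rshift 2 i) (lshift 2 j)))%C.
Proof.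
have E : wd WW i (wb WW j x) = cstf W 2%:R^-1 * cstf W 2%:R^-1 *
  (pdf (lshift 2 i) (pdf (lshift 2 j) x)
   - cstf W 'i%C * cstf W 'i%C * pdf (rshift 2 i) (pdf (rshift 2 j) x)
   + cstf W 'i%C * (pdf (lshift 2 i) (pdf (rshift 2 j) x)
   - pdf (rshift 2 i) (pdf (lshift 2 j) x))).
  rewrite wb_cinf cinf_wd.
  exact: (wdz_wdzbE (@pdfD _ _ W) (@pdfM _ _ W) (fun m => pdf_cst W m 'i%C)
    (fun m => pdf_cst W m 2%:R^-1)).
have E' : wd WW i (wb WW j x) p = 2%:R^-1 * 2%:R^-1 *
  (pdf (lshift 2 i) (pdf (lshift 2 j) x) p
   - 'i%C * 'i%C * pdf (rshift 2 i) (pdf (rshift 2 j) x) p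
   + 'i%C * (pdf (lshift 2 i) (pdf (rshift 2 j) x) p
   - pdf (rshift 2 i) (pdf (lshift 2 j) x) p)).
  rewrite E; apply: (etrans (cfM _ _ Up)); apply: (f_equal2 *%R).
    by apply: (etrans (cfM _ _ Up)); rewrite !(cstfE _ Up).
  apply: (etrans (cfD _ _ Up)); apply: (f_equal2 +%R).
    apply: (etrans (cfD _ _ Up)); apply: (f_equal2 +%R) => //.
    apply: (etrans (cfN _ Up)); apply: (f_equal -%R).
    apply: (etrans (cfM _ _ Up)); apply: (f_equal2 *%R) => //.
    by apply: (etrans (cfM _ _ Up)); rewrite !(cstfE _ Up).
  apply: (etrans (cfM _ _ Up)); apply: (f_equal2 *%R); first exact: cstfE.
  apply: (etrans (cfD _ _ Up)); apply: (f_equal2 +%R) => //.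
  exact: cfN.
have Q (a1 a2 a3 a4 : R) (P1 P2 P3 P4 : C) :
    P1 = a1%:C%C -> P2 = a2%:C%C -> P3 = a3%:C%C -> P4 = a4%:C%C ->
    4%:R * (2%:R^-1 * 2%:R^-1 * (P1 - 'i%C * 'i%C * P2 + 'i%C * (P3 - P4))) =
    ((a1 + a2) +i* (a3 - a4))%C.
  have ii : 'i%C * 'i%C = -1 :> C by rewrite -expr2 sqr_i.
  move=> -> -> -> ->; rewrite ii.
  have -> : 4%:R = 2%:R * 2%:R :> C by rewrite -natrM.
  rewrite -!mulrA !mulVKf ?pnatr_eq0 //.
  by apply/eqP; rewrite eq_complex /=; apply/andP; split; apply/eqP; ring.
apply: (etrans (f_equal _ E')); exact: Q (pdf_pdf_hess _ _) (pdf_pdf_hess _ _)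
  (pdf_pdf_hess _ _) (pdf_pdf_hess _ _).
Qed.

Lemma sL_max (h : 'I_2 -> 'I_2 -> A) (H : 'M[C]_2) :
  hermitian_posdef H -> (forall i j, h i j p = H i j) -> sL WW h x p <= 0.
Proof.
move=> Hpos hH.
have X (a : 'I_2 -> C) :
    \sum_i \sum_j a i * (a j)^*%C * (wd WW i (wb WW j x) p) <= 0.
  have p4 : 0 < 4%:R :> C by rewrite ltr0n.
  rewrite -(pmulr_rle0 _ p4) mulr_sumr.
  have := levi_form a hess_sym hess_neg; congr (_ <= 0).
  apply: eq_bigr => i _; rewrite mulr_sumr; apply: eq_bigr => j _.
  by rewrite -wd_wb_hess mulrCA.
have := levi_trace_le0 Hpos X; congr (_ <= 0).
rewrite sLE -!hH; apply/esym.
have M k l i j : (h k l * wd WW i (wb WW j x)) p = h k l p * wd WW i (wb WW j x) p.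
  exact: cfM.
apply: (etrans (cfD _ _ Up)); apply: (f_equal2 +%R) => //.
apply: (etrans (cfD _ _ Up)); apply: (f_equal2 +%R).
  apply: (etrans (cfD _ _ Up)); apply: (f_equal2 +%R) => //.
  by apply: (etrans (cfN _ Up)); apply: (f_equal -%R).
by apply: (etrans (cfN _ Up)); apply: (f_equal -%R).
Qed.

End SurfaceMaximum.

(** * The strong maximum principle *)

Section TouchingPoint.
Variables (R : realType) (n : nat).
Local Notation V := (cspace R n).
Implicit Types (U : set V) (f v : V -> R) (p q y : V).

Lemma compact_closed_ball p (r : R) : compact [set q : V | `|p - q| <= r].
Proof.
apply: bounded_closed_compact; last exact: closed_closed_ball_.
exists (`|p| + r); split; first exact: num_real.
move=> M HM q /= Hq; apply: ltW; apply: le_lt_trans HM.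
rewrite -[q](subKr p); apply: (le_trans (ler_normB _ _)).
by rewrite lerD2l.
Qed.

(* Adding a small multiple of a barrier v that is nonnegative only where f < M
   keeps the maximum of f in the interior of the ball. *)
Lemma interior_touching U f v p (M r : R) : open U ->
  (forall q, U q -> {for q, continuous f}) ->
  (forall q, U q -> f q <= M) -> continuous v -> v p = 0 -> f p = M -> 0 < r ->
  (forall q, `|p - q| <= r -> U q) ->
  (forall q, `|p - q| <= r -> q != p -> 0 <= v q -> f q < M) ->
  exists2 e : R, 0 < e & exists2 q, `|p - q| < r &
    forall q', `|p - q'| < r -> f q' + e * v q' <= f q + e * v q.
Proof.
move=> oU cf fM cv vp fp r0 BU Hv.
have cw (A : set V) (g : V -> R) : (forall q, A q -> {for q, continuous g}) ->
    {within A, continuous g}.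
  by move=> c; apply: continuous_in_subspaceT => q; rewrite inE; exact: c.
(* The part of the boundary sphere where the barrier could push the sum above M; there f < M, with a
   uniform gap by compactness. *)
pose S := [set q : V | `|p - q| <= r] `&` ([set q | r <= `|p - q|] `&` [set q | 0 <= v q]).
have cnorm : continuous (fun q : V => `|p - q|).
  move=> q; apply: (@continuous_comp _ _ _ (fun q => p - q) (fun z => `|z|)).
    by apply: continuousB; [exact: cst_continuous|exact: cvg_id].
  exact: norm_continuous.
have cS : compact S.
  apply: (@subclosed_compact _ _ [set q : V | `|p - q| <= r] _ (@compact_closed_ball p r)); last by move=> q [].
  apply: closedI; first exact: closed_closed_ball_.
  apply: closedI.
    by apply: (@preimage_closed _ _ (fun q : V => `|p - q|) [set t | r <= t]); [move=> q _; exact: cnorm|exact: closed_ge].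
  by apply: (@preimage_closed _ _ v [set t | 0 <= t]); [move=> q _; exact: cv|exact: closed_ge].
have cfS : {within S, continuous f} by apply: cw => q [/BU /cf].
have cvS : {within S, continuous v} by apply: cw => q _; exact: cv.
have neS q : S q -> q != p.
  by move=> [_ [/= rq _]]; apply: contraTneq rq => ->; rewrite subrr normr0 -ltNge.
have [e e0 He] : exists2 e : R, 0 < e & forall q, S q -> f q + e * v q < M.
  have [S0|/set0P S0] := eqVneq S set0; first by exists 1 => // q; rewrite S0.
  have [q1 Sq1 H1] := EVT_max_rV S0 cS cfS.
  have [q2 Sq2 H2] := EVT_max_rV S0 cS cvS.
  rewrite !inE in Sq1 Sq2.
  have f1 : f q1 < M by have [b1 [b2 b3]] := Sq1; exact: Hv (neS _ Sq1) b3.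
  have v2 : 0 <= v q2 by have [_ []] := Sq2.
  have v21 : 0 < v q2 + 1 by rewrite ltr_wpDl.
  (* With f maximal on [S] at [q1] and v at [q2], this makes [e * v] at most half of the gap on [S];
     adding 1 avoids dividing by 0. *)
  exists ((M - f q1) / 2 / (v q2 + 1)); first by rewrite !divr_gt0 // subr_gt0.
  move=> q Sq; have := H1 q; have := H2 q; rewrite !inE => /(_ Sq) Hq2 /(_ Sq) Hq1.
  have : (M - f q1) / 2 / (v q2 + 1) * v q <= (M - f q1) / 2.
    rewrite mulrAC ler_pdivrMr // ler_wpM2l //.
      by rewrite divr_ge0 // subr_ge0 ltW.
    by rewrite (le_trans Hq2) // lerDl.
  by lra.
exists e => //.
have B0 : [set q : V | `|p - q| <= r] !=set0.
  by exists p; rewrite /= subrr normr0 ltW.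
have cF : {within [set q : V | `|p - q| <= r], continuous (fun q => f q + e * v q)}.
  apply: cw => q /BU Uq; apply: continuousD; first exact: cf.
  by apply: continuousM; [exact: cst_continuous|exact: cv].
have [q Bq Hq] := EVT_max_rV B0 (@compact_closed_ball p r) cF.
rewrite inE /= in Bq.
exists q; last by move=> q' /ltW q'r; apply: Hq; rewrite inE.
(* On the boundary the value is below M, which is the value at p: by the choice of [e] where v >= 0,
   and because f <= M where v < 0. *)
rewrite lt_neqAle Bq andbT; apply/eqP => E.
have := Hq p; rewrite inE /= subrr normr0 vp mulr0 addr0 fp => /(_ (ltW r0)).
have [v0|v0] := leP 0 (v q).
  by rewrite leNgt He //; split => //; split => //=; rewrite E.
rewrite leNgt => /negP; apply.
have : e * v q < 0 by rewrite pmulr_rlt0.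
by have := fM q (BU _ Bq); lra.
Qed.

(** The norm of [cspace] is the sup norm, which is not smooth; barriers and touching balls use the
    squared Euclidean distance. *)
Definition sqd q y : R := \sum_m (q ord0 m - y ord0 m) * (q ord0 m - y ord0 m).

Lemma sqd_ge0 q y : 0 <= sqd q y.
Proof. by apply: sumr_ge0 => m _; rewrite -expr2 sqr_ge0. Qed.

Lemma sqdxx q : sqd q q = 0.
Proof. by apply: big1 => m _; rewrite subrr mulr0. Qed.

Lemma sqd_coord q y m : (q ord0 m - y ord0 m) ^+ 2 <= sqd q y.
Proof.
rewrite /sqd (bigD1 m) //= expr2 lerDl; apply: sumr_ge0 => i _.
by rewrite -expr2 sqr_ge0.
Qed.

Lemma sqd_gt0 q y : q != y -> 0 < sqd q y.
Proof.
rewrite lt_neqAle sqd_ge0 andbT; apply: contraNneq => E.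
apply/eqP/rowP => m; apply/eqP; rewrite -subr_eq0 -sqrf_eq0 eq_le sqr_ge0 andbT.
by rewrite [leRHS]E sqd_coord.
Qed.

Lemma sqd_continuous y : continuous (sqd ^~ y).
Proof.
move=> q; apply: continuous_sum => m.
have c : {for q, continuous (fun q : V => q ord0 m - y ord0 m)}.
  by apply: continuousB; [exact: coord_continuous|exact: cst_continuous].
exact: continuousM.
Qed.

Lemma sqd_norm_le q y (r : R) : 0 <= r -> sqd q y <= r ^+ 2 -> `|q - y| <= r.
Proof.
move=> r0 H; apply: norm_le_coord => // m; rewrite !mxE.
rewrite -(@ler_pXn2r _ 2) ?nnegrE // real_normK ?num_real //.
exact: le_trans (sqd_coord _ _ _) H.
Qed.

Lemma sqd_le_norm q y (r : R) : `|q - y| <= r -> sqd q y <= r ^+ 2 *+ (n + n).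
Proof.
move=> H; rewrite /sqd; apply: (@le_trans _ _ (\sum_(m < n + n) r ^+ 2)).
  apply: ler_sum => m _; rewrite -expr2 -real_normK ?num_real //.
  rewrite ler_pXn2r ?nnegrE //; last by rewrite (le_trans _ H).
  by apply: le_trans H; have := coord_le_norm (q - y) m; rewrite !mxE.
by rewrite sumr_const card_ord.
Qed.

(* If f = M at p0 but not near p0, a closed ball on whose interior f < M
   touches the set f = M. *)
Lemma touching_ball U f (M : R) p0 : open U ->
  (forall q, U q -> {for q, continuous f}) ->
  (forall q, U q -> f q <= M) -> U p0 -> f p0 = M ->
  (forall p y, U p -> f p = M -> 0 < sqd p y ->
     (exists2 e : R, 0 < e & forall q, `|p - q| < e -> sqd q y < sqd p y -> f q < M) -> False) ->
  \forall q \near p0, f q = M.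
Proof.
move=> oU cf fM Up0 fp0 touch.
have [d d0 Hd] := open_ball oU Up0.
pose r := d / 2; have r0 : 0 < r by rewrite divr_gt0.
have BU q : `|p0 - q| <= r -> U q.
  move=> H; rewrite -[q](subrK p0) addrC; apply: Hd; rewrite distrC.
  by apply: le_lt_trans H _; rewrite /r; lra.
pose K : R := (n + n).+1%:R.
have K0 : 0 < K by rewrite ltr0n.
have K1 : 1 <= K by rewrite ler1n.
(* For y within [eta] of p0, a point at least as close to y as p0 in Euclidean distance is within
   [K * eta] of y, since the dimension is below K^2; hence it is within [eta + K * eta < r] of
   p0. *)
pose eta := r / (K + K + 1).
have KK : 0 < K + K + 1 by rewrite addr_gt0 // addr_gt0.
have eta0 : 0 < eta by rewrite divr_gt0.
apply/nbhs_ballP; exists eta => //= y; rewrite -ball_normE /= => yp.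
apply/eqP; apply: contraT => fy.
have Ke : eta + K * eta < r.
  have E : r = eta * (K + K + 1) by rewrite /eta divfK // gt_eqF.
  by rewrite E; have := mulr_gt0 K0 eta0; rewrite mulrDr mulr1 mulrDr; lra.
have sp0 : sqd p0 y <= (K * eta) ^+ 2.
  apply: (le_trans (sqd_le_norm (ltW yp))); rewrite [leRHS]exprMn -[leLHS]mulr_natl.
  apply: ler_wpM2r; first exact: sqr_ge0.
  rewrite expr2; apply: (@le_trans _ _ (1 * K)).
    by rewrite mul1r ler_nat.
  by apply: ler_wpM2r => //; exact: ltW.
have near_y q : sqd q y <= sqd p0 y -> `|p0 - q| < r.
  move=> H; have H1 : `|q - y| <= K * eta.
    by apply: sqd_norm_le; [rewrite mulr_ge0 // ltW|exact: le_trans H sp0].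
  rewrite -(subrK y p0) -addrA; apply: le_lt_trans (ler_normD _ _) _.
  by apply: le_lt_trans Ke; apply: lerD; [exact: ltW|rewrite distrC].
pose Z := [set q : V | `|p0 - q| <= r /\ f q = M].
have cZ : compact Z.
  apply: (@subclosed_compact _ _ [set q : V | `|p0 - q| <= r] _ (@compact_closed_ball p0 r)); last by move=> q [].
  move=> q clq; have Bq : `|p0 - q| <= r.
    apply: (@closed_closed_ball_ _ _ p0 r q); apply: closure_subset clq.
    by move=> q' [].
  split => //; apply/eqP; apply: contraT => fq.
  have fq' : f q < M by rewrite lt_neqAle fq fM //; exact: BU.
  have N : \forall q' \near q, f q' < M.
    have c : f @ q --> f q := cf _ (BU _ Bq).
    have e0 : 0 < M - f q by rewrite subr_gt0.
    move/cvgrPdist_lt : c => /(_ _ e0); apply: filterS => q'.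
    by rewrite ltr_norml => /andP[]; lra.
  have [q' [[_ fq1]]] := clq _ N.
  by rewrite fq1 ltxx.
have Z0 : Z !=set0 by exists p0; split => //; rewrite subrr normr0 ltW.
have cs : {within Z, continuous (sqd ^~ y)}.
  by apply: continuous_in_subspaceT => q _; exact: sqd_continuous.
(* Take a point [p] of the level set nearest to y: the open Euclidean ball about y through [p] stays
   in the good neighbourhood of p0 and misses the level set, contradicting [touch]. *)
have [p Zp Hp] := EVT_min_rV Z0 cZ cs.
rewrite inE in Zp; have [Bp fp] := Zp.
have spp : sqd p y <= sqd p0 y.
  by apply: Hp; rewrite inE; split => //; rewrite subrr normr0 ltW.
exfalso; apply: (touch p y (BU _ Bp) fp).
  by apply: sqd_gt0; apply: contraNneq fy => <-; rewrite fp.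
exists 1 => // q _ sq.
have Bq : `|p0 - q| <= r.
  by apply: ltW; apply: near_y; apply: le_trans spp; exact: ltW.
rewrite lt_neqAle fM ?andbT; last exact: BU.
apply/eqP => fq; have := Hp q; rewrite inE => /(_ (conj Bq fq)).
by rewrite leNgt sq.
Qed.

End TouchingPoint.

Section EllipticOperator.
Variables (A : comPzRingType) (W : wirtinger A 2) (h : 'I_2 -> 'I_2 -> A).
Variables (c1 c2 c3 c4 : A).
Local Notation d := (wd W).
Local Notation J := (wj W).
Local Notation b := (wb W).
Local Notation N x := (sN h (fun i => d i x) (fun i => b i x)).

Definition sL1 (x : A) : A :=
  locked (sL W h x + d i1 x * c1 + d i2 x * c2 + b i1 x * c3 + b i2 x * c4).

Lemma sL1E x :
  sL1 x = sL W h x + d i1 x * c1 + d i2 x * c2 + b i1 x * c3 + b i2 x * c4.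
Proof. by rewrite /sL1 -lock. Qed.

Lemma sL1D x y : sL1 (x + y) = sL1 x + sL1 y.
Proof. by rewrite !sL1E !sLE !(wbD, wdD); ring. Qed.

Lemma sL1N x : sL1 (- x) = - sL1 x.
Proof. by rewrite !sL1E !sLE !(wbN, wdN); ring. Qed.

Lemma sL1_cst k : (forall i, d i k = 0) -> (forall i, b i k = 0) -> sL1 k = 0.
Proof. by move=> dk bk; rewrite sL1E sLE !bk !dk !wd0; ring. Qed.

Lemma sL1Z k x : (forall i, d i k = 0) -> (forall i, b i k = 0) ->
  sL1 (k * x) = k * sL1 x.
Proof.
move=> dk bk; rewrite !sL1E !sLE !(wbM, wdM) !bk !dk !mul0r !add0r !wdM !dk; ring.
Qed.

Lemma sL1_sqr x : sL1 (x * x) = (x + x) * sL1 x + (N x + N x).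
Proof. rewrite !sL1E !sLE !sNE !(wbM, wdD, wdM); ring. Qed.

(** For s = |q - y|^2, t = |q - p|^2 and k the value of s at p, this is a polynomial Hopf barrier.
    At p the last term vanishes, and the gradient term of s, multiplied by 2 a, dominates for large
    [a]. *)
Lemma barrier_sL1 k a s t :
  (forall i, d i k = 0) -> (forall i, b i k = 0) ->
  (forall i, d i a = 0) -> (forall i, b i a = 0) ->
  sL1 (k - s + a * ((k - s) * (k - s)) - t) =
  - (sL1 s + sL1 t) + a * (N s + N s) - a * (k - s) * (sL1 s + sL1 s).
Proof.
move=> dk bk da ba; rewrite !sL1D !sL1N sL1Z // sL1_sqr !sL1D !sL1N (sL1_cst dk bk).
have -> : N (k - s) = N s by rewrite !sNE !(wdD, wbD, wdN, wbN) !dk !bk; ring.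
ring.
Qed.

Lemma sq_deriv (w : 'I_2 -> A) j :
  (forall i k, d i (w k) = (i == k)%:R) -> (forall i k, b i (w k) = 0) ->
  d j (\sum_k w k * J (w k)) = J (w j) /\ b j (\sum_k w k * J (w k)) = w j.
Proof.
move=> dw bw; have J0 : J 0 = 0 := wj0 W.
rewrite sum2 wdD wbD !wdM !wbM !wdJ !wbJ !bw !dw !J0.
move: j; apply: ord2P; rewrite !eqxx /= ?wj1 ?wj0; split; ring.
Qed.

End EllipticOperator.

Section StrongMaximum.
Variables (R : realType) (W : opens R 2).
Local Notation V := (cspace R 2).
Local Notation e_ := (@basis_vec R 2).
Local Notation C := R[i].
Local Notation U := (opset W).
Local Notation oU := (opset_open W).
Local Notation A := (cinfty W).
Local Notation WW := (cinf_wirtinger W).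
Implicit Types (x : A) (p q y : V).

Lemma wd_cst k c : wd WW k (cstf W c) = 0.
Proof. by rewrite cinf_wd /wdz !pdf_cst; ring. Qed.

Lemma wb_cst k c : wb WW k (cstf W c) = 0.
Proof. by rewrite wb_cinf /wdzb !pdf_cst; ring. Qed.

Lemma zel_subproof (k : 'I_2) : {z : A | forall p, U p -> z p = zcoord k p}.
Proof.
have s : csmooth U (zcoord k) by split => l; exact: Ck_coord.
by exists (mkf s) => p; exact: mkfE.
Qed.

Definition zel k : A := sval (zel_subproof k).

Lemma zelE k p : U p -> zel k p = zcoord k p.
Proof. exact: svalP (zel_subproof k) p. Qed.

Lemma cderive_zcoord (k : 'I_2) m p : cderive (e_ m) (zcoord k) p =
  ((m == lshift 2 k)%:R +i* (m == rshift 2 k)%:R)%C.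
Proof.
have D (l : 'I_(2 + 2)) : 'D_(e_ m) (fun q : V => q ord0 l) p = (m == l)%:R.
  by have [_ ->] := is_derive_coord l p (e_ m); rewrite mxE eqxx /= eq_sym.
exact: (f_equal2 (@Complex R) (D _) (D _)).
Qed.

Lemma dz_zcoord (i k : 'I_2) p : dz i (zcoord k) p = (i == k)%:R.
Proof.
rewrite /dz !cderive_zcoord eq_lshift eq_rshift eq_lrshift eq_rlshift.
case: (i == k) => /=; last by apply/eqP; rewrite eq_complex /=; apply/andP; split; apply/eqP; ring.
apply: (canLR (mulfK _)); first by rewrite pnatr_eq0.
by apply/eqP; rewrite eq_complex /=; apply/andP; split; apply/eqP; ring.
Qed.

Lemma dzb_zcoord (i k : 'I_2) p : dzb i (zcoord k) p = 0.
Proof.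
rewrite /dzb !cderive_zcoord eq_lshift eq_rshift eq_lrshift eq_rlshift.
apply: (canLR (mulfK _)); first by rewrite pnatr_eq0.
by case: (i == k); apply/eqP; rewrite eq_complex /=; apply/andP; split; apply/eqP; ring.
Qed.

Definition wel (y : V) k : A := zel k - cstf W (zcoord k y).

Lemma wd_wel y i k : wd WW i (wel y k) = (i == k)%:R.
Proof.
rewrite /wel wdD wdN wd_cst oppr0 addr0; apply: cinf_ext => p Up.
apply: (etrans (wd_cinfE _ _ Up)).
apply: (etrans (dz_near _ (near_open oU Up (fun q => @zelE k q)))).
rewrite dz_zcoord; case: (i == k); first exact: (esym (cf1 Up)).
exact: (esym (cf0 Up)).
Qed.

Lemma wb_wel y i k : wb WW i (wel y k) = 0.
Proof.
rewrite /wel wbD wbN wb_cst oppr0 addr0; apply: cinf_ext => p Up.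
apply: (etrans (wb_cinfE _ _ Up)); apply: etrans (esym (cf0 Up)).
apply: (etrans (dzb_near _ (near_open oU Up (fun q => @zelE k q)))).
exact: dzb_zcoord.
Qed.

Definition sqA (y : V) : A := \sum_k wel y k * wj WW (wel y k).

Lemma welE y k p : U p -> wel y k p = zcoord k p - zcoord k y.
Proof.
move=> Up; apply: (etrans (cfD _ _ Up)); apply: (f_equal2 +%R); first exact: zelE.
by apply: (etrans (cfN _ Up)); apply: (f_equal -%R); exact: cstfE.
Qed.

Lemma sqAE y p : U p -> sqA y p = (sqd p y)%:C%C.
Proof.
move=> Up; rewrite /sqA sum2; apply: (etrans (cfD _ _ Up)).
have T k : (wel y k * wj WW (wel y k)) p =
   (zcoord k p - zcoord k y) * ((zcoord k p - zcoord k y)^*)%C.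
  apply: (etrans (cfM _ _ Up)); apply: (f_equal2 *%R); first exact: welE.
  by apply: (etrans (wj_cinfE _ Up)); congr conjc; exact: welE.
rewrite !T /sqd sum4.
by apply/eqP; rewrite eq_complex /=; apply/andP; split; apply/eqP; ring.
Qed.

Lemma sqAJ y : wj WW (sqA y) = sqA y.
Proof. by rewrite /sqA !sum2 wjD !wjM !wjK; congr (_ + _); rewrite mulrC. Qed.

Lemma Re_continuous x p : U p -> {for p, continuous (fun q => complex.Re (x q))}.
Proof. by move=> Up; exact: (Ck_cont ((cfun_smooth x).1 0%N) Up). Qed.

Variables (h : 'I_2 -> 'I_2 -> A) (H : V -> 'M[C]_2).
Hypothesis Hpos : forall p, U p -> hermitian_posdef (H p).
Hypothesis hH : forall p, U p -> forall i j, h i j p = H p i j.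
Variables c1 c2 c3 c4 : A.
Local Notation L1 := (sL1 WW h c1 c2 c3 c4).

Lemma sNv (a c : 'I_2 -> A) p : U p -> sN h a c p =
  H p i2 i2 * a i1 p * c i1 p - H p i2 i1 * a i1 p * c i2 p
  - H p i1 i2 * a i2 p * c i1 p + H p i1 i1 * a i2 p * c i2 p.
Proof.
move=> Up; rewrite sNE -!(hH Up).
have M (x y z : A) : (x * y * z) p = x p * y p * z p.
  by apply: (etrans (cfM _ _ Up)); apply: (f_equal2 *%R) => //; exact: cfM.
apply: (etrans (cfD _ _ Up)); apply: (f_equal2 +%R) => //.
apply: (etrans (cfD _ _ Up)); apply: (f_equal2 +%R).
  apply: (etrans (cfD _ _ Up)); apply: (f_equal2 +%R) => //.
  by apply: (etrans (cfN _ Up)); apply: (f_equal -%R).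
by apply: (etrans (cfN _ Up)); apply: (f_equal -%R).
Qed.

Lemma grad_sq_gt0 y p : U p -> p != y ->
  0 < sN h (fun i => wd WW i (sqA y)) (fun i => wb WW i (sqA y)) p.
Proof.
move=> Up py; rewrite (sNv _ _ Up).
have D i := sq_deriv i (wd_wel y) (wb_wel y).
rewrite !(proj1 (D _)) !(proj2 (D _)) !(wj_cinfE _ Up).
have := posdef_adj_gt0 (Hpos Up) (x := (wel y i1 p)^*%C) (y := (wel y i2 p)^*%C).
rewrite !conjcK; apply.
apply: contraT; rewrite negb_or !negbK !conjc_eq0 !(welE _ _ Up) !subr_eq0.
move=> /andP[/eqP E1 /eqP E2]; case/eqP: py; apply/rowP => m.
have E k : zcoord k p = zcoord k y by move: k; apply: ord2P.
by case: (split_ordP m) => k ->; have [] := E k.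
Qed.

Lemma barrier_value (LL NN G Z : A) (a : R) p : U p -> G p = 0 ->
  (- LL + cstf W a%:C%C * (NN + NN) - cstf W a%:C%C * G * Z) p =
  - (LL p) + a%:C%C * (NN p + NN p).
Proof.
move=> Up G0; apply: (etrans (cfD _ _ Up)); rewrite -[RHS]addr0; apply: (f_equal2 +%R).
  apply: (etrans (cfD _ _ Up)); apply: (f_equal2 +%R); first exact: cfN.
  apply: (etrans (cfM _ _ Up)); apply: (f_equal2 *%R); first exact: cstfE.
  exact: cfD.
apply: (etrans (cfN _ Up)); apply: etrans (oppr0 _); apply: (f_equal -%R).
apply: (etrans (cfM _ _ Up)); apply: etrans (mul0r (Z p)); apply: (f_equal2 *%R) => //.
by apply: (etrans (cfM _ _ Up)); rewrite G0 mulr0.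
Qed.

Lemma Re_scale (a : R) (z : C) : complex.Re (a%:C%C * z) = a * complex.Re z.
Proof. by case: z => z1 z2; rewrite /= mul0r subr0. Qed.

Lemma ReN (z : C) : complex.Re (- z) = - complex.Re z.
Proof. by case: z. Qed.

(** Were a ball to touch the level set at p, then [F = x + e v] would have an interior maximum for
    some e > 0. There its gradient vanishes, so [L1 F = sL F <= 0], while [L1 F = e * L1 v > 0] by
    the choice of the barrier v. *)
Lemma strong_maximum x (M : R) p0 : wj WW x = x -> L1 x = 0 ->
  (forall q, U q -> complex.Re (x q) <= M) -> U p0 -> complex.Re (x p0) = M ->
  \forall q \near p0, complex.Re (x q) = M.
Proof.
move=> xJ Lx xM Up0 xp0.
apply: (@touching_ball _ _ U (fun q => complex.Re (x q)) M p0 oU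
  (fun q Uq => @Re_continuous x q Uq) xM Up0 xp0).
move=> p y Up xp s0 [e0 e00 He0].
have py : p != y by apply: contraTneq s0 => ->; rewrite sqdxx ltxx.
pose K := sqd p y.
pose N0 := complex.Re (sN h (fun i => wd WW i (sqA y)) (fun i => wb WW i (sqA y)) p).
have N0p : 0 < N0 by have := grad_sq_gt0 Up py; rewrite ltcE => /andP[].
pose k0 := complex.Re ((L1 (sqA y) + L1 (sqA p)) p).
(* The factor K - |q - y|^2 vanishes at p, so L1 of the barrier there is a (N0 + N0) - k0;
   positivity of [N0] uses [p != y]. *)
have [a a0 Ha] : exists2 a : R, 0 < a & k0 < a * (N0 + N0).
  exists ((`|k0| + 1) / N0); first by rewrite divr_gt0 // ltr_wpDl.
  rewrite mulrDr divfK ?gt_eqF //.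
  by have := ler_norm k0; have := normr_ge0 k0; lra.
pose vA : A := cstf W K%:C%C - sqA y
  + cstf W a%:C%C * ((cstf W K%:C%C - sqA y) * (cstf W K%:C%C - sqA y)) - sqA p.
pose v q := K - sqd q y + a * ((K - sqd q y) * (K - sqd q y)) - sqd q p.
have vAE q : U q -> vA q = (v q)%:C%C.
  move=> Uq.
  have G : (cstf W K%:C%C - sqA y : A) q = (K - sqd q y)%:C%C.
    apply: (etrans (cfD _ _ Uq)); rewrite rmorphB; apply: (f_equal2 +%R); first exact: cstfE.
    by apply: (etrans (cfN _ Uq)); apply: (f_equal -%R); exact: sqAE.
  rewrite /v rmorphB rmorphD !rmorphM.
  apply: (etrans (cfD _ _ Uq)); apply: (f_equal2 +%R).
    apply: (etrans (cfD _ _ Uq)); apply: (f_equal2 +%R) => //.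
    apply: (etrans (cfM _ _ Uq)); apply: (f_equal2 *%R); first exact: cstfE.
    by apply: (etrans (cfM _ _ Uq)); apply: (f_equal2 *%R).
  by apply: (etrans (cfN _ Uq)); apply: (f_equal -%R); exact: sqAE.
have Lv : 0 < complex.Re (L1 vA p).
  have G0 : (cstf W K%:C%C - sqA y : A) p = 0.
    apply: (etrans (cfD _ _ Up)); rewrite (cstfE _ Up) (cfN _ Up) (sqAE _ Up).
    by rewrite subrr.
  have LvE := etrans (congr1 (fun z : A => cfun z p)
    (@barrier_sL1 _ WW h c1 c2 c3 c4 (cstf W K%:C%C) (cstf W a%:C%C) (sqA y) (sqA p)
      (fun i => wd_cst i _) (fun i => wb_cst i _) (fun i => wd_cst i _) (fun i => wb_cst i _)))
    (barrier_value _ _ _ _ Up G0).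
  rewrite LvE ReD ReN; apply: (lt_le_trans (y := a * (N0 + N0) - k0)).
    by rewrite subr_gt0.
  by rewrite addrC Re_scale ReD.
have nearU : \forall q \near p, U q by exact: (open_nbhs_nbhs (conj oU Up)).
have nearL : \forall q \near p, 0 < complex.Re (L1 vA q).
  have c : (fun q => complex.Re (L1 vA q)) @ p --> complex.Re (L1 vA p) := @Re_continuous _ _ Up.
  move/cvgrPdist_lt : c => /(_ _ Lv); apply: filterS => q.
  by rewrite ltr_norml => /andP[]; lra.
(* This bound makes 1 + a g nonnegative for g = K - |q - y|^2, fixing the sign of g + a g^2 outside
   the ball about y. *)
have nears : \forall q \near p, `|K - sqd q y| < a^-1.
  have c : (fun q : V => sqd q y) @ p --> sqd p y by exact: sqd_continuous.
  have a1 : 0 < a^-1 by rewrite invr_gt0.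
  by move/cvgrPdist_lt : c => /(_ _ a1).
have /nbhs_ballP[d /= d0 Hd] := @filterI _ _ (nbhs_filter p) _ _ nearU
  (@filterI _ _ (nbhs_filter p) _ _ nearL nears).
pose r := Num.min (d / 2) (e0 / 2).
have r0 : 0 < r by rewrite lt_min !divr_gt0.
have rd q : `|p - q| <= r -> `|p - q| < d /\ `|p - q| < e0.
  by rewrite le_min => /andP[]; lra.
have Br q : `|p - q| <= r ->
    [/\ U q, 0 < complex.Re (L1 vA q) & `|K - sqd q y| < a^-1].
  by move=> /rd[qd _]; have [] := Hd q; rewrite -?ball_normE // => ? [].
have cv : continuous v.
  move=> q; have cs z : {for q, continuous (fun q : V => sqd q z)} := @sqd_continuous _ _ z q.
  have cg : {for q, continuous (fun q => K - sqd q y)}.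
    by apply: continuousB => //; exact: cst_continuous.
  have cag : {for q, continuous (fun q : V => a * ((K - sqd q y) * (K - sqd q y)))}.
    by apply: continuousM; [exact: cst_continuous|exact: continuousM].
  exact: (continuousB (continuousD cg cag) (cs p)).
have vp : v p = 0 by rewrite /v sqdxx -/K subrr !mulr0 subr0 addr0.
have BU q : `|p - q| <= r -> U q by move=> /Br[].
(* Outside the ball about y one has g <= 0, so v = g (1 + a g) - |q - p|^2 is negative for q != p.
   Thus v >= 0 forces q inside, where the touching hypothesis gives the strict inequality. *)
have Hv q : `|p - q| <= r -> q != p -> 0 <= v q -> complex.Re (x q) < M.
  move=> qr qp vq; have [_ _ sq] := Br _ qr; have [_ qe] := rd _ qr.
  apply: He0 => //; rewrite ltNge; apply/negP => Ks.
  have t0 := sqd_gt0 qp.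
  have g0 : K - sqd q y <= 0 by rewrite subr_le0.
  have ag : 0 <= 1 + a * (K - sqd q y).
    have : a * `|K - sqd q y| < 1 by rewrite -ltr_pdivlMl // mulr1.
    by rewrite ler0_norm // mulrN; lra.
  have : (K - sqd q y) * (1 + a * (K - sqd q y)) <= 0 by rewrite mulr_le0_ge0.
  rewrite [X in X <= 0](_ : _ = K - sqd q y + a * ((K - sqd q y) * (K - sqd q y)));
    last by ring.
  by move: vq t0; rewrite /v; lra.
have [e ep [q qr qmax]] := @interior_touching _ _ U (fun q => complex.Re (x q)) v p M r oU
  (fun q Uq => @Re_continuous x q Uq) xM cv vp xp r0 BU Hv.
have [Uq Lq _] := Br _ (ltW qr).
pose F : A := x + cstf W e%:C%C * vA.
have FE q' : U q' -> complex.Re (F q') = complex.Re (x q') + e * v q'.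
  move=> Uq'; have -> : F q' = x q' + e%:C%C * (v q')%:C%C.
    apply: (etrans (cfD _ _ Uq')); apply: (f_equal2 +%R) => //.
    apply: (etrans (cfM _ _ Uq')); apply: (f_equal2 *%R); first exact: cstfE.
    exact: vAE.
  by rewrite ReD /= mul0r subr0.
have JF : wj WW F = F.
  have Jc (c : R) : wj WW (cstf W c%:C%C) = cstf W c%:C%C.
    by rewrite cinf_wj conjf_cst conjc_real.
  by rewrite /F wjD wjM xJ Jc /vA !(wjD, wjN, wjM) !Jc !sqAJ // ; rewrite (wjN, wjD).
pose O := [set q' : V | `|p - q'| < r].
have oO : open O.
  by rewrite (_ : O = ball p r); [exact: ball_open|rewrite -ball_normE].
have sO : O `<=` U by move=> q' /ltW /BU.
have Fmax q' : O q' -> complex.Re (F q') <= complex.Re (F q).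
  by move=> Oq'; rewrite !FE //; [exact: qmax|exact: sO].
(* First order terms disappear at a critical point; those in b_k follow from those in d_k because F
   is real. *)
have LF : L1 F q = sL WW h F q.
  have dF k : wd WW k F q = 0 by exact: (wd_max JF oO qr sO Fmax).
  have bF k : wb WW k F q = 0.
    by rewrite wbE JF (wj_cinfE _ Uq) dF conjc0.
  have Z (z c : A) : z q = 0 -> (z * c) q = 0.
    by move=> z0; apply: (etrans (cfM _ _ Uq)); rewrite z0 mul0r.
  have P (z z' : A) : z' q = 0 -> (z + z') q = z q.
    by move=> z0; apply: (etrans (cfD _ _ Uq)); rewrite z0 addr0.
  rewrite sL1E; do 4 (apply: (etrans (P _ _ _)); first exact: Z).
  by [].
have := sL_max JF oO qr sO Fmax (Hpos Uq) (hH Uq).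
rewrite -LF /F sL1D Lx add0r sL1Z; try by move=> i; rewrite ?wd_cst ?wb_cst.
rewrite lecE => /andP[_]; rewrite (_ : (_ * L1 vA : A) q = e%:C%C * L1 vA q).
  by rewrite Re_scale /= leNgt mulr_gt0.
by apply: (etrans (cfM _ _ Uq)); apply: (f_equal2 *%R) => //; exact: cstfE.
Qed.

End StrongMaximum.

(** * A Gauduchon metric in a chart *)

Ltac evalp Up := rewrite ?(cfD _ _ Up, cfM _ _ Up, cfN _ Up).

Section LocalMetric.
Variables (R : realType) (W : opens R 2) (m : cspace R 2 -> 'M[R[i]]_2).
Local Notation V := (cspace R 2).
Local Notation C := R[i].
Local Notation U := (opset W).
Local Notation oU := (opset_open W).
Local Notation A := (cinfty W).
Local Notation WW := (cinf_wirtinger W).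
Hypothesis ms : forall i j, csmooth U (coef m i j).
Hypothesis mp : forall p, U p -> hermitian_posdef (m p).

Lemma hA_subproof i j : {x : A | forall p, U p -> x p = m p i j}.
Proof. by exists (mkf (ms i j)) => p Up; apply: (etrans (mkfE _ Up)). Qed.

Definition hA i j : A := sval (hA_subproof i j).

Lemma hAE i j p : U p -> hA i j p = m p i j.
Proof. exact: svalP (hA_subproof i j) p. Qed.

Lemma hA_J i j : wj WW (hA i j) = hA j i.
Proof.
apply: cinf_ext => p Up; apply: (etrans (wj_cinfE _ Up)).
rewrite (hAE _ _ Up) (hAE _ _ Up); have [E _] := mp Up; exact: (esym (E _ _)).
Qed.

Lemma sD_hA p : U p -> sD hA p = m p i1 i1 * m p i2 i2 - m p i1 i2 * m p i2 i1.
Proof. by move=> Up; rewrite sDE; evalp Up; rewrite !hAE. Qed.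

Lemma sD_gt0 p : U p -> 0 < sD hA p.
Proof. by move=> Up; rewrite sD_hA //; exact: posdef_det (mp Up). Qed.

Lemma DiA_subproof : {x : A | sD hA * x = 1}.
Proof.
have D0 p : U p -> sD hA p != 0 by move=> Up; rewrite gt_eqF // sD_gt0.
by exists (invf D0); exact: invfP.
Qed.

Definition DiA : A := sval DiA_subproof.

Lemma DDiA : sD hA * DiA = 1.
Proof. exact: svalP DiA_subproof. Qed.

Lemma shu_inverse i j : \sum_k hA i k * shu hA DiA j k = (i == j)%:R.
Proof.
rewrite sum2 !shuE /=; move: i j; do 2 (apply: ord2P); rewrite /=;
  ring: (hhDi DDiA).
Qed.

Lemma hupE p i j : U p -> hup m p i j = shu hA DiA i j p.
Proof.
move=> Up; pose N : 'M[C]_2 := \matrix_(a, b) shu hA DiA b a p.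
have mN : m p *m N = 1%:M.
  apply/matrixP => a c; rewrite !mxE sum2 !mxE -!(hAE _ _ Up).
  have := congr1 (fun x : A => cfun x p) (shu_inverse a c).
  rewrite sum2; evalp Up => ->.
  by case: (a == c); [exact: cf1|exact: cf0].
have [mu _] := mulmx1_unit mN.
by rewrite /hup -[invmx _]mulmx1 -mN mulKmx // mxE.
Qed.

Lemma wd_hA k i j p : U p -> wd WW k (hA i j) p = dz k (coef m i j) p.
Proof.
move=> Up; apply: (etrans (wd_cinfE _ _ Up)); apply: dz_near.
by apply: (near_open oU Up) => q Uq; exact: hAE.
Qed.

Lemma wb_hA k i j p : U p -> wb WW k (hA i j) p = dzb k (coef m i j) p.
Proof.
move=> Up; apply: (etrans (wb_cinfE _ _ Up)); apply: dzb_near.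
by apply: (near_open oU Up) => q Uq; exact: hAE.
Qed.

Lemma wd_wb_hA k l i j p : U p ->
  wd WW k (wb WW l (hA i j)) p = dz k (dzb l (coef m i j)) p.
Proof.
move=> Up; apply: (etrans (wd_cinfE _ _ Up)); apply: dz_near.
by apply: (near_open oU Up) => q Uq; exact: wb_hA.
Qed.

Lemma chern_curvatureE p i j k l : U p ->
  chern_curvature m p i j k l = sTheta WW hA DiA i j k l p.
Proof.
move=> Up; rewrite sThetaE; apply: etrans (esym (cfD _ _ Up)); apply: (f_equal2 +%R).
  apply: etrans (esym (cfN _ Up)); apply: (f_equal -%R).
  exact: (esym (wd_wb_hA _ _ _ _ Up)).
apply: etrans (esym (cf_sum _ _ Up)); apply: eq_bigr => a _.
apply: etrans (esym (cf_sum _ _ Up)); apply: eq_bigr => b _.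
apply: etrans (esym (cfM _ _ Up)); apply: (f_equal2 *%R); last exact: (esym (wd_hA _ _ _ Up)).
apply: etrans (esym (cfM _ _ Up)); apply: (f_equal2 *%R); first exact: hupE.
exact: (esym (wb_hA _ _ _ Up)).
Qed.

Lemma chern_ricci1E p i j : U p -> chern_ricci1 m p i j = sric1 WW hA DiA i j p.
Proof.
move=> Up; rewrite ric1_def.
apply: etrans (esym (cf_sum _ _ Up)); apply: eq_bigr => k _.
apply: etrans (esym (cf_sum _ _ Up)); apply: eq_bigr => l _.
apply: etrans (esym (cfM _ _ Up)); apply: (f_equal2 *%R); first exact: hupE.
exact: chern_curvatureE.
Qed.

Lemma chern_ricci3E p i j : U p -> chern_ricci3 m p i j = sric3 WW hA DiA i j p.
Proof.
move=> Up; rewrite ric3_def.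
apply: etrans (esym (cf_sum _ _ Up)); apply: eq_bigr => k _.
apply: etrans (esym (cf_sum _ _ Up)); apply: eq_bigr => l _.
apply: etrans (esym (cfM _ _ Up)); apply: (f_equal2 *%R); first exact: hupE.
exact: chern_curvatureE.
Qed.

Lemma chern_ricci4E p i j : U p -> chern_ricci4 m p i j = sric4 WW hA DiA i j p.
Proof.
move=> Up; rewrite ric4_def.
apply: etrans (esym (cf_sum _ _ Up)); apply: eq_bigr => k _.
apply: etrans (esym (cf_sum _ _ Up)); apply: eq_bigr => l _.
apply: etrans (esym (cfM _ _ Up)); apply: (f_equal2 *%R); first exact: hupE.
exact: chern_curvatureE.
Qed.

Lemma chern_scalar1E p : U p -> chern_scalar1 m p =
  (\sum_i \sum_j shu hA DiA i j * sric1 WW hA DiA i j) p.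
Proof.
move=> Up.
apply: etrans (esym (cf_sum _ _ Up)); apply: eq_bigr => i _.
apply: etrans (esym (cf_sum _ _ Up)); apply: eq_bigr => j _.
apply: etrans (esym (cfM _ _ Up)); apply: (f_equal2 *%R); first exact: hupE.
exact: chern_ricci1E.
Qed.

Lemma chern_scalar2E p : U p -> chern_scalar2 m p =
  (\sum_i \sum_j \sum_k \sum_l shu hA DiA i l * shu hA DiA k j
     * sTheta WW hA DiA i j k l) p.
Proof.
move=> Up.
apply: etrans (esym (cf_sum _ _ Up)); apply: eq_bigr => i _.
apply: etrans (esym (cf_sum _ _ Up)); apply: eq_bigr => j _.
apply: etrans (esym (cf_sum _ _ Up)); apply: eq_bigr => k _.
apply: etrans (esym (cf_sum _ _ Up)); apply: eq_bigr => l _.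
apply: etrans (esym (cfM _ _ Up)); apply: (f_equal2 *%R); last exact: chern_curvatureE.
by apply: etrans (esym (cfM _ _ Up)); apply: (f_equal2 *%R); exact: hupE.
Qed.

Definition norm_se p : R :=
  complex.Re ((se WW hA DiA * wj WW (se WW hA DiA) * DiA) p).

Hypothesis mg : forall p, U p -> forall i k j l, ddbar_coef m p i k j l = 0.

Lemma gaudA : wd WW i1 (wb WW i1 (hA i2 i2)) - wd WW i2 (wb WW i1 (hA i1 i2))
  - wd WW i1 (wb WW i2 (hA i2 i1)) + wd WW i2 (wb WW i2 (hA i1 i1)) = 0.
Proof.
apply: cinf_ext => p Up; evalp Up; rewrite !(wd_wb_hA _ _ _ _ Up).
by apply: etrans (esym (cf0 Up)); exact: (mg Up i1 i2 i1 i2).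
Qed.

Variable f : V -> R.
Hypothesis fs : smooth U f.
Hypothesis fe : forall p, U p -> forall i j,
  chern_ricci3 m p i j + chern_ricci4 m p i j = (f p)%:C%C * m p i j.

Lemma fA_subproof : {x : A | forall p, U p -> x p = (f p)%:C%C}.
Proof.
have s : csmooth U (fun p => (f p)%:C%C) by split; [exact: fs|move=> k; exact: Ck_cst].
by exists (mkf s) => p; exact: mkfE.
Qed.

Definition fA : A := sval fA_subproof.

Lemma fAE p : U p -> fA p = (f p)%:C%C.
Proof. exact: svalP fA_subproof p. Qed.

Lemma fA_J : wj WW fA = fA.
Proof.
by apply: cinf_ext => p Up; apply: (etrans (wj_cinfE _ Up)); rewrite fAE // conjc_real.
Qed.

Lemma einA i j : sric3 WW hA DiA i j + sric4 WW hA DiA i j = fA * hA i j.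
Proof.
apply: cinf_ext => p Up; evalp Up.
by rewrite -(chern_ricci3E _ _ Up) -(chern_ricci4E _ _ Up) (fe Up) (fAE Up) (hAE _ _ Up).
Qed.

Lemma local_strong_maximum (M : R) p0 : (forall p, U p -> f p <= M) -> U p0 ->
  f p0 = M -> \forall q \near p0, f q = M.
Proof.
move=> fM Up0 fp0.
have ReF q : U q -> complex.Re (fA q) = f q by move=> Uq; rewrite fAE.
have pde := conformal_pde hA_J DDiA gaudA einA.
have N : \forall q \near p0, complex.Re (fA q) = M.
  apply: (strong_maximum mp (fun p Up i j => hAE i j Up) fA_J _ _ Up0); last 2 first.
  - by move=> q Uq; rewrite ReF //; exact: fM.
  - by rewrite ReF.
  by rewrite sL1E; exact: pde.
have nU : \forall q \near p0, U q by exact: (open_nbhs_nbhs (conj oU Up0)).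
by apply: filterS2 N nU => q E Uq; rewrite -ReF.
Qed.

(** The traces of Theta^(3) and Theta^(4) are both S_C^(2), and the trace of h is 2. *)
Lemma scalar2_eq_f p : U p -> chern_scalar2 m p = (f p)%:C%C.
Proof.
move=> Up; rewrite (chern_scalar2E Up).
set S := \sum_i _.
have E : S + S = fA + fA.
  apply: (etrans (f_equal2 +%R (esym (trace_ric3 WW hA DiA)) (esym (trace_ric4 WW hA DiA)))).
  apply: etrans (trace_h DDiA fA).
  rewrite -big_split /=; apply: eq_bigr => i _; rewrite -big_split /=.
  by apply: eq_bigr => j _; rewrite -einA mulrDr.
have := congr1 (fun x : A => cfun x p) E; evalp Up; rewrite -!mulr2n => /eqP.
by rewrite eqrMn2r //= => /eqP ->; exact: fAE.
Qed.

Lemma se_norm p : U p -> norm_se p =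
    (complex.Re (se WW hA DiA p) ^+ 2 + complex.Im (se WW hA DiA p) ^+ 2) /
    complex.Re (sD hA p) /\
  (norm_se p)%:C%C = se WW hA DiA p * (se WW hA DiA p)^*%C / sD hA p.
Proof.
move=> Up; have D0 := sD_gt0 Up.
have DV : DiA p = (sD hA p)^-1.
  have := congr1 (fun x : A => cfun x p) DDiA; evalp Up; rewrite (cf1 Up) => E.
  by apply: (mulfI (lt0r_neq0 D0)); rewrite E divff ?gt_eqF.
have E : (se WW hA DiA * wj WW (se WW hA DiA) * DiA) p =
    se WW hA DiA p * (se WW hA DiA p)^*%C / sD hA p.
  by evalp Up; rewrite (wj_cinfE _ Up) DV.
rewrite /norm_se E; move: D0 {E DV}; case: (se WW hA DiA p) => a b.
case: (sD hA p) => x y; rewrite ltcE /= => /andP[/eqP -> x0].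
have x2 : x / (x ^+ 2 + 0 ^+ 2) = x^-1 by rewrite expr0n addr0 expr2 invfM mulVKf ?gt_eqF.
by split; [|apply/eqP; rewrite eq_complex /=; apply/andP; split; apply/eqP];
  rewrite ?x2; ring.
Qed.

End LocalMetric.

(** [L_phi] with [L_D] and [trace_dtau] substituted, in the shape that [max_identity] simplifies
    once evaluated at a point. *)
Lemma L_phi_expanded (A : comPzRingType) (W : wirtinger A 2)
    (h : 'I_2 -> 'I_2 -> A) (Di f v0 : A) :
  (forall i j, wj W (h i j) = h j i) -> sD h * Di = 1 ->
  (forall j, wb W j (se W h Di) = f * stau W h j) -> wj W f = f ->
  (forall j, wd W j f = 0) -> (forall j, wd W j v0 = 0) -> wj W v0 = v0 ->
  sL W h (se W h Di * wj W (se W h Di) - v0 * sD h) =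
    f * wj W (se W h Di) * (- (sD h * se W h Di) + sN h (sG W h Di) (stau W h))
    + f * f * sN h (fun i => wj W (stau W h i)) (stau W h)
    + sN h (fun i => wd W i (se W h Di)) (fun i => wj W (wd W i (se W h Di)))
    + f * se W h Di * (- (sD h * wj W (se W h Di))
        + sN h (fun i => wj W (stau W h i)) (fun i => wj W (sG W h Di i)))
    - v0 * (sD h * (sN h (sG W h Di) (fun j => wj W (sG W h Di j)) -
        (h i2 i2 * sric1 W h Di i1 i1 - h i2 i1 * sric1 W h Di i1 i2 -
         h i1 i2 * sric1 W h Di i2 i1 + h i1 i1 * sric1 W h Di i2 i2))).
Proof.
move=> hJ DDi be Jf df dv Jv.
rewrite (L_phi hJ be Jf df dv Jv) (L_D hJ DDi) (trace_dtau W DDi).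
have -> : wj W (- (sD h * se W h Di) + sN h (sG W h Di) (stau W h)) =
  - (sD h * wj W (se W h Di)) +
  sN h (fun i => wj W (stau W h i)) (fun i => wj W (sG W h Di i)).
  by rewrite wjD wjN wjM (JD hJ) !sNE !(wjD, wjN, wjM) !hJ; ring.
by [].
Qed.

(** * Vanishing of e for a negative constant factor *)

Section ConstantFactor.
Variables (R : realType) (W : opens R 2) (m : cspace R 2 -> 'M[R[i]]_2).
Local Notation C := R[i].
Local Notation U := (opset W).
Local Notation oU := (opset_open W).
Local Notation A := (cinfty W).
Local Notation WW := (cinf_wirtinger W).
Hypothesis ms : forall i j, csmooth U (coef m i j).
Hypothesis mp : forall p, U p -> hermitian_posdef (m p).
Hypothesis mg : forall p, U p -> forall i k j l, ddbar_coef m p i k j l = 0.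
Variable c : R.
Hypothesis fe : forall p, U p -> forall i j,
  chern_ricci3 m p i j + chern_ricci4 m p i j = c%:C%C * m p i j.
Local Notation h := (hA ms).
Local Notation Di := (DiA ms mp).
Local Notation e := (se WW h Di).
Local Notation cc := (cstf W c%:C%C).
Local Notation tau := (stau WW h).
Local Notation eta := (seta WW h Di).
Local Notation G := (sG WW h Di).
Let hJ := hA_J ms mp.
Let DD := DDiA ms mp.

Lemma cstf_J (a : R) : wj WW (cstf W a%:C%C) = cstf W a%:C%C.
Proof. by rewrite cinf_wj conjf_cst conjc_real. Qed.

Lemma einC i j : sric3 WW h Di i j + sric4 WW h Di i j = cc * h i j.
Proof.
apply: cinf_ext => p Up; evalp Up.
by rewrite -(chern_ricci3E ms mp _ _ Up) -(chern_ricci4E ms mp _ _ Up) (fe Up) (cstfE _ Up) (hAE _ _ _ Up).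
Qed.

Lemma dbar_eC j : wb WW j e = cc * tau j.
Proof. by apply: (dbar_se hJ DD einC); exact: wd_cst. Qed.

Lemma trace_ric1_val p : U p ->
  (h i2 i2 * sric1 WW h Di i1 i1 - h i2 i1 * sric1 WW h Di i1 i2 -
   h i1 i2 * sric1 WW h Di i2 i1 + h i1 i1 * sric1 WW h Di i2 i2) p =
  sD h p * c%:C%C + sN h eta (fun j => wj WW (eta j)) p.
Proof.
move=> Up; have := Df_ric1 hJ DD (gaudA ms mg) einC (cstf_J c).
set K := _ - _ - _ + _ => E.
have := congr1 (fun x : A => cfun x p) E; rewrite [in LHS](cfD _ _ Up) [in RHS](cfD _ _ Up).
rewrite -!mulr2n => /eqP; rewrite eqrMn2r //= => /eqP ->.
by rewrite (cfD _ _ Up) (cfM _ _ Up) (cstfE _ Up).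
Qed.

Lemma sN_ge0 (a : 'I_2 -> A) p : U p -> 0 <= sN h a (fun i => wj WW (a i)) p.
Proof.
move=> Up; rewrite (sNv (fun p Up i j => hAE ms i j Up) _ _ Up) !(wj_cinfE _ Up).
exact: posdef_adj_ge0 (mp Up) _ _.
Qed.

(** Stated for arbitrary functions, so that evaluation at [p] works on variables and never enters
    the curvature expressions. *)
Lemma eval_phi (F E E' D S1 S2 S3 S4 S5 v k : A) (x y z s1 s2 s3 s4 s5 : C) p :
  U p -> F p = x -> v p = y -> k p = z ->
  S1 p = s1 -> S2 p = s2 -> S3 p = s3 -> S4 p = s4 -> S5 p = s5 ->
  (F * E' * (- (D * E) + S1) + F * F * S2 + S3 + F * E * (- (D * E') + S4)
    - v * (D * (S5 - k))) p =
  x * E' p * (- (D p * E p) + s1) + x * x * s2 + s3 + x * E p * (- (D p * E' p) + s4)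
    - y * D p * (s5 - z).
Proof. by move=> Up <- <- <- <- <- <- <- <-; evalp Up; rewrite [v p * (_ * _)]mulrA. Qed.

Lemma no_positive_max p0 : c < 0 -> U p0 ->
  (forall q, U q -> norm_se ms mp q <= norm_se ms mp p0) ->
  norm_se ms mp p0 <= 0.
Proof.
move=> c0 Up nmax; rewrite leNgt; apply/negP.
set v0 := norm_se ms mp p0 => v00.
pose vc : A := cstf W v0%:C%C.
(* This is det h times |e|^2 / det h - v0: nonpositive, and zero at [p0]. *)
pose phi : A := e * wj WW e - vc * sD h.
have JD' := JD hJ.
have Jphi : wj WW phi = phi.
  by rewrite /phi wjD wjN !wjM wjK JD' cstf_J mulrC.
have ee q : U q -> e q * (e q)^*%C = (norm_se ms mp q)%:C%C * sD h q.
  move=> Uq; have [_ ->] := se_norm ms mp Uq.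
  by rewrite divfK // gt_eqF // (sD_gt0 ms mp Uq).
have phiE q : U q -> phi q = (norm_se ms mp q - v0)%:C%C * sD h q.
  move=> Uq; rewrite /phi; evalp Uq.
  by rewrite (wj_cinfE _ Uq) (ee _ Uq) (cstfE _ Uq) -mulrBl -rmorphB.
have phi0 : phi p0 = 0 by rewrite phiE // subrr mul0r.
have phimax q : U q -> complex.Re (phi q) <= complex.Re (phi p0).
  move=> Uq; rewrite phi0 (phiE _ Uq) Re_scale.
  have := sD_gt0 ms mp Uq; rewrite ltcE => /andP[_ /= D0].
  by rewrite pmulr_lle0 // subr_le0; exact: nmax.
have dphi k := wd_max Jphi oU Up (@subset_refl _ U) phimax k.
have Lphi := sL_max Jphi oU Up (@subset_refl _ U) phimax (mp Up)
  (fun i j => hAE ms i j Up).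
have [q0 q0D] : exists z, e p0 * (e p0)^*%C = z by eexists.
have D0 := sD_gt0 ms mp Up.
have q0E : q0 = v0%:C%C * sD h p0 by rewrite -q0D; exact: ee.
have v0C : 0 < v0%:C%C by rewrite ltcR.
have q00 : 0 < q0 by rewrite q0E mulr_gt0.
have q0J : q0^*%C = q0 by rewrite -q0D rmorphM /= conjcK mulrC.
pose J (x : A) : A := wj WW x.
have JE x : J x p0 = (x p0)^*%C by exact: wj_cinfE.
(* The critical equation d_i phi = 0, where v0 det h = |e|^2 = q0 at [p0]. *)
have Hu i : wd WW i e p0 * J e p0 = q0 * G i p0 - e p0 * c%:C%C * J (tau i) p0.
  have := dphi i; rewrite (grad_phi DD i dbar_eC (cstf_J c) (fun j => wd_cst W j _)).
  evalp Up; rewrite !(cstfE _ Up) -q0E => E.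
  by apply/eqP; rewrite -subr_eq0 -[X in _ == X]E; apply/eqP; rewrite /J; ring.
have Hu' i : J (wd WW i e) p0 * e p0 = q0 * J (G i) p0 - J e p0 * c%:C%C * tau i p0.
  have := congr1 (@conjc R) (Hu i); rewrite !JE rmorphB !rmorphM /= !conjcK oppr0.
  by rewrite q0J.
have HN a b : sN h a b p0 = _ := sNv (fun p Up i j => hAE ms i j Up) a b Up.
have LE : sL WW h phi p0 = _ := etrans (congr1 (fun x : A => cfun x p0)
    (L_phi_expanded hJ DD dbar_eC (cstf_J c) (fun j => wd_cst W j _)
      (fun j => wd_cst W j _) (cstf_J v0)))
  (eval_phi e (J e) (sD h) Up (cstfE _ Up) (cstfE _ Up) (trace_ric1_val Up) (HN _ _) (HN _ _)
     (HN _ _) (HN _ _) (HN _ _)).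
set kk : C := sD h p0 * c%:C%C + sN h eta (fun j => wj WW (eta j)) p0 in LE.
have MI := @max_identity C (m p0 i1 i1) (m p0 i1 i2) (m p0 i2 i1) (m p0 i2 i2)
  (e p0) (J e p0) q0 c%:C%C (sD h p0) kk (fun i => tau i p0)
  (fun i => J (tau i) p0) (fun i => G i p0) (fun i => J (G i) p0)
  (fun i => wd WW i e p0) (fun i => J (wd WW i e) p0) _ _
  (etrans (congr1 _ (JE e)) q0D) Hu Hu' (erefl _) (erefl _).
rewrite -q0E in LE.
have QL := etrans (congr1 (fun z => q0 * z) LE) MI.
have : q0 * sL WW h phi p0 <= 0 by rewrite pmulr_rle0.
move=> L1; suff : 0 < q0 * sL WW h phi p0 by move=> /lt_le_trans/(_ L1); rewrite ltxx.
rewrite QL pmulr_rgt0 //.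
have c0C : c%:C%C < 0 :> C by rewrite ltcR.
have Ne := sN_ge0 eta Up.
have Nt0 := posdef_adj_ge0 (mp Up) (tau i1 p0)^*%C (tau i2 p0)^*%C.
rewrite !conjcK -!JE in Nt0; rewrite /kk.
move: Nt0; set n2 := (X in 0 <= X -> _) => Nt0; move: Ne; set n1 := sN h eta _ p0 => Ne.
have cNt : 0 <= c%:C%C * c%:C%C * n2.
  by rewrite mulr_ge0 // -expr2 -rmorphXn /= lecR sqr_ge0.
have P1 : 0 < - (q0 * (sD h p0 * c%:C%C)).
  by rewrite oppr_gt0 pmulr_rlt0 // pmulr_rlt0.
have P2 : 0 <= q0 * n1 by rewrite mulr_ge0 // ltW.
(* Strict positivity comes from the term -c q0 det h alone, hence from c < 0; the |eta|^2 and
   |tau|^2 terms are nonnegative. *)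
rewrite [X in 0 < X](_ : _ = - (q0 * (sD h p0 * c%:C%C)) +
  (q0 * n1 + (c%:C%C * c%:C%C * n2 + c%:C%C * c%:C%C * n2))).
  by rewrite ltr_wpDr // addr_ge0 // addr_ge0.
rewrite /n2; ring.
Qed.

Lemma norm_se_ge0 p : U p -> 0 <= norm_se ms mp p.
Proof.
move=> Up; have [-> _] := se_norm ms mp Up.
have := sD_gt0 ms mp Up; rewrite ltcE => /andP[_ /= D0].
by rewrite divr_ge0 ?(ltW D0) // addr_ge0 // sqr_ge0.
Qed.

End ConstantFactor.

Lemma ric34_torsion_free (A : comPzRingType) (W : wirtinger A 2)
    (h : 'I_2 -> 'I_2 -> A) (Di : A) :
  (forall i j, wj W (h i j) = h j i) -> sD h * Di = 1 ->
  (forall l, stau W h l = 0) ->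
  forall i j, sric3 W h Di i j = sric1 W h Di i j /\
              sric4 W h Di i j = sric1 W h Di i j.
Proof.
move=> hJ DDi t0 i j.
have e0 k : seta W h Di k = 0 by rewrite setaE !t0 !mul0r subr0 mul0r.
by rewrite (sric3E hJ DDi) (sric4E W DDi) (sric1E W DDi) !e0 wj0 wd0 wb0 !addr0.
Qed.

(** * Consequences of vanishing torsion *)

Section TorsionFree.
Variables (R : realType) (W : opens R 2) (m : cspace R 2 -> 'M[R[i]]_2).
Local Notation C := R[i].
Local Notation U := (opset W).
Local Notation A := (cinfty W).
Local Notation WW := (cinf_wirtinger W).
Hypothesis ms : forall i j, csmooth U (coef m i j).
Hypothesis mp : forall p, U p -> hermitian_posdef (m p).
Local Notation h := (hA ms).
Local Notation Di := (DiA ms mp).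
Local Notation e := (se WW h Di).
Local Notation tau := (stau WW h).
Let hJ := hA_J ms mp.
Let DD := DDiA ms mp.

Lemma stau_dclosed : (forall p, U p -> dclosed_at m p) -> forall l, tau l = 0.
Proof.
move=> dc l; rewrite stauE; apply: cinf_ext => p Up; evalp Up.
have [d1 _] := dc p Up; rewrite (wd_hA ms i1 i2 l Up) (wd_hA ms i2 i1 l Up) d1 subrr.
exact: (esym (cf0 Up)).
Qed.

Lemma dclosed_stau : (forall l, tau l = 0) -> forall p, U p -> dclosed_at m p.
Proof.
move=> t0 p Up.
have t i k l : wd WW i (h k l) = wd WW k (h i l).
  have E : wd WW i1 (h i2 l) = wd WW i2 (h i1 l).
    by apply/eqP; rewrite -subr_eq0 -stauE t0.
  by move: i k; do 2 (apply: ord2P).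
(* Hermitian symmetry of h makes the dbar half of closedness the conjugate of the d half. *)
have tb k j l : wb WW j (h k l) = wb WW l (h k j) by rewrite !wbE !hJ t.
split=> [i k l|k j l].
  by rewrite -(wd_hA ms i k l Up) -(wd_hA ms k i l Up) t.
by rewrite -(wb_hA ms j k l Up) -(wb_hA ms l k j Up) tb.
Qed.

Variable c : R.
Hypothesis fe : forall p, U p -> forall i j,
  chern_ricci3 m p i j + chern_ricci4 m p i j = c%:C%C * m p i j.

Lemma stau0_of_norm_se0 : c != 0 -> (forall p, U p -> norm_se ms mp p = 0) ->
  forall l, tau l = 0.
Proof.
move=> c0 n0 l.
have e0 : e = 0.
  apply: cinf_ext => p Up; apply: etrans (esym (cf0 Up)).
  have [_] := se_norm ms mp Up; rewrite (n0 _ Up) => /esym/eqP.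
  rewrite mulf_eq0 invr_eq0 (gt_eqF (sD_gt0 ms mp Up)) orbF mulf_eq0 conjc_eq0 orbb.
  by move/eqP.
have := dbar_eC ms mp fe l; rewrite e0 wb0 => E.
apply: cinf_ext => p Up; apply: etrans (esym (cf0 Up)).
have := congr1 (fun x : A => cfun x p) E; rewrite (cf0 Up) (cfM _ _ Up) (cstfE _ Up).
move=> /esym/eqP; rewrite mulf_eq0 => /orP[|/eqP //].
by rewrite eq_complex /= (negbTE c0).
Qed.

Hypothesis t0 : forall l, tau l = 0.

Lemma ricci1_torsion_free p i j : U p ->
  chern_ricci1 m p i j = (c / 2)%:C%C * m p i j.
Proof.
move=> Up; have := fe Up i j.
rewrite (chern_ricci3E ms mp _ _ Up) (chern_ricci4E ms mp _ _ Up).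
have [-> ->] := ric34_torsion_free hJ DD t0 i j.
rewrite -(chern_ricci1E ms mp _ _ Up); set r := chern_ricci1 _ _ _ _; set x := m p i j.
rewrite {1}(splitr c) rmorphD mulrDl -!mulr2n => /eqP.
by rewrite eqrMn2r //= => /eqP.
Qed.

Lemma scalar1_torsion_free p : U p -> chern_scalar1 m p = c%:C%C.
Proof.
move=> Up; rewrite (chern_scalar1E ms mp Up).
set S := \sum_i _.
have E : S + S = cstf W c%:C%C + cstf W c%:C%C.
  apply: etrans (trace_h DD _).
  rewrite -big_split /=; apply: eq_bigr => i _; rewrite -big_split /=.
  apply: eq_bigr => j _; rewrite -(einC ms mp fe) -mulrDr.
  by have [-> ->] := ric34_torsion_free hJ DD t0 i j.
have := congr1 (fun x : A => cfun x p) E; evalp Up; rewrite -!mulr2n => /eqP.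
by rewrite eqrMn2r //= => /eqP ->; exact: cstfE.
Qed.

End TorsionFree.
Lemma norm_se_smooth (R : realType) (W : opens R 2) (m : cspace R 2 -> 'M[R[i]]_2)
    (ms : forall i j, csmooth (opset W) (coef m i j))
    (mp : forall p, opset W p -> hermitian_posdef (m p)) :
  smooth (opset W) (norm_se ms mp).
Proof. exact: (cfun_smooth (_ : cinfty W)).1. Qed.

(** * Invariance of |e|^2 / det h under transition maps *)

Section LocalPullback.
Variables (R : realType) (W W' : opens R 2) (m m' : cspace R 2 -> 'M[R[i]]_2).
Local Notation V := (cspace R 2).
Local Notation C := R[i].
Local Notation U := (opset W).
Local Notation U' := (opset W').
Local Notation A := (cinfty W).
Local Notation WW := (cinf_wirtinger W).
Hypothesis ms : forall i j, csmooth U (coef m i j).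
Hypothesis mp : forall p, U p -> hermitian_posdef (m p).
Hypothesis ms' : forall i j, csmooth U' (coef m' i j).
Hypothesis mp' : forall p, U' p -> hermitian_posdef (m' p).
Variable phi : V -> V.
Hypothesis phiW : forall p, U p -> U' (phi p).
Hypothesis phiC : forall p, U p -> {for p, continuous phi}.
Hypothesis phiS : forall k, holomorphic U (fun p => zcoord k (phi p)).
Hypothesis mE : forall p, U p -> forall i j, m p i j =
  \sum_k \sum_l dz i (fun q => zcoord k (phi q)) p *
    (dz j (fun q => zcoord l (phi q)) p)^*%C * m' (phi p) k l.

Lemma norm_se_local_pullback p : U p -> norm_se ms mp p = norm_se ms' mp' (phi p).
Proof.
move=> Up; pose P := pb phiW phiC phiS; pose jac := jacf phiS.
have PD : forall x y, P (x + y) = P x + P y by exact: pbD.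
have PM : forall x y, P (x * y) = P x * P y by exact: pbM.
have P1 : P 1 = 1 by exact: pb1.
have PJ x : P (wj (cinf_wirtinger W') x) = wj WW (P x).
  by rewrite !cinf_wj; exact: pbJ.
have Pd k x : wd WW k (P x) = \sum_c jac c k * P (wd (cinf_wirtinger W') c x).
  exact: pb_chain.
have jh k a i : wb WW k (jac a i) = 0 by rewrite wbE; exact: jacf_hol.
have jsym a : wd WW i1 (jac a i2) = wd WW i2 (jac a i1) by exact: wdC.
have hE i j : hA ms i j =
    \sum_a \sum_c jac a i * wj WW (jac c j) * P (hA ms' a c).
  apply: cinf_ext => q Uq; rewrite (hAE ms i j Uq) (mE Uq).
  apply: etrans (esym (cf_sum _ _ Uq)); apply: eq_bigr => a _.
  apply: etrans (esym (cf_sum _ _ Uq)); apply: eq_bigr => b _.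
  apply: etrans (esym (cfM _ _ Uq)); apply: (f_equal2 *%R); last first.
    by apply: etrans (esym (pbE _ _ _ _ Uq)); rewrite (hAE ms' _ _ (phiW Uq)).
  apply: etrans (esym (cfM _ _ Uq)); apply: (f_equal2 *%R).
    exact: (esym (jacfE _ _ _ Uq)).
  by apply: etrans (esym (wj_cinfE _ Uq)); rewrite (jacfE _ _ _ Uq).
have := norm_se_pullback PD PM P1 PJ Pd jh jsym (DDiA ms mp)
  (DDiA ms' mp') hE.
move=> /(congr1 (fun x : A => complex.Re (cfun x p))) E.
by apply: (etrans E); rewrite (pbE _ _ _ _ Up).
Qed.

End LocalPullback.

(** * Globalization *)

Section Charts.
Variables (R : realType) (n : nat) (T : topologicalType).
Implicit Types c : chart R n T.

Definition chart_opens c : opens R n := Opens (@chart_img_open R n T c).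

Lemma overlap_open c c' : open (overlap c c').
Proof.
rewrite openE => p [cp dp]; apply: filterI.
  exact: (open_nbhs_nbhs (conj (@chart_img_open _ _ _ c) cp)).
apply: (@chart_inv_continuous _ _ _ c p cp).
exact: (open_nbhs_nbhs (conj (@chart_dom_open _ _ _ c') dp)).
Qed.

Definition overlap_opens c c' : opens R n := Opens (@overlap_open c c').

Lemma transition_continuous c c' p : overlap c c' p ->
  {for p, continuous (transition c c')}.
Proof.
move=> [cp dp]; apply: continuous_comp; first exact: (@chart_inv_continuous _ _ _ c).
exact: (@chart_map_continuous _ _ _ c').
Qed.

Lemma overlap_refl c c' p : overlap c c' p -> overlap c c p.
Proof. by move=> [cp _]; split => //; exact: chart_inv_dom. Qed.

Lemma transition_refl c p : chart_img c p -> transition c c p = p.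
Proof. exact: chart_invK. Qed.

Lemma transition_img c c' p : overlap c c' p -> chart_img c' (transition c c' p).
Proof. by move=> [_ dp]; exact: chart_map_img. Qed.

End Charts.

Lemma csmooth_sub (R : realType) n (U U' : set (cspace R n)) (F : cspace R n -> R[i]) :
  U' `<=` U -> csmooth U F -> csmooth U' F.
Proof. by move=> s [s1 s2]; split=> k; apply: (Ck_sub s); [exact: s1|exact: s2]. Qed.

Lemma continuous_of_charts (R : realType) n (M : complex_manifold R n) (g : M -> R) :
  (forall c, atlas c -> forall p, chart_img c p ->
     {for p, continuous (fun q => g (chart_inv c q))}) ->
  continuous g.
Proof.
move=> gc x; have [c ac dx] := atlas_cover x.
have E : \forall y \near x, g (chart_inv c (chart_map c y)) = g y.
  apply: filterS (open_nbhs_nbhs (conj (@chart_dom_open _ _ _ c) dx)) => y dy.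
  by rewrite chart_mapK.
have C : {for x, continuous ((fun q => g (chart_inv c q)) \o chart_map c)}.
  apply: continuous_comp; first exact: (@chart_map_continuous _ _ _ c).
  exact: (gc _ ac _ (chart_map_img dx)).
move: C; rewrite /prop_for /continuous_at /= chart_mapK // => C.
by apply: cvg_trans C; apply: near_eq_cvg; apply: filterS E => y.
Qed.

Section GlobalMetric.
Variables (R : realType) (M : complex_manifold R 2) (w : hermitian_metric M).

Definition chart_norm_se (c : chart R 2 M) (ac : atlas c) (p : cspace R 2) : R :=
  norm_se (W := chart_opens c) (metric_smooth w ac) (metric_posdef w ac) p.

Lemma norm_se_overlap (W : opens R 2) (c c' : chart R 2 M) (ac : atlas c)
    (ac' : atlas c') (ms : forall i j, csmooth (opset W) (coef (metric w c) i j))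
    (mp : forall p, opset W p -> hermitian_posdef (metric w c p)) p :
  opset W `<=` overlap c c' -> opset W p ->
  norm_se ms mp p = chart_norm_se ac' (transition c c' p).
Proof.
move=> s Wp; apply: (norm_se_local_pullback _ _ _ _ _ _ _ _ Wp).
- by move=> q /s; exact: (@transition_img _ _ _ c c').
- by move=> q /s; exact: (@transition_continuous _ _ _ c c').
- move=> k; have [hs hd] := atlas_holomorphic ac ac' k; split.
    exact: csmooth_sub hs.
  by move=> q /s; exact: hd.
- by move=> q /s; exact: (metric_compat w ac ac').
Qed.

Lemma chart_norm_se_transition (c c' : chart R 2 M) (ac : atlas c) (ac' : atlas c') p :
  overlap c c' p -> chart_norm_se ac p = chart_norm_se ac' (transition c c' p).
Proof.
move=> op; pose W := overlap_opens c c'.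
have ms i j : csmooth (opset W) (coef (metric w c) i j).
  by apply: csmooth_sub (metric_smooth w ac i j) => q [].
have mp q : opset W q -> hermitian_posdef (metric w c q).
  by move=> [+ _]; exact: (metric_posdef w ac).
(* Both sides are compared with the metric restricted to the overlap; the chart [c] enters through
   its own transition, the identity. *)
rewrite -(norm_se_overlap ac ac' ms mp (@subset_refl _ _) op).
rewrite (norm_se_overlap ac ac ms mp _ op) ?transition_refl //; first by case: op.
by move=> q; exact: overlap_refl.
Qed.

Lemma global_norm_se : exists2 v : M -> R, continuous v &
  forall c (ac : atlas c) p, chart_img c p -> v (chart_inv c p) = chart_norm_se ac p.
Proof.
(* Choosing a chart at each point defines the function; invariance under transitions identifies it
   with the local expression in every chart, hence its continuity. *)
have [ch chP] : exists ch : M -> chart R 2 M,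
    forall x, atlas (ch x) /\ chart_dom (ch x) x.
  have chx (x : M) : {c : chart R 2 M | atlas c /\ chart_dom c x}.
    by apply: cid; have [c ac dc] := atlas_cover x; exists c.
  by exists (fun x => sval (chx x)) => x; exact: svalP (chx x).
pose v x := chart_norm_se (proj1 (chP x)) (chart_map (ch x) x).
have vE c (ac : atlas c) p : chart_img c p ->
    v (chart_inv c p) = chart_norm_se ac p.
  move=> cp; have [ac' dc'] := chP (chart_inv c p).
  rewrite (@chart_norm_se_transition c (ch (chart_inv c p)) ac ac') //.
  by rewrite /v (Prop_irrelevance (proj1 _) ac').
exists v => //; apply: continuous_of_charts => c ac p cp.
have vs := norm_se_smooth (W := chart_opens c) (metric_smooth w ac) (metric_posdef w ac) 0%N.
apply: near_eq_cont (Ck_cont vs cp).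
apply: filterS (open_nbhs_nbhs (conj (@chart_img_open _ _ _ c) cp)) => q cq.
by rewrite vE.
Qed.

Hypothesis M_compact : compact [set: M].
Hypothesis w_gauduchon : gauduchon w.

Lemma compact_max (g : M -> R) : continuous g -> exists x, forall y, g y <= g x.
Proof.
move=> gc; have [x _ xm] := compact_EVT_max (carrier_nonempty M) M_compact
  (continuous_subspaceT gc).
by exists x => y; apply: xm; rewrite inE.
Qed.

Variable f : M -> R.
Hypothesis f_smooth : smooth_function f.
Hypothesis ricci_eq : chern_ricci34_eq w f.

(** The level set of the maximum is nonempty by compactness, open by the strong maximum principle
    and closed by continuity, so connectedness makes it all of M. *)
Lemma conformal_factor_constant : exists a, forall x, f x = a.
Proof.
have fc : continuous f.
  by apply: continuous_of_charts => c ac p cp; exact: (Ck_cont (f_smooth ac 0%N) cp).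
have [x0 xm] := compact_max fc; exists (f x0) => x.
have : [set y | f y = f x0] = [set: M]; last by move=> /seteqP[_ /(_ x I)].
apply: (@carrier_connected R 2 M); first by exists x0.
- exists [set y | f y = f x0]; last by rewrite setTI.
  rewrite openE => y fy; have [c ac dy] := atlas_cover y.
  have N : \forall q \near chart_map c y, f (chart_inv c q) = f x0.
    apply: (@local_strong_maximum R (chart_opens c) (metric w c) (metric_smooth w ac)
      (metric_posdef w ac) (w_gauduchon ac) (fun q => f (chart_inv c q))
      (f_smooth ac) (ricci_eq ac)).
    + by move=> q _; exact: xm.
    + exact: chart_map_img.
    + by rewrite chart_mapK.
  have nd := open_nbhs_nbhs (conj (@chart_dom_open _ _ _ c) dy).
  have := @chart_map_continuous _ _ _ c y dy _ N.
  apply: filterS2 nd => z dz /=; by rewrite chart_mapK.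
- exists [set y | f y = f x0]; last by rewrite setTI.
  by apply: (@preimage_closed _ _ f [set f x0]); [|exact: closed_eq].
Qed.

End GlobalMetric.
Theorem corollary1p6 (R : realType) (M : complex_manifold R 2)
    (w : hermitian_metric M)
    (M_compact : compact [set: M])
    (w_gauduchon : gauduchon w)
    (f : M -> R) (f_smooth : smooth_function f)
    (f_le0 : forall x : M, f x <= 0)
    (ricci_eq : chern_ricci34_eq w f) :
  exactly_one (chern_scalar2_vanishes w)
    (kahler_einstein w /\ negative_scalar_curvature w).
Proof.
have [a fa] := conformal_factor_constant M_compact w_gauduchon f_smooth ricci_eq.
have [x0 _] := carrier_nonempty M.
have [c0 ac0 dx0] := atlas_cover x0; have cp0 := chart_map_img dx0.
have aE c (ac : atlas c) p (cp : opset (chart_opens c) p) i j :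
    chern_ricci3 (metric w c) p i j + chern_ricci4 (metric w c) p i j =
    a%:C%C * metric w c p i j.
  by rewrite (ricci_eq c ac p cp) fa.
have S2 c (ac : atlas c) p : chart_img c p -> chern_scalar2 (metric w c) p = a%:C%C.
  move=> cp; apply: (etrans (scalar2_eq_f (W := chart_opens c) (metric_smooth w ac)
    (metric_posdef w ac) (f_smooth c ac) (ricci_eq c ac) cp)).
  by rewrite fa.
have : a <= 0 by rewrite -(fa x0).
rewrite le_eqVlt => /predU1P[a0|a0].
  left; split=> [c ac p cp|[[K _] neg]]; first by rewrite (S2 _ ac) // a0.
  (* The second alternative is impossible for a = 0: a Kähler metric has no torsion, so its Chern
     scalar curvature is a = 0, which is not negative. *)
  have t0 l : stau (cinf_wirtinger (chart_opens c0))
      (hA (W := chart_opens c0) (metric_smooth w ac0)) l = 0.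
    by apply: (stau_dclosed (W := chart_opens c0)) => p; exact: K.
  have := neg _ ac0 _ cp0.
  rewrite (scalar1_torsion_free (W := chart_opens c0) (metric_posdef w ac0) (aE _ ac0) t0 cp0).
  by rewrite a0 ltxx.
right; split.
  move=> /(_ _ ac0 _ cp0); rewrite (S2 _ ac0) // => /eqP.
  by rewrite eq_complex /= (lt_eqF a0).
have [v vc vE] := global_norm_se w.
have [x1 x1max] := compact_max M_compact vc.
(* The global maximum point of |e|^2 / det h is a maximum in any chart around it, where a positive
   value is excluded. *)
have v0 x : v x <= 0.
  apply: (le_trans (x1max x)).
  have [c ac dx] := atlas_cover x1; have cp := chart_map_img dx.
  rewrite -(chart_mapK dx) (vE _ ac _ cp).
  apply: (no_positive_max (W := chart_opens c) (w_gauduchon c ac) (aE _ ac) a0 cp).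
  move=> q cq; rewrite -/(chart_norm_se w ac q) -/(chart_norm_se w ac (chart_map c x1)).
  by rewrite -!vE // chart_mapK.
have t0 c (ac : atlas c) l :
    stau (cinf_wirtinger (chart_opens c)) (hA (W := chart_opens c) (metric_smooth w ac)) l = 0.
  apply: (stau0_of_norm_se0 (W := chart_opens c) (mp := metric_posdef w ac) (aE _ ac)); first by rewrite lt_eqF.
  move=> p cp; apply/eqP; rewrite eq_le; apply/andP; split; last exact: norm_se_ge0.
  by have := v0 (chart_inv c p); rewrite (vE _ ac).
split; last first.
  move=> c ac p cp; rewrite (scalar1_torsion_free (W := chart_opens c)
    (metric_posdef w ac) (aE _ ac) (t0 _ ac) cp).
  by rewrite ltcR.
split=> [c ac p cp|].
  exact: (dclosed_stau (W := chart_opens c) (metric_posdef w ac) (t0 _ ac) cp).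
exists (a / 2) => c ac p cp i j.
exact: (ricci1_torsion_free (W := chart_opens c) (metric_posdef w ac) (aE _ ac) (t0 _ ac) _ _ cp).
Qed.
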